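(* Let $d\ge 1$ and let $p,q>0$ with $pq>1$. (i) For every $\delta>0$ there is a constant $C=C(p,q,d,\delta)<\infty$ such that whenever $A,B\subseteq\mathbf{R}^d$ are closed discrete sets with $A$ $(p,\delta)$-dense and $B$ $(q,\delta)$-dense, $\operatorname{Ker}\mathcal{F}_{A,B}$ is finite-dimensional of dimension at most $C$, and $\operatorname{Coker}\mathcal{F}_{A,B}$ is infinite-dimensional. (ii) There is $\delta_0=\delta_0(p,q,d)>0$ such that if $0<\delta\le\delta_0$, then for all closed discrete $A,B\subseteq\mathbf{R}^d$ with $A$ $(p,\delta)$-dense and $B$ $(q,\delta)$-dense, the map $\mathcal{F}_{A,B}$ is injective.
   Context: Write $\langle x\rangle=\sqrt{1+|x|^2}$, and let $B_R(x)$ be the open ball of radius $R$ about $x$. For $p\ge0$, $\delta>0$, a set $S\subseteq\mathbf{R}^d$ is $(p,\delta)$-dense if the balls $B_{\delta\langle x\rangle^{-p}}(x)$, $x\in S$, cover $\mathbf{R}^d$. The Fourier transform is $\hat f(\xi)=\int_{\mathbf{R}^d}f(x)e^{-2\pi i x\cdot\xi}\,dx$. For a closed discrete set $A\subseteq\mathbf{R}^d$, $\mathcal{S}(A)$ is the space of rapidly decreasing sequences on $A$, i.e. functions $\alpha:A\to\mathbf{C}$ with $\sup_{a\in A}|\alpha(a)|\langle a\rangle^j<\infty$ for all $j\in\mathbf{N}$. For closed discrete $A,B\subseteq\mathbf{R}^d$, $\mathcal{F}_{A,B}:\mathcal{S}(\mathbf{R}^d)\to\mathcal{S}(A)\oplus\mathcal{S}(B)$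 is the linear map $f\mapsto(f|_A,\hat f|_B)$ on Schwartz functions. $\operatorname{Ker}$ is its kernel and $\operatorname{Coker}$ is the quotient of the target vector space by the image. *)

(* Defs.v *)
From HB Require Import structures.
From mathcomp Require Import all_boot all_order all_algebra.
From mathcomp Require Import all_classical all_reals all_analysis.
From mathcomp Require Import complex.
Import Order.TTheory GRing.Theory Num.Theory.
Import numFieldNormedType.Exports numFieldTopology.Exports.

Set Implicit Arguments.
Unset Strict Implicit.
Unset Printing Implicit Defensive.

Local Open Scope classical_set_scope.
Local Open Scope ring_scope.
Local Open Scope complex_scope.

Section LebesgueMeasureRn.
Variable R : realType.
Local Notation T := (measurableTypeR R).
Local Open Scope ereal_scope.

Definition cons_pair n (x : T * n.-tuple T) : n.+1.-tuple T :=
  [tuple of x.1 :: x.2].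

Lemma measurable_cons_pair n :
  measurable_fun [set: T * n.-tuple T] (@cons_pair n).
Proof. exact: (@measurable_cons _ _ (T * n.-tuple T)%type T fst n snd). Qed.

HB.instance Definition _ n := isMeasurableFun.Build _ _
  (T * n.-tuple T)%type (n.+1.-tuple T) (@cons_pair n) (@measurable_cons_pair n).

Section step.
Variables (n : nat) (mu : {sigma_finite_measure set (n.-tuple T) -> \bar R}).

Definition lebesgue_cons : set (n.+1.-tuple T) -> \bar R :=
  pushforward (@lebesgue_measure R \x mu) (@cons_pair n).

Let lebesgue_cons0 : lebesgue_cons set0 = 0.
Proof. exact: measure0. Qed.

Let lebesgue_cons_ge0 A : 0 <= lebesgue_cons A.
Proof. exact: measure_ge0. Qed.

Let lebesgue_cons_sigma_additive : semi_sigma_additive lebesgue_cons.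
Proof. exact: measure_semi_sigma_additive. Qed.

HB.instance Definition _ := isMeasure.Build _ _ _ lebesgue_cons
  lebesgue_cons0 lebesgue_cons_ge0 lebesgue_cons_sigma_additive.

Let lebesgue_cons_sigma_finite : sigma_finite setT lebesgue_cons.
Proof.
pose uncons (t : n.+1.-tuple T) : T * n.-tuple T :=
  (thead t, [tuple of behead t]).
have muncons : measurable_fun setT uncons.
  apply/measurable_fun_pairP; split; first exact: measurable_tnth.
  exact: measurable_behead.
have consK : cancel (@cons_pair n) uncons.
  case=> x t; rewrite /uncons /cons_pair /=; congr pair.
  exact: val_inj.
have [F FT Foo] : sigma_finite setT (@lebesgue_measure R \x mu).
  have /sigma_finiteP[F [FT ndF Foo]] := @sigma_finiteT _ _ _ (@lebesgue_measure R).
  have /sigma_finiteP[G [GT ndG Goo]] := @sigma_finiteT _ _ _ mu.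
  exists (fun k => F k `*` G k).
    rewrite -setXTT FT GT predeqE => -[x y]; split.
      move=> [/= [k _ Fkx] [l _ Gly]]; exists (maxn k l) => //; split.
      - by move: x Fkx; exact/subsetPset/ndF/leq_maxl.
      - by move: y Gly; exact/subsetPset/ndG/leq_maxr.
    by move=> [k _ []/= ? ?]; split; exists k.
  move=> k; have [? ?] := Foo k; have [? ?] := Goo k.
  split; first exact: measurableX.
  by rewrite product_measure1E// lte_mul_pinfty// ge0_fin_numE.
exists (fun i => uncons @^-1` F i).
  by rewrite -preimage_bigcup -FT preimage_setT.
move=> i; have [mF Fi] := Foo i; split.
  by rewrite -[X in measurable X]setTI; exact: muncons.
rewrite /lebesgue_cons /pushforward -comp_preimage.
rewrite (_ : uncons \o _ = id) ?preimage_id//.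
by apply/funext => x /=; exact: consK.
Qed.

HB.instance Definition _ := Measure_isSigmaFinite.Build _ _ _ lebesgue_cons
  lebesgue_cons_sigma_finite.

End step.

(** Lebesgue measure on R^n, carried by n-tuples (the library's measurable
    structure for R^n): the n-fold product of Lebesgue measure on R, where
    R * R^n is transported to R^(n+1) along [cons]. *)
Fixpoint lebesgue_tuple n : {sigma_finite_measure set (n.-tuple T) -> \bar R} :=
  match n with
  | 0 => dirac [tuple]
  | n'.+1 => lebesgue_cons (lebesgue_tuple n')
  end.

End LebesgueMeasureRn.

Section Schwartz.
Variables (R : realType) (d : nat).
Implicit Types (x y xi : 'rV[R]_d) (f : 'rV[R]_d -> R[i]) (S A B : set 'rV[R]_d).

Definition dotp x y : R := \sum_i x ord0 i * y ord0 i.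

(* The library's norm on ['rV[R]_d] is the sup norm. *)
Definition enorm x : R := Num.sqrt (dotp x x).

Definition jbracket x : R := Num.sqrt (1 + enorm x ^+ 2).

Definition eball x (r : R) : set 'rV[R]_d := [set y | enorm (y - x) < r].

Definition pdense (p delta : R) S :=
  \bigcup_(x in S) eball x (delta * jbracket x `^ (- p)) = setT.

Definition closed_discrete A := closed A /\ A `<=` isolated A.

(* [R[i]] is not a normed space over [R] in the library, so differentiation of
   complex-valued functions of a real vector is taken on real and imaginary
   parts. *)
Definition cdifferentiable f :=
  forall x, differentiable (fun y => complex.Re (f y)) x /\
            differentiable (fun y => complex.Im (f y)) x.

Definition cpartial (i : 'I_d) f : 'rV[R]_d -> R[i] := fun x =>
  'D_(delta_mx ord0 i) (fun y => complex.Re (f y)) x +i*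
  'D_(delta_mx ord0 i) (fun y => complex.Im (f y)) x.

(* [s] lists the directions of differentiation: the multi-index of order
   [size s] whose i-th entry is [count_mem i s]. *)
Definition cpartials (s : seq 'I_d) f := foldr cpartial f s.

Definition schwartz : set ('rV[R]_d -> R[i]) := [set f | forall s : seq 'I_d,
  cdifferentiable (cpartials s f) /\
  forall k : nat, exists M : R, forall x,
    jbracket x ^+ k * Normc.normc (cpartials s f x) <= M].

Definition cis (t : R) : R[i] := cos t +i* sin t.

Definition row_of_tuple (t : d.-tuple (measurableTypeR R)) : 'rV[R]_d :=
  \row_i tnth t i.

Definition cintegral f : R[i] :=
  Rintegral (lebesgue_tuple R d) setT (fun t => complex.Re (f (row_of_tuple t))) +i*
  Rintegral (lebesgue_tuple R d) setT (fun t => complex.Im (f (row_of_tuple t))).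

Definition fourier f : 'rV[R]_d -> R[i] := fun xi =>
  cintegral (fun x => f x * cis (- (2 * pi * dotp x xi))).

Definition rapid A : set (A -> R[i]) := [set alpha | forall j : nat,
  exists M : R, forall a : A,
    Normc.normc (alpha a) * jbracket (set_val a) ^+ j <= M].

Definition FAB A B f : (A -> R[i]) * (B -> R[i]) :=
  (fun a => f (set_val a), fun b => fourier f (set_val b)).

(* [FAB A B] is typed into all pairs of sequences; [FAB_target A B] is the
   subspace S(A) (+) S(B), which contains the image of [schwartz]. *)
Definition FAB_target A B : set ((A -> R[i]) * (B -> R[i])) :=
  [set ab | rapid ab.1 /\ rapid ab.2].

Definition FAB_ker A B : set ('rV[R]_d -> R[i]) :=
  schwartz `&` [set f | FAB A B f = 0].

Definition FAB_image A B : set ((A -> R[i]) * (B -> R[i])) :=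
  FAB A B @` schwartz.

End Schwartz.

Arguments rapid {R d} A _.
Arguments FAB {R d} A B f.
Arguments FAB_target {R d} A B _.
Arguments FAB_image {R d} A B _.
Arguments FAB_ker {R d} A B _.
Arguments schwartz {R d} _.

Section Dimension.
Variables (K : fieldType) (V : lmodType K).
Implicit Types (U W : set V).

Definition dim_le W (N : nat) := exists n (b : 'I_n -> V),
  [/\ (n <= N)%N,
      forall i, W (b i),
      forall c : 'I_n -> K, \sum_i c i *: b i = 0 -> forall i, c i = 0 &
      forall v, W v -> exists c : 'I_n -> K, v = \sum_i c i *: b i].

(* The classes of the [u i] span the quotient [U / W], so that [U / W] is
   finite-dimensional. *)
Definition quotient_finite_dim U W := exists n (u : 'I_n -> V),
  (forall i, U (u i)) /\
  forall v, U v -> exists c : 'I_n -> K, W (v - \sum_i c i *: u i).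

End Dimension.

(* Main.v *)
Require Import Defs.
From mathcomp Require Import all_boot all_order all_algebra.
From mathcomp Require Import all_classical all_reals all_analysis.
From mathcomp Require Import complex measurable_realfun.
From mathcomp Require Import qpoly ring lra.
Import Order.TTheory GRing.Theory Num.Theory.
Import numFieldNormedType.Exports numFieldTopology.Exports.

Set Implicit Arguments.
Unset Strict Implicit.
Unset Printing Implicit Defensive.

Local Open Scope classical_set_scope.
Local Open Scope ring_scope.

(** The dense set [A] controls [f] by the smoothness of [f], and the smoothness
    of [f] is the decay of its transform.  Suppose that [f] vanishes on a
    (p, delta)-dense set.  Every [x] has a zero [y] of [f] at distance at most
    of order delta <x>^-p.  By Fourier inversion [f] is a superposition of
    waves, so on a segment of the line through [x] and [y] it differs from a
    polynomial of degree less than k by at most a constant times (length)^k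
    times the integral of |xi|^k |f^|.  Lagrange interpolation at nodes [x + j v], with
    [v = K (y - x)], therefore expresses [f x = f x - f y] by the values of [f]
    at the nodes, with weights of size O(1/K) because a polynomial changes
    little between the parameters 0 and 1/K.  For large K these values are
    absorbed into the supremum being estimated, and

      sup <x>^(p k) |f|  <=  C delta^k sup <xi>^(k + 2 d) |f^| ,

    where the 2 d extra powers pay for integrability ([trig_interpolation],
    [vanish_decay]).  Exchanging the roles of [f] and its transform,

      sup <xi>^(q m) |f^|  <=  C delta^m sup <x>^(m + 2 d) |f| .

    As p q > 1 there are k, m with q m >= k + 2 d and p k >= m + 2 d
    ([exponents_exist]).  The composition of both estimates bounds
    sup <x>^(p k) |f| by a constant times delta^(k + m) times itself, so [f = 0]
    once delta is small ([schwartz_uniqueness]).  This is part (ii).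

    For the kernel in part (i), replace p, q by slightly smaller exponents whose
    product still exceeds 1.  Far out a (p, delta)-dense set is as dense as one
    likes for the smaller exponent, and near the origin a finite set of points
    that depends on the parameters only repairs the density ([finite_net]).
    The uniqueness result applies to the enlarged sets, so an element of the
    kernel is determined by its values, and those of its transform, at finitely
    many fixed points ([dense_functionals]); their number bounds the dimension.

    For the cokernel, infinitely many points [a i] can be removed from [A]
    without spoiling its density, only enlarging delta ([sparse_removal]).
    If n classes spanned the cokernel, the indicator of each [a i] would be an
    image plus a combination of the n representatives.  Among n + N + 1 of
    these relations, N being the number of functionals just found for the
    larger delta, a nontrivial combination kills the n representatives and the
    N functionals.  The same combination of the Schwartz functions involved
    vanishes on the thinned set, has a transform that vanishes on [B], and is
    annihilated by the N functionals; hence it is zero, although its value at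
    some [a i] is not ([coker_infinite]).

    Everything rests on Fourier inversion for Schwartz functions
    ([fourier_inversion]) and on the decay of the transform
    ([fourier_decay]).  Inversion is obtained by damping the inverse integral
    with prod_i exp(-e |xi_i|), whose transform is a product of Poisson kernels;
    Fubini turns the damped integral into an average of [f] against these
    kernels, which tends to [f] as e -> 0.  The decay is integration by parts. *)

(** * One-dimensional integrals *)

Section OneDim.
Variable R : realType.
Local Notation mu := (@lebesgue_measure R).

Lemma integrable_oneDsqr : mu.-integrable setT (fun s : R => ((1 + s ^+ 2)^-1)%:E).
Proof.
have cE : continuous (fun s : R => (1 + s ^+ 2)^-1).
  move=> s; apply: cvgV; first by rewrite gt_eqF// ltr_pwDl// sqr_ge0.
  by apply: cvgD; [exact: cvg_cst|apply: exprn_continuous].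
have mE : measurable_fun [set: R] (fun s : R => (1 + s ^+ 2)^-1).
  exact: continuous_measurable_fun.
apply/integrableP; split; first exact/measurable_EFinP.
have E0 (s : R) : 0 <= (1 + s ^+ 2)^-1 by rewrite invr_ge0 addr_ge0// sqr_ge0.
under eq_integral do rewrite gee0_abs ?lee_fin//.
rewrite ge0_symfun_integralT//; last by move=> s /=; rewrite sqrrN.
rewrite -set_itvcy.
rewrite [X in (2 * X)%E](_ : _ = (pi / 2)%:E) -?EFinM ?ltry//.
by rewrite -integral0y_oneDsqr.
Qed.

(** Separate antiderivatives on the two half-lines allow a corner of the
    integrand at 0, as in exp(-e|s|). The integrals over [-n, n] are
    evaluated by the fundamental theorem and converge by domination. *)
Lemma integral_FTC_R (f F1 F2 : R -> R) (l1 l2 : R) :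
  continuous f -> mu.-integrable setT (EFin \o f) ->
  continuous F1 -> continuous F2 ->
  (forall s : R, 0 < s -> is_derive s 1 F1 (f s)) ->
  (forall s : R, s < 0 -> is_derive s 1 F2 (f s)) ->
  F1 n%:R @[n --> \oo] --> l1 ->
  F2 (- n%:R) @[n --> \oo] --> l2 ->
  Rintegral mu setT f = (l1 - F1 0) + (F2 0 - l2).
Proof.
move=> cf intf cF1 cF2 dF1 dF2 F1l F2l.
pose f_ n := f \_ `[- n.+1%:R, n.+1%:R].
have mf : measurable_fun setT f by exact: continuous_measurable_fun.
have intfn n : (\int[mu]_x (f_ n x)%:E = ((F1 n.+1%:R - F1 0) + (F2 0 - F2 (- n.+1%:R)))%:E)%E.
  rewrite /f_.
  rewrite (_ : (fun x => _) = (EFin \o f) \_ `[- n.+1%:R, n.+1%:R]%classic); last first.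
    by rewrite restrict_EFin.
  rewrite -integral_mkcond.
  have -> : `[- n.+1%:R, n.+1%:R]%classic = `[- n.+1%:R, 0] `|` `]0, n.+1%:R] :> set R.
    rewrite -itv_bndbnd_setU//=; rewrite ?bnd_simp//.
  rewrite integral_setU_EFin//=; last 2 first.
  - by apply: measurable_funTS.
  - apply/disj_setPS => x /= []; rewrite !in_itv/= => /andP[_ x0] /andP[x1 _].
    by move: (lt_le_trans x1 x0); rewrite ltxx.
  rewrite integral_itv_obnd_cbnd; last by apply/measurable_EFinP/measurable_funTS.
  rewrite (@continuous_FTC2 _ f F2 (- n.+1%:R) 0)//; last first.
  - by move=> x; rewrite in_itv/= => /andP[_ x0]; rewrite derive1E; apply: derive_val; exact: dF2.
  - split.
    + by move=> x; rewrite in_itv/= => /andP[_ x0]; have := dF2 _ x0; case.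
    + by apply: cvg_at_right_filter; exact: cF2.
    + by apply: cvg_at_left_filter; exact: cF2.
  - by apply: continuous_subspaceT.
  rewrite (@continuous_FTC2 _ f F1 0 n.+1%:R)//; last first.
  - by move=> x; rewrite in_itv/= => /andP[x0 _]; rewrite derive1E; apply: derive_val; exact: dF1.
  - split.
    + by move=> x; rewrite in_itv/= => /andP[x0 _]; have := dF1 _ x0; case.
    + by apply: cvg_at_right_filter; exact: cF1.
    + by apply: cvg_at_left_filter; exact: cF1.
  - by apply: continuous_subspaceT.
  by rewrite -!EFinB -EFinD addrC.
have [||||| _ _] := @dominated_convergence _ _ _ mu setT measurableT
  (fun n x => (f_ n x)%:E) (EFin \o f) (fun x => `|f x|%:E).
- move=> n; apply/measurable_EFinP.
  by apply/(measurable_restrictT _ _).1 => //; exact: measurable_funTS.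
- exact/measurable_EFinP.
- apply: aeW => x _; apply: cvg_near_cst.
  near=> n; rewrite /f_ patchE ifT//= inE/= in_itv/=.
  rewrite -ler_norml; apply: (@le_trans _ _ n%:R); last by rewrite ler_nat.
  near: n; exact: nbhs_infty_ger.
- exact: integrable_norm intf.
- apply: aeW => x n _; rewrite /f_ patchE; case: ifPn => _ //=.
  by rewrite normr0 lee_fin.
rewrite (_ : [sequence _]_n = fun n =>
    ((F1 n.+1%:R - F1 0) + (F2 0 - F2 (- n.+1%:R)))%:E); last first.
  by apply/funext => n; exact: intfn.
move=> cvgf.
have cvgl : ((F1 n.+1%:R - F1 0) + (F2 0 - F2 (- n.+1%:R)))%:E @[n --> \oo]
    --> ((l1 - F1 0) + (F2 0 - l2))%:E.
  apply: cvg_EFin; first exact: nearW.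
  apply: cvgD.
    by apply: cvgB; [rewrite (@cvg_shiftS _ (fun n => F1 n%:R))|exact: cvg_cst].
  by apply: cvgB; [exact: cvg_cst|rewrite (@cvg_shiftS _ (fun n => F2 (- n%:R)))].
rewrite /Rintegral -(cvg_lim (@ereal_hausdorff R) cvgf).
by rewrite (cvg_lim (@ereal_hausdorff R) cvgl).
Unshelve. all: by end_near.
Qed.

Lemma integrable_le_oneDsqr (f : R -> R) C : measurable_fun setT f ->
  (forall s, `|f s| <= C * (1 + s ^+ 2)^-1) -> mu.-integrable setT (EFin \o f).
Proof.
move=> mf fC; have := integrable_oneDsqr => /(integrableZl measurableT C) i.
apply: le_integrable i => //; first exact/measurable_EFinP.
by move=> s _ /=; rewrite lee_fin (le_trans (fC s))// ler_norm.
Qed.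

Lemma expRN_le_oneDsqr (e : R) : 0 < e -> forall s : R,
  expR (- (e * `|s|)) <= (1 + 4 / e ^+ 2) * (1 + s ^+ 2)^-1.
Proof.
move=> e0 s; rewrite expRN -[X in X <= _]mul1r ler_pdivrMr ?expR_gt0//.
rewrite mulrAC ler_pdivlMr ?ltr_pwDl ?sqr_ge0// mul1r.
have es0 : 0 <= e * `|s| by rewrite mulr_ge0// ltW.
(* The square of 1 + y/2 <= exp(y/2), for y = e|s|. *)
have h : 1 + (e * `|s|) ^+ 2 / 4 <= expR (e * `|s|).
  rewrite [X in expR X](_ : _ = (e * `|s|) / 2 + (e * `|s|) / 2); last by field.
  rewrite expRD -expr2; have h1 := @expR_ge1Dx R (e * `|s| / 2).
  have h2 : (1 + e * `|s| / 2) ^+ 2 <= expR (e * `|s| / 2) ^+ 2.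
    by rewrite ler_pXn2r ?nnegrE ?expR_ge0//; lra.
  by apply: le_trans h2; nra.
have e2 : 0 < e ^+ 2 by rewrite exprn_gt0.
apply: (@le_trans _ _ ((1 + 4 / e ^+ 2) * (1 + (e * `|s|) ^+ 2 / 4))); last first.
  by rewrite ler_wpM2l// addr_ge0// divr_ge0// ltW.
rewrite exprMn real_normK ?num_real//.
have -> : (1 + 4 / e ^+ 2) * (1 + e ^+ 2 * s ^+ 2 / 4) =
  1 + s ^+ 2 + (4 / e ^+ 2 + e ^+ 2 * s ^+ 2 / 4) by field; rewrite gt_eqF.
rewrite lerDl addr_ge0//; first by rewrite divr_ge0// ltW.
by rewrite divr_ge0// mulr_ge0// ?sqr_ge0// ltW.
Qed.

Lemma cvg_expRN (e : R) : 0 < e -> expR (- (e * n%:R)) @[n --> \oo] --> (0 : R).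
Proof.
move=> e0; apply: (@squeeze_cvgr _ _ _ _ (cst 0) (fun n : nat => e^-1 * (n%:R)^-1)).
- near=> n; have n0 : (0 : R) < n%:R by rewrite ltr0n; near: n; exact: nbhs_infty_gt.
  rewrite expR_ge0/= expRN -invfM lef_pV2 ?posrE ?expR_gt0 ?mulr_gt0//.
  by apply: le_trans (expR_ge1Dx _); rewrite lerDr.
- exact: cvg_cst.
- rewrite -[X in _ --> X](mulr0 e^-1); apply: cvgM; first exact: cvg_cst.
  apply/(@gtr0_cvgV0 R); first by near=> n; rewrite ltr0n; near: n; exact: nbhs_infty_gt.
  exact: cvgr_idn.
Unshelve. all: by end_near.
Qed.

Lemma cvg0_mul_bounded (u v : nat -> R) (C : R) :
  u n @[n --> \oo] --> 0 -> (forall n, `|v n| <= C) -> (u n * v n) @[n --> \oo] --> 0.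
Proof.
move=> u0 vC; apply/cvgr0Pnorm_le => /= r r0.
have C0 : 0 <= C := le_trans (normr_ge0 _) (vC 0%N).
have C1 : 0 < C + 1 by rewrite ltr_pwDr.
near=> n; rewrite normrM.
have : `|u n| <= r / (C + 1).
  by near: n; apply: (@cvgr0_norm_le _ _ _ _ _ u u0); rewrite divr_gt0.
move=> h; apply: (@le_trans _ _ (r / (C + 1) * (C + 1))).
  by rewrite ler_pM// (le_trans (vC n))// lerDl.
by rewrite divfK// gt_eqF.
Unshelve. all: by end_near.
Qed.

Lemma continuous_norm_expR (e : R) : continuous (fun s : R => expR (- (e * `|s|))).
Proof.
move=> s; apply: continuous_comp; last exact: continuous_expR.
apply: cvgN; apply: cvgM; [exact: cvg_cst|exact: norm_continuous].
Qed.

(** On each half-line exp(-e|s|) cos(phi + b s) has an explicit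
    antiderivative vanishing at infinity. The phase [phi] is what an
    induction on the dimension produces from the other coordinates; at phi =
    -pi/2 the cosine is a sine. *)
Lemma Rintegral_expR_cos (e b phi : R) : 0 < e ->
  Rintegral mu setT (fun s => expR (- (e * `|s|)) * cos (phi + b * s)) =
  cos phi * (2 * e / (e ^+ 2 + b ^+ 2)).
Proof.
move=> e0.
have eb : 0 < e ^+ 2 + b ^+ 2 by rewrite ltr_pwDl ?sqr_ge0// exprn_gt0.
have cc : continuous (fun s : R => cos (phi + b * s)).
  move=> s; apply: continuous_comp; last exact: continuous_cos.
  by apply: cvgD; [exact: cvg_cst|apply: cvgM; [exact: cvg_cst|exact: cvg_id]].
have cf : continuous (fun s => expR (- (e * `|s|)) * cos (phi + b * s)).
  by move=> s; apply: cvgM; [exact: continuous_norm_expR|exact: cc].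
pose A1 s : R := (b * sin (phi + b * s) - e * cos (phi + b * s)) / (e ^+ 2 + b ^+ 2).
pose A2 s : R := (b * sin (phi + b * s) + e * cos (phi + b * s)) / (e ^+ 2 + b ^+ 2).
pose F1 s := expR (- (e * s)) * A1 s.
pose F2 s := expR (e * s) * A2 s.
have dF1 (s : R) : is_derive s 1 F1 (expR (- (e * s)) * cos (phi + b * s)).
  rewrite /F1 /A1; apply: is_derive_eq.
  by rewrite /GRing.scale/=; field; rewrite gt_eqF.
have dF2 (s : R) : is_derive s 1 F2 (expR (e * s) * cos (phi + b * s)).
  rewrite /F2 /A2; apply: is_derive_eq.
  by rewrite /GRing.scale/=; field; rewrite gt_eqF.
have bA (u v : R) : `|u| <= 1 -> `|v| <= 1 ->
  `|(b * u + e * v) / (e ^+ 2 + b ^+ 2)| <= (`|b| + e) / (e ^+ 2 + b ^+ 2).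
  move=> u1 v1; rewrite normrM [X in _ * X]ger0_norm ?invr_ge0 ?(ltW eb)//.
  rewrite ler_wpM2r ?invr_ge0 ?(ltW eb)//.
  rewrite (le_trans (ler_normD _ _))// lerD// normrM ?(gtr0_norm e0).
    by rewrite ler_piMr.
  by rewrite ler_piMr// ltW.
transitivity ((0 - F1 0) + (F2 0 - 0)); last first.
  rewrite /F1 /F2 /A1 /A2 !mulr0 oppr0 expR0 !addr0.
  by field; rewrite gt_eqF.
apply: (@integral_FTC_R (fun s => expR (- (e * `|s|)) * cos (phi + b * s)) F1 F2 0 0) => //.
- apply: (@integrable_le_oneDsqr _ (1 + 4 / e ^+ 2)).
    exact: continuous_measurable_fun.
  move=> s; apply: le_trans (expRN_le_oneDsqr e0 s).
  by rewrite normrM ger0_norm ?expR_ge0// ler_piMr ?expR_ge0// cos_max.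
- by move=> s; apply: differentiable_continuous; apply/derivable1_diffP; have [] := dF1 s.
- by move=> s; apply: differentiable_continuous; apply/derivable1_diffP; have [] := dF2 s.
- by move=> s s0; have := dF1 s; rewrite (gtr0_norm s0).
- by move=> s s0; have := dF2 s; rewrite (ltr0_norm s0) mulrN opprK.
- apply: (@cvg0_mul_bounded _ _ ((`|b| + e) / (e ^+ 2 + b ^+ 2))).
    exact: cvg_expRN.
  move=> n; rewrite /A1 -mulrN; apply: bA; first exact: sin_max.
  by rewrite normrN cos_max.
- apply: (@cvg0_mul_bounded _ _ ((`|b| + e) / (e ^+ 2 + b ^+ 2))).
    by under eq_cvg do rewrite mulrN; exact: cvg_expRN.
  by move=> n; rewrite /A2; apply: bA; [exact: sin_max|exact: cos_max].
Qed.

Lemma cvg_atan_nat (c x : R) : 0 < c ->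
  atan (c * (n%:R - x)) @[n --> \oo] --> pi / 2.
Proof.
move=> c0; apply: (@cvg_comp _ _ _ (fun n : nat => c * (n%:R - x)) (@atan R) _ +oo);
  last exact: cvgy_atan.
apply/cvgryPge => A; near=> n.
rewrite mulrC -ler_pdivrMr// lerBrDr.
near: n; exact: nbhs_infty_ger.
Unshelve. all: by end_near.
Qed.

(** The Fourier transform of s |-> exp(-e|s|), that is, the Poisson kernel of
    the half-plane at height e / (2 pi). *)
Definition poisson_kernel (e z : R) : R := 2 * e / (e ^+ 2 + (2 * pi * z) ^+ 2).

(** The antiderivative atan(2 pi (y - x) / e) / pi runs from -1/2 to 1/2. *)
Lemma Rintegral_poisson (e x : R) : 0 < e ->
  mu.-integrable setT (EFin \o fun y => poisson_kernel e (x - y)) /\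
  Rintegral mu setT (fun y => poisson_kernel e (x - y)) = 1.
Proof.
move=> e0.
have pi0 : 0 < pi :> R := pi_gt0 R.
have ep (z : R) : 0 < e ^+ 2 + (2 * pi * z) ^+ 2 by rewrite ltr_pwDl ?sqr_ge0// exprn_gt0.
have cf : continuous (fun y => poisson_kernel e (x - y)).
  move=> y; rewrite /poisson_kernel; apply: cvgM; first exact: cvg_cst.
  apply: cvgV; first by rewrite gt_eqF.
  apply: cvgD; first exact: cvg_cst.
  apply: (@continuous_comp _ _ _ (fun y => 2 * pi * (x - y)) (fun t => t ^+ 2)).
    by apply: cvgM; [exact: cvg_cst|apply: cvgB; [exact: cvg_cst|exact: cvg_id]].
  exact: exprn_continuous.
have mf : mu.-integrable setT (EFin \o (fun y => poisson_kernel e (x - y))).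
  apply: (@integrable_le_oneDsqr _ (2 * e * ((1 + 2 * x ^+ 2) / e ^+ 2 + 2 / (2 * pi) ^+ 2))).
    exact: continuous_measurable_fun.
  move=> y; rewrite /poisson_kernel ger0_norm; last first.
    by rewrite divr_ge0// ?mulr_ge0// ltW.
  rewrite -[leRHS]mulrA; apply: ler_wpM2l; first by rewrite mulr_ge0// ltW.
  rewrite -[leLHS]mul1r ler_pdivrMr// mulrAC ler_pdivlMr ?ltr_pwDl ?sqr_ge0// mul1r.
  have e2 : 0 < e ^+ 2 by rewrite exprn_gt0.
  have p2 : 0 < (2 * pi) ^+ 2 :> R by rewrite exprn_gt0// mulr_gt0.
  rewrite [(_ * (x - y)) ^+ 2]exprMn.
  have -> : ((1 + 2 * x ^+ 2) / e ^+ 2 + 2 / (2 * pi) ^+ 2) * (e ^+ 2 + (2 * pi) ^+ 2 * (x - y) ^+ 2)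
    = 1 + 2 * x ^+ 2 + 2 * (x - y) ^+ 2 + (((1 + 2 * x ^+ 2) / e ^+ 2) * ((2 * pi) ^+ 2 * (x - y) ^+ 2) + 2 / (2 * pi) ^+ 2 * e ^+ 2).
    by move: ((2 * pi) ^+ 2) p2 (e ^+ 2) e2 => P p2 E e2; field; rewrite !gt_eqF.
  apply: (@le_trans _ _ (1 + 2 * x ^+ 2 + 2 * (x - y) ^+ 2)).
    by have := sqr_ge0 (2 * x - y); nra.
  have A0 : 0 <= 1 + 2 * x ^+ 2 by rewrite addr_ge0// mulr_ge0// sqr_ge0.
  rewrite lerDl addr_ge0//.
    by rewrite mulr_ge0 ?(divr_ge0 A0 (ltW e2))// mulr_ge0 ?(ltW p2) ?sqr_ge0.
  by rewrite mulr_ge0 ?(ltW e2)// divr_ge0 ?(ltW p2).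
split=> //.
pose F y : R := atan (2 * pi / e * (y - x)) / pi.
have dF (y : R) : is_derive y 1 F (poisson_kernel e (x - y)).
  rewrite /F; apply: is_derive_eq.
  rewrite /GRing.scale/= /poisson_kernel.
  have := ep (x - y); move: pi0; generalize (pi : R) => P P0 epP.
  by field; rewrite !lt0r_neq0.
have cF : continuous F.
  by move=> s; apply: differentiable_continuous; apply/derivable1_diffP; have [] := dF s.
transitivity ((2^-1 - F 0) + (F 0 - (- 2^-1)) : R); last by field.
apply: (@integral_FTC_R (fun y => poisson_kernel e (x - y)) F F (2^-1) (- 2^-1)) => //.
- rewrite [X in _ --> X](_ : _ = pi / 2 / pi); last by rewrite mulrAC divff ?mul1r ?lt0r_neq0.
  by apply: cvgM; [apply: cvg_atan_nat; rewrite divr_gt0// mulr_gt0|exact: cvg_cst].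
- rewrite [X in _ --> X](_ : _ = - (pi / 2) / pi); last by rewrite mulNr mulrAC divff ?mul1r ?lt0r_neq0.
  apply: cvgM; last exact: cvg_cst.
  rewrite (_ : (fun n => _) = - (fun n => atan (2 * pi / e * (n%:R - (- x))))).
    by apply: cvgN; apply: cvg_atan_nat; rewrite divr_gt0// mulr_gt0.
  by apply/funext => n; rewrite fctE/= opprK -atanN -mulrN opprD.
Qed.
End OneDim.

(** * Integration over tuples *)

Section Fubini.
Context d1 d2 (T1 : measurableType d1) (T2 : measurableType d2) (R : realType).
Variable m1 : {sigma_finite_measure set T1 -> \bar R}.
Variable m2 : {sigma_finite_measure set T2 -> \bar R}.
Variable f : T1 * T2 -> R.
Hypothesis intf : (m1 \x m2)%E.-integrable setT (EFin \o f).

Lemma Rintegral_prod1 :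
  (forall x, m2.-integrable setT (fun y => (f (x, y))%:E)) ->
  Rintegral (m1 \x m2)%E setT f =
  Rintegral m1 setT (fun x => Rintegral m2 setT (fun y => f (x, y))).
Proof.
move=> int2; rewrite /Rintegral -integral12_prod_meas1//.
by congr fine; apply: eq_integral => x _; rewrite fineK//; exact: integrable_fin_num.
Qed.

Lemma Rintegral_prod2 :
  (forall y, m1.-integrable setT (fun x => (f (x, y))%:E)) ->
  Rintegral (m1 \x m2)%E setT f =
  Rintegral m2 setT (fun y => Rintegral m1 setT (fun x => f (x, y))).
Proof.
move=> int2; rewrite /Rintegral -integral21_prod_meas1//.
by congr fine; apply: eq_integral => x _; rewrite fineK//; exact: integrable_fin_num.
Qed.

End Fubini.

Section Tuples.
Variable R : realType.
Local Notation T := (measurableTypeR R).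
Local Notation mu := (@lebesgue_measure R).
Local Notation leb := (lebesgue_tuple R).

Lemma integral_lebesgue_tupleS n (f : n.+1.-tuple T -> \bar R) :
  measurable_fun setT f -> (forall t, 0 <= f t)%E ->
  (\int[leb n.+1]_t f t = \int[mu]_x \int[leb n]_t f (cons_pair (x, t)))%E.
Proof.
move=> mf f0.
rewrite [LHS](@ge0_integral_pushforward _ _ _ _ _ (@cons_pair R n))//=.
rewrite preimage_setT fubini_tonelli1//=.
exact: measurableT_comp.
Qed.

Lemma integrable_lebesgue_tupleS n (f : n.+1.-tuple T -> R) :
  (leb n.+1).-integrable setT (EFin \o f) ->
  (mu \x leb n)%E.-integrable setT (EFin \o (f \o @cons_pair R n)).
Proof.
move=> /integrableP[mf foo]; apply/integrableP; split.
  exact: (@measurableT_comp _ _ _ _ _ _ (EFin \o f)).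
move: foo; rewrite integral_lebesgue_tupleS//; last exact: measurableT_comp.
rewrite fubini_tonelli1//; apply: measurableT_comp => //.
exact: (@measurableT_comp _ _ _ _ _ _ (EFin \o f)).
Qed.

Lemma Rintegral_lebesgue_tupleS n (f : n.+1.-tuple T -> R) :
  (leb n.+1).-integrable setT (EFin \o f) ->
  Rintegral (leb n.+1) setT f = Rintegral (mu \x leb n)%E setT (f \o @cons_pair R n).
Proof.
move=> intf; have := integrable_lebesgue_tupleS intf => ig.
have mf := measurable_int _ intf.
rewrite /Rintegral [X in fine X](@integral_pushforward _ _ _ _ _ (@cons_pair R n))//.
Qed.

(** The common integrable majorant on R^n. As a product of one-variable
    factors it keeps its form on coordinate sections, and Schwartz functions
    lie below its multiples. *)
Definition weight n (t : n.-tuple T) : R := \prod_(i < n) (1 + tnth t i ^+ 2)^-1.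

Lemma prod_cons_pair n (h : 'I_n.+1 -> R -> R) x (t : n.-tuple T) :
  \prod_(i < n.+1) h i (tnth (cons_pair (x, t)) i) =
  h ord0 x * \prod_(i < n) h (lift ord0 i) (tnth t i).
Proof.
rewrite big_ord_recl; congr (_ * _).
  by apply: eq_bigr => i _; rewrite tnthS.
Qed.

Lemma sum_cons_pair n (h : 'I_n.+1 -> R -> R) x (t : n.-tuple T) :
  \sum_(i < n.+1) h i (tnth (cons_pair (x, t)) i) =
  h ord0 x + \sum_(i < n) h (lift ord0 i) (tnth t i).
Proof.
rewrite big_ord_recl; congr (_ + _).
  by apply: eq_bigr => i _; rewrite tnthS.
Qed.

Lemma weight_cons_pair n x (t : n.-tuple T) :
  weight (cons_pair (x, t)) = (1 + x ^+ 2)^-1 * weight t.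
Proof. exact: (@prod_cons_pair n (fun _ s => (1 + s ^+ 2)^-1)). Qed.

Lemma oneDsqrV_gt0 (s : R) : 0 < (1 + s ^+ 2)^-1.
Proof. by rewrite invr_gt0 ltr_pwDl// sqr_ge0. Qed.

Lemma oneDsqrV_le1 (s : R) : (1 + s ^+ 2)^-1 <= 1.
Proof. by rewrite invf_le1 ?ltr_pwDl ?lerDl// sqr_ge0. Qed.

Lemma weight_gt0 n (t : n.-tuple T) : 0 < weight t.
Proof. by apply: prodr_gt0 => i _; exact: oneDsqrV_gt0. Qed.

Lemma measurable_prod_tnth n (h : 'I_n -> R -> R) :
  (forall i, measurable_fun setT (h i)) ->
  measurable_fun setT (fun t : n.-tuple T => \prod_(i < n) h i (tnth t i)).
Proof.
move=> mh; apply: measurable_prod => i _.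
by apply: (measurableT_comp (mh i)); exact: measurable_tnth.
Qed.

Lemma integral_prod_tnth n (h : 'I_n -> R -> R) (c : 'I_n -> R) :
  (forall i, measurable_fun setT (h i)) -> (forall i s, 0 <= h i s) ->
  (forall i, (\int[mu]_s (h i s)%:E = (c i)%:E)%E) ->
  (\int[leb n]_t (\prod_(i < n) h i (tnth t i))%:E = (\prod_(i < n) c i)%:E)%E.
Proof.
elim: n h c => [|n IH] h c mh h0 hc.
  rewrite [LHS]integral_dirac//.
    by rewrite !big_ord0 diracT mul1e.
  by under eq_fun do rewrite big_ord0; exact: measurable_cst.
rewrite integral_lebesgue_tupleS; last 2 first.
- by apply/measurable_EFinP; exact: measurable_prod_tnth.
- by move=> t; rewrite lee_fin prodr_ge0.
under eq_integral => x _.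
  under eq_integral do rewrite prod_cons_pair EFinM.
  rewrite ge0_integralZl//; first last.
  - by rewrite lee_fin.
  - by move=> t _; rewrite lee_fin prodr_ge0.
  - apply/measurable_EFinP.
    exact: (@measurable_prod_tnth n (fun i => h (lift ord0 i)) (fun i => mh _)).
  rewrite (IH (fun i => h (lift ord0 i)) (fun i => c (lift ord0 i)))//.
  over.
rewrite ge0_integralZr//; first last.
- rewrite lee_fin; apply: prodr_ge0 => i _; rewrite -lee_fin -hc.
  by apply: integral_ge0 => s _; rewrite lee_fin.
- by move=> s _; rewrite lee_fin.
- by apply/measurable_EFinP; exact: mh.
by rewrite hc -EFinM [in RHS]big_ord_recl.
Qed.

Lemma measurable_oneDsqrV : measurable_fun setT (fun s : R => (1 + s ^+ 2)^-1).
Proof. by have /measurable_int/measurable_EFinP := @integrable_oneDsqr R. Qed.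

Lemma measurable_weight n : measurable_fun setT (@weight n).
Proof.
exact: (@measurable_prod_tnth n _ (fun=> measurable_oneDsqrV)).
Qed.

Lemma integrable_prod_tnth n (h : 'I_n -> R -> R) :
  (forall i, measurable_fun setT (h i)) -> (forall i s, 0 <= h i s) ->
  (forall i, mu.-integrable setT (EFin \o h i)) ->
  (leb n).-integrable setT (fun t => (\prod_(i < n) h i (tnth t i))%:E) /\
  Rintegral (leb n) setT (fun t => \prod_(i < n) h i (tnth t i)) =
  \prod_(i < n) Rintegral mu setT (h i).
Proof.
move=> mh h0 ih.
have E := @integral_prod_tnth n h (fun i => Rintegral mu setT (h i)) mh h0.
have {}E : (\int[leb n]_t (\prod_(i < n) h i (tnth t i))%:E =
  (\prod_(i < n) Rintegral mu setT (h i))%:E)%E.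
  by apply: E => i; rewrite /Rintegral fineK//; exact: integrable_fin_num (ih i).
split; last by rewrite /Rintegral E.
apply/integrableP; split; first by apply/measurable_EFinP; exact: measurable_prod_tnth.
under eq_integral do rewrite gee0_abs ?lee_fin ?prodr_ge0//.
by rewrite E ltry.
Qed.

Lemma integrable_weight n : (leb n).-integrable setT (EFin \o @weight n).
Proof.
have [|||//] := @integrable_prod_tnth n (fun _ s => (1 + s ^+ 2)^-1).
- by move=> i; exact: measurable_oneDsqrV.
- by move=> i s; exact: ltW (oneDsqrV_gt0 s).
- by move=> i; exact: integrable_oneDsqr.
Qed.

Definition dominated n (f : n.-tuple T -> R) :=
  measurable_fun setT f /\ exists C, forall t, `|f t| <= C * weight t.

Lemma dominated_integrable n (f : n.-tuple T -> R) : dominated f ->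
  (leb n).-integrable setT (EFin \o f).
Proof.
move=> [mf [C fC]]; have := integrable_weight n => /(integrableZl measurableT C) i.
apply: le_integrable i => //; first exact/measurable_EFinP.
by move=> s _ /=; rewrite lee_fin (le_trans (fC s))// ler_norm.
Qed.

Lemma dominated_section1 n (f : n.+1.-tuple T -> R) x : dominated f ->
  dominated (fun t => f (cons_pair (x, t))).
Proof.
move=> [mf [C fC]]; split.
  apply: (measurableT_comp mf); apply: measurableT_comp => //.
exists (C * (1 + x ^+ 2)^-1) => t; rewrite -mulrA -weight_cons_pair; exact: fC.
Qed.

Lemma dominated_section2 n (f : n.+1.-tuple T -> R) t : dominated f ->
  measurable_fun setT (fun x => f (cons_pair (x, t))) /\
  exists C, forall x : R, `|f (cons_pair (x, t))| <= C * (1 + x ^+ 2)^-1.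
Proof.
move=> [mf [C fC]]; split.
  apply: (measurableT_comp mf); apply: measurableT_comp => //.
by exists (C * weight t) => x; rewrite mulrAC -mulrA -weight_cons_pair; exact: fC.
Qed.

Lemma Rintegral_tupleS1 n (f : n.+1.-tuple T -> R) : dominated f ->
  Rintegral (leb n.+1) setT f =
  Rintegral mu setT (fun x => Rintegral (leb n) setT (fun t => f (cons_pair (x, t)))).
Proof.
move=> df; rewrite Rintegral_lebesgue_tupleS; last exact: dominated_integrable.
rewrite Rintegral_prod1//; first exact/integrable_lebesgue_tupleS/dominated_integrable.
by move=> x; exact/dominated_integrable/dominated_section1.
Qed.

Lemma Rintegral_tupleS2 n (f : n.+1.-tuple T -> R) : dominated f ->
  Rintegral (leb n.+1) setT f =
  Rintegral (leb n) setT (fun t => Rintegral mu setT (fun x => f (cons_pair (x, t)))).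
Proof.
move=> df; rewrite Rintegral_lebesgue_tupleS; last exact: dominated_integrable.
rewrite Rintegral_prod2//; first exact/integrable_lebesgue_tupleS/dominated_integrable.
move=> t; have [mf [C fC]] := dominated_section2 t df.
exact: integrable_le_oneDsqr mf fC.
Qed.

(** The point [t] with its i-th coordinate moved to [s]: partial derivatives
    are derivatives in [s]. *)
Definition tset n (t : n.-tuple T) (i : 'I_n) (s : R) : n.-tuple T :=
  [tuple (if j == i then s else tnth t j) | j < n].

Lemma tset_cons0 n x (t : n.-tuple T) s :
  tset (cons_pair (x, t)) ord0 s = cons_pair (s, t).
Proof.
apply: eq_from_tnth => j; rewrite tnth_mktuple.
case: (unliftP ord0 j) => [k|] -> //.
by rewrite !tnthS.
Qed.

Lemma tset_consS n x (t : n.-tuple T) i s :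
  tset (cons_pair (x, t)) (lift ord0 i) s = cons_pair (x, tset t i s).
Proof.
apply: eq_from_tnth => j; rewrite tnth_mktuple.
case: (unliftP ord0 j) => [k|] -> //.
by rewrite !tnthS tnth_mktuple (inj_eq lift_inj).
Qed.

Lemma cvg0_le_oneDsqr (u : nat -> R) (C : R) :
  (forall n, `|u n| <= C * (1 + n%:R ^+ 2)^-1) -> u n @[n --> \oo] --> 0.
Proof.
move=> uC; apply/cvgr0Pnorm_le => /= r r0; near=> n.
apply: le_trans (uC n) _; rewrite ler_pdivrMr ?ltr_pwDl ?sqr_ge0//.
have : C / r <= n%:R by near: n; exact: nbhs_infty_ger.
rewrite ler_pdivrMr// => /le_trans; apply.
by rewrite mulrC ler_wpM2l ?(ltW r0)//; have := sqr_ge0 (n%:R - 1 : R); nra.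
Unshelve. all: by end_near.
Qed.

(** Integrating first in the differentiated coordinate leaves the fundamental
    theorem on the line, with vanishing boundary values. The induction on the
    dimension moves that coordinate to the front. *)
Lemma Rintegral_partial n (i : 'I_n) (g g' : n.-tuple T -> R) :
  dominated g -> dominated g' ->
  (forall t (s : R), is_derive s 1 (fun s => g (tset t i s)) (g' (tset t i s))) ->
  (forall t, continuous (fun s : R => g' (tset t i s))) ->
  Rintegral (leb n) setT g' = 0.
Proof.
elim: n i g g' => [[]//|n IH] i g g' dg dg' dgg' cg'.
case: (unliftP ord0 i) dgg' cg' => [j|] -> dgg' cg'.
  rewrite Rintegral_tupleS1//.
  have E x : Rintegral (leb n) setT (fun t => g' (cons_pair (x, t))) = 0.
    apply: (@IH j (fun t => g (cons_pair (x, t)))).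
    - exact: dominated_section1.
    - exact: dominated_section1.
    - move=> t s; have := dgg' (cons_pair (x, t)) s; rewrite tset_consS.
      by rewrite (_ : (fun _ => _) = (fun s => g (cons_pair (x, tset t j s))))//; apply/funext => r; rewrite tset_consS.
    - move=> t; have := cg' (cons_pair (x, t)).
      by rewrite (_ : (fun _ => _) = (fun s => g' (cons_pair (x, tset t j s))))//; apply/funext => r; rewrite tset_consS.
  by under eq_Rintegral do rewrite E; rewrite Rintegral_cst// mul0r.
rewrite Rintegral_tupleS2//.
suff E t : Rintegral mu setT (fun x => g' (cons_pair (x, t))) = 0.
  by under eq_Rintegral do rewrite E; rewrite Rintegral_cst// mul0r.
have [mf [C fC]] := dominated_section2 t dg'.
have [_ [C' fC']] := dominated_section2 t dg.
have d1 (s : R) : is_derive s 1 (fun s => g (cons_pair (s, t))) (g' (cons_pair (s, t))).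
  have := dgg' (cons_pair (0, t)) s; rewrite tset_cons0.
  by rewrite (_ : (fun _ => _) = (fun s => g (cons_pair (s, t))))//; apply/funext => r; rewrite tset_cons0.
have cd : continuous (fun s : R => g (cons_pair (s, t))).
  by move=> s; apply: differentiable_continuous; apply/derivable1_diffP; have [] := d1 s.
have cd' : continuous (fun s : R => g' (cons_pair (s, t))).
  have := cg' (cons_pair (0, t)).
  by rewrite (_ : (fun _ => _) = (fun s => g' (cons_pair (s, t))))//; apply/funext => r; rewrite tset_cons0.
transitivity ((0 - g (cons_pair (0, t))) + (g (cons_pair (0, t)) - 0)); last by ring.
apply: (@integral_FTC_R R (fun x => g' (cons_pair (x, t))) (fun x => g (cons_pair (x, t))) (fun x => g (cons_pair (x, t)))) => //.
- exact: integrable_le_oneDsqr mf fC.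
- by apply: (@cvg0_le_oneDsqr _ C') => m; exact: fC'.
- by apply: (@cvg0_le_oneDsqr _ C') => m; have := fC' (- m%:R); rewrite sqrrN.
Qed.

Lemma dominated_mul n (f g : n.-tuple T -> R) (M : R) : dominated f ->
  measurable_fun setT g -> (forall t, `|g t| <= M) -> dominated (fun t => f t * g t).
Proof.
move=> [mf [C fC]] mg gM; split; first exact: measurable_funM.
exists (C * M) => t; rewrite normrM mulrAC ler_pM//.
Qed.

Lemma dominated_expR n (e : R) : 0 < e ->
  dominated (fun t : n.-tuple T => \prod_(i < n) expR (- (e * `|tnth t i|))).
Proof.
move=> e0; split.
  apply: (@measurable_prod_tnth n (fun _ s => expR (- (e * `|s|)))) => _.
  by apply: continuous_measurable_fun; exact: continuous_norm_expR.
exists ((1 + 4 / e ^+ 2) ^+ n) => t.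
rewrite ger0_norm; last by apply: prodr_ge0 => i _; exact: expR_ge0.
rewrite -[X in _ ^+ X]card_ord -prodr_const -big_split/=.
by apply: ler_prod => i _; rewrite expR_ge0 expRN_le_oneDsqr.
Qed.

Lemma measurable_cos_sum n (phi : R) (z : 'I_n -> R) :
  measurable_fun setT (fun t : n.-tuple T => cos (phi + \sum_(i < n) z i * tnth t i)).
Proof.
apply: (measurableT_comp (continuous_measurable_fun (@continuous_cos R))).
apply: measurable_funD; first exact: measurable_cst.
apply: measurable_sum => i; apply: measurable_funM; first exact: measurable_cst.
exact: measurable_tnth.
Qed.

(** The integral over the first coordinate absorbs [z ord0 * x] from the
    phase, so the factors split off one at a time. *)
Lemma Rintegral_expR_cos_tuple n (e : R) (z : 'I_n -> R) phi : 0 < e ->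
  Rintegral (leb n) setT (fun t =>
    (\prod_(i < n) expR (- (e * `|tnth t i|))) * cos (phi + \sum_(i < n) z i * tnth t i)) =
  cos phi * \prod_(i < n) (2 * e / (e ^+ 2 + z i ^+ 2)).
Proof.
move=> e0; elim: n z phi => [|n IH] z phi.
  rewrite /Rintegral [X in fine X]integral_dirac//; last first.
    by under eq_fun do rewrite !big_ord0; exact: measurable_cst.
  by rewrite !big_ord0 diracT mul1e /= mul1r mulr1 addr0.
have dm m (w : 'I_m -> R) (c : R) : dominated (fun t : m.-tuple T =>
    (\prod_(i < m) expR (- (e * `|tnth t i|))) * cos (c + \sum_(i < m) w i * tnth t i)).
  apply: (@dominated_mul _ _ _ 1); first exact: dominated_expR.
    exact: measurable_cos_sum.
  by move=> t; exact: cos_max.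
rewrite Rintegral_tupleS1; last exact: dm.
have E x : Rintegral (leb n) setT (fun t =>
    (\prod_(i < n.+1) expR (- (e * `|tnth (cons_pair (x, t)) i|))) *
    cos (phi + \sum_(i < n.+1) z i * tnth (cons_pair (x, t)) i)) =
  expR (- (e * `|x|)) * cos (phi + z ord0 * x) *
    \prod_(i < n) (2 * e / (e ^+ 2 + z (lift ord0 i) ^+ 2)).
  rewrite -mulrA -IH -RintegralZl//; last exact/dominated_integrable/dm.
  apply: eq_Rintegral => t _.
  rewrite (@prod_cons_pair n (fun _ s => expR (- (e * `|s|)))) -mulrA.
  by rewrite (@sum_cons_pair n (fun i s => z i * s)) addrA.
under eq_Rintegral do rewrite E.
rewrite RintegralZr//; last first.
  apply: (@integrable_le_oneDsqr _ _ (1 + 4 / e ^+ 2)).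
    apply: measurable_funM.
      by apply: continuous_measurable_fun; exact: continuous_norm_expR.
    apply: (measurableT_comp (continuous_measurable_fun (@continuous_cos R))).
    by apply: measurable_funD => //; apply: measurable_funM.
  move=> s; apply: le_trans (expRN_le_oneDsqr e0 s).
  by rewrite normrM ger0_norm ?expR_ge0// ler_piMr ?expR_ge0// cos_max.
by rewrite Rintegral_expR_cos// [in RHS]big_ord_recl [in RHS]mulrA.
Qed.
End Tuples.

(** * Fourier inversion *)

Section Inversion.
Variable R : realType.
Local Notation T := (measurableTypeR R).
Local Notation mu := (@lebesgue_measure R).
Local Notation leb := (lebesgue_tuple R).
Variable n : nat.
Implicit Types (u v : n.-tuple T -> R) (x y t : n.-tuple T).

Lemma Rintegral_dominated_cvg d (X : measurableType d) (m : {measure set X -> \bar R})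
    (f_ : nat -> X -> R) (f g : X -> R) :
  (forall k, measurable_fun setT (f_ k)) -> measurable_fun setT f ->
  (forall a, f_ k a @[k --> \oo] --> f a) ->
  m.-integrable setT (EFin \o g) -> (forall k a, `|f_ k a| <= g a) ->
  Rintegral m setT (f_ k) @[k --> \oo] --> Rintegral m setT f.
Proof.
move=> mf_ mf f_f ig f_g.
have [|||||intf _ c] := @dominated_convergence _ _ _ m setT measurableT
  (fun k a => (f_ k a)%:E) (EFin \o f) (EFin \o g).
- by move=> k; exact/measurable_EFinP.
- exact/measurable_EFinP.
- by apply: aeW => a _; apply: cvg_EFin; [exact: nearW|exact: f_f].
- exact: ig.
- by apply: aeW => a k _ /=; rewrite lee_fin.
have : (\int[m]_a (f_ k a)%:E)%E @[k --> \oo] --> (Rintegral m setT f)%:E.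
  by rewrite /Rintegral fineK//; exact: integrable_fin_num intf.
by move=> /fine_cvgP[_].
Qed.

(** Tuples carry the measure, so the waves are written on tuples. *)
Definition phase x t : R := 2 * pi * \sum_(i < n) tnth x i * tnth t i.

(** Real form of the Fourier integral: for f = u + i v the real part of the
    transform is [trig u v] and its imaginary part is [trig v (- u)]. The
    inverse transform of U + i V has real part [trig U (- V)], so one
    expression serves both directions. *)
Definition trig u v x : R :=
  Rintegral (leb n) setT (fun t => u t * cos (phase x t) + v t * sin (phase x t)).

Lemma measurable_phase x : measurable_fun setT (phase x).
Proof.
apply: measurable_funM => //; apply: measurable_sum => i.
by apply: measurable_funM => //; exact: measurable_tnth.
Qed.

Lemma weight_le1 t : weight t <= 1.
Proof.
by apply: prodr_ile1 => i; rewrite oneDsqrV_le1 ltW// oneDsqrV_gt0.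
Qed.

Lemma dominated_bounded u : dominated u -> exists2 C, 0 <= C & forall t, `|u t| <= C.
Proof.
move=> [_ [C uC]]; exists `|C| => // t; rewrite (le_trans (uC t))//.
apply: le_trans (ler_norm _) _; rewrite normrM ler_piMr//.
by rewrite ger0_norm ?weight_le1// ltW// weight_gt0.
Qed.

Lemma dominatedD u v : dominated u -> dominated v -> dominated (fun t => u t + v t).
Proof.
move=> [mu1 [C uC]] [mv [D vD]]; split; first exact: measurable_funD.
exists (C + D) => t; rewrite mulrDl (le_trans (ler_normD _ _))// lerD//.
Qed.

Lemma dominatedN u : dominated u -> dominated (fun t => - u t).
Proof.
move=> [mu1 [C uC]]; split; first exact: measurableT_comp.
by exists C => t; rewrite normrN.
Qed.

Lemma dominated_norm u : dominated u -> dominated (fun t => `|u t|).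
Proof.
move=> [mu1 [C uC]]; split; first exact: measurableT_comp.
by exists C => t; rewrite normr_id.
Qed.

Lemma measurable_cosT d (X : measurableType d) (f : X -> R) :
  measurable_fun setT f -> measurable_fun setT (fun a => cos (f a)).
Proof. exact: (measurableT_comp (continuous_measurable_fun (@continuous_cos R))). Qed.

Lemma measurable_sinT d (X : measurableType d) (f : X -> R) :
  measurable_fun setT f -> measurable_fun setT (fun a => sin (f a)).
Proof. exact: (measurableT_comp (continuous_measurable_fun (@continuous_sin R))). Qed.

Lemma norm_cos_sin_le (a b t : R) : `|a * cos t + b * sin t| <= `|a| + `|b|.
Proof.
rewrite (le_trans (ler_normD _ _))// !normrM lerD// ler_piMr//.
  exact: cos_max.
exact: sin_max.
Qed.

Lemma dominated_cos_sin u v (ph : n.-tuple T -> R) :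
  dominated u -> dominated v -> measurable_fun setT ph ->
  dominated (fun t => u t * cos (ph t) + v t * sin (ph t)).
Proof.
move=> du dv mph; apply: dominatedD.
  apply: (@dominated_mul _ _ _ _ 1) => //; last by move=> t; exact: cos_max.
  exact: measurable_cosT.
apply: (@dominated_mul _ _ _ _ 1) => //; last by move=> t; exact: sin_max.
exact: measurable_sinT.
Qed.

Lemma dominated_trig_integrand u v x : dominated u -> dominated v ->
  dominated (fun t => u t * cos (phase x t) + v t * sin (phase x t)).
Proof. by move=> du dv; apply: dominated_cos_sin => //; exact: measurable_phase. Qed.

(** A measurable function below a multiple of the product of the two weights
    meets all the integrability conditions under which the order of
    integration may be exchanged. *)
Lemma integrable_prod_weight (G : n.-tuple T * n.-tuple T -> R) (C : R) :
  measurable_fun setT G -> (forall a b, `|G (a, b)| <= C * weight a * weight b) ->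
  (leb n \x leb n)%E.-integrable setT (EFin \o G) /\
  (forall a, dominated (fun b => G (a, b))) /\ (forall b, dominated (fun a => G (a, b))).
Proof.
move=> mG GC; split; last first.
  split=> [a|b]; split.
  - exact: measurableT_comp.
  - by exists (C * weight a) => b; exact: GC.
  - exact: measurableT_comp.
  - by exists (C * weight b) => a; rewrite mulrAC; exact: GC.
apply/integrable12ltyP; first exact/measurable_EFinP.
pose c := fine (\int[leb n]_b (weight b)%:E)%E.
have wfin : (\int[leb n]_b (weight b)%:E = c%:E)%E.
  by rewrite /c fineK//; exact: integrable_fin_num (integrable_weight R n).
have mw := @measurable_weight R n.
apply: (@le_lt_trans _ _ (\int[leb n]_a (`|C| * weight a * c)%:E)%E).
  apply: ge0_le_integral => //.
  - by move=> a _; exact: integral_ge0.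
  - apply: (@measurable_fun_fubini_tonelli_F _ _ _ _ _ _ (abse \o (EFin \o G))) => //; last first.
      by move=> z; exact: abse_ge0.
    by apply: measurableT_comp => //; exact/measurable_EFinP.
  - by apply/measurable_EFinP; do 2 apply: measurable_funM => //.
  - move=> a _; rewrite EFinM -wfin -ge0_integralZl//.
    + apply: ge0_le_integral => //.
      * by apply: measurableT_comp => //; apply/measurable_EFinP; exact: measurableT_comp.
      * by apply/measurable_EFinP; apply: measurable_funM.
      * move=> b _; rewrite -EFinM lee_fin (le_trans (GC a b))//.
        by rewrite !ler_wpM2r ?ler_norm ?(ltW (weight_gt0 _)).
    + exact/measurable_EFinP.
    + by move=> b _; rewrite lee_fin ltW// weight_gt0.
    + by rewrite lee_fin mulr_ge0// ltW// weight_gt0.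
under eq_integral do rewrite mulrAC EFinM.
rewrite ge0_integralZl ?wfin -?EFinM ?ltry//.
- exact/measurable_EFinP.
- by move=> b _; rewrite lee_fin ltW// weight_gt0.
- rewrite lee_fin mulr_ge0// -lee_fin -wfin; apply: integral_ge0 => b _.
  by rewrite lee_fin ltW// weight_gt0.
Qed.

Definition damping (e : R) t : R := \prod_(i < n) expR (- (e * `|tnth t i|)).

Lemma trig_bounded u v : dominated u -> dominated v ->
  exists2 C, 0 <= C & forall x, `|trig u v x| <= C.
Proof.
move=> du dv.
have duv : dominated (fun t => `|u t| + `|v t|).
  by apply: dominatedD; exact: dominated_norm.
exists (Rintegral (leb n) setT (fun t => `|u t| + `|v t|)).
  by apply: Rintegral_ge0 => t _; rewrite addr_ge0.
move=> x; have di := dominated_trig_integrand x du dv.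
apply: (le_trans (le_normr_Rintegral _ (dominated_integrable di))) => //.
apply: le_Rintegral => //.
- exact/dominated_integrable/dominated_norm.
- exact: dominated_integrable.
- by move=> t _; exact: norm_cos_sin_le.
Qed.

Lemma measurable_joint_phase :
  measurable_fun setT (fun z : n.-tuple T * n.-tuple T => phase z.1 z.2).
Proof.
apply: measurable_funM => //; apply: measurable_sum => i.
by apply: measurable_funM; (apply: (measurableT_comp (measurable_tnth i))).
Qed.

Lemma phaseC x t : phase x t = phase t x.
Proof. by rewrite /phase; congr (_ * _); apply: eq_bigr => i _; rewrite mulrC. Qed.

Lemma measurable_trig u v : dominated u -> dominated v -> measurable_fun setT (trig u v).
Proof.
move=> du dv; have [mu1 [C uC]] := du; have [mv [D vD]] := dv.
(* The integrand of [trig] does not decay in the outer variable; the factor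
   [weight z.1] makes it integrable on the product, and is divided out at the
   end. *)
pose G (z : n.-tuple T * n.-tuple T) := weight z.1 *
  (u z.2 * cos (phase z.1 z.2) + v z.2 * sin (phase z.1 z.2)).
have mph := measurable_joint_phase.
have mG : measurable_fun setT G.
  apply: measurable_funM.
    by apply: (measurableT_comp (@measurable_weight R n)).
  apply: measurable_funD; apply: measurable_funM.
  - exact: (measurableT_comp mu1).
  - exact: measurable_cosT.
  - exact: (measurableT_comp mv).
  - exact: measurable_sinT.
have GC a b : `|G (a, b)| <= (C + D) * weight a * weight b.
  rewrite /G /= normrM (gtr0_norm (weight_gt0 _)) -mulrA mulrCA.
  rewrite ler_wpM2l ?(ltW (weight_gt0 _))//.
  by rewrite (le_trans (norm_cos_sin_le _ _ _))// mulrDl lerD.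
have [iG [dG _]] := integrable_prod_weight mG GC.
have mF : measurable_fun setT (fun a => Rintegral (leb n) setT (fun b => G (a, b))).
  have := measurable_fubini_F iG.
  by move=> /(measurableT_comp (@fine_measurable R setT measurableT)).
have -> : trig u v = (fun a => (weight a)^-1 * Rintegral (leb n) setT (fun b => G (a, b))).
  apply/funext => a; rewrite /G /= RintegralZl//; last first.
    exact/dominated_integrable/dominated_trig_integrand.
  by rewrite mulKf// gt_eqF// weight_gt0.
apply: measurable_funM => //.
rewrite (_ : (fun a => _) = fun a => \prod_(i < n) (1 + tnth a i ^+ 2)); last first.
  by apply/funext => a; rewrite /weight prodfV invrK.
apply: (@measurable_prod_tnth _ _ (fun _ s => 1 + s ^+ 2)) => _.
by apply: measurable_funD => //; exact: measurable_funX.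
Qed.

(** Fubini: the damped inverse transform of the transform is the integral of
    [u] and [v] against the transform of the damping factor. That factor is
    even, so [v], which meets its sine transform, drops out. *)
Lemma trig_trig_damping u v x e : 0 < e -> dominated u -> dominated v ->
  Rintegral (leb n) setT (fun t => damping e t *
     (trig u v t * cos (phase x t) + (- trig v (fun t => - u t) t) * sin (phase x t))) =
  Rintegral (leb n) setT (fun y => u y *
     \prod_(i < n) poisson_kernel e (tnth x i - tnth y i)).
Proof.
move=> e0 du dv; have [mu1 [C uC]] := du; have [mv [D vD]] := dv.
pose G (z : n.-tuple T * n.-tuple T) := damping e z.1 *
  (u z.2 * cos (phase x z.1 - phase z.2 z.1) + - v z.2 * sin (phase x z.1 - phase z.2 z.1)).
have [mde [B dB]] := @dominated_expR R n e e0.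
have mph : measurable_fun setT (fun z : n.-tuple T * n.-tuple T => phase x z.1 - phase z.2 z.1).
  apply: measurable_funB.
    exact: (measurableT_comp (measurable_phase x)).
  under eq_fun do rewrite phaseC; exact: measurable_joint_phase.
have mG : measurable_fun setT G.
  apply: measurable_funM; first exact: (measurableT_comp mde).
  apply: measurable_funD; apply: measurable_funM.
  - exact: (measurableT_comp mu1).
  - exact: measurable_cosT.
  - by apply: measurableT_comp => //; exact: (measurableT_comp mv).
  - exact: measurable_sinT.
have GC a b : `|G (a, b)| <= (B * (C + D)) * weight a * weight b.
  have -> : B * (C + D) * weight a * weight b = (B * weight a) * (C * weight b + D * weight b).
    by ring.
  rewrite /G /= normrM ler_pM//; first exact: dB.
  by rewrite (le_trans (norm_cos_sin_le _ _ _))// normrN lerD.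
have [iG [dG1 dG2]] := integrable_prod_weight mG GC.
have E1 := Rintegral_prod1 iG (fun a => dominated_integrable (dG1 a)).
have E2 := Rintegral_prod2 iG (fun b => dominated_integrable (dG2 b)).
transitivity (Rintegral (leb n \x leb n)%E setT G).
  rewrite E1; apply: eq_Rintegral => a _; rewrite /G/=.
  have mpa : measurable_fun setT (fun b => phase x a - phase b a).
    apply: measurable_funB => //; under eq_fun do rewrite phaseC.
    exact: measurable_phase.
  rewrite RintegralZl//; last first.
    by apply/dominated_integrable/dominated_cos_sin => //; exact: dominatedN.
  have duv := dominated_trig_integrand a du dv.
  have dvu := dominated_trig_integrand a dv (dominatedN du).
  congr (_ * _).
  rewrite /trig mulNr -!RintegralZr//; try exact: dominated_integrable.
  rewrite -RintegralB//; last 2 first.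
  - have := integrableZr measurableT (cos (phase x a)) (dominated_integrable duv).
    by apply: eq_integrable.
  - have := integrableZr measurableT (sin (phase x a)) (dominated_integrable dvu).
    by apply: eq_integrable.
  by apply: eq_Rintegral => b _; rewrite (phaseC b a) cosB sinB; ring.
rewrite E2; apply: eq_Rintegral => b _; rewrite /G/=.
pose z i := 2 * pi * (tnth x i - tnth b i).
have phE a : phase x a - phase b a = \sum_(i < n) z i * tnth a i.
  rewrite /phase -mulrBr -sumrB mulr_sumr; apply: eq_bigr => i _.
  by rewrite /z -mulrBl mulrA.
have Z phi := @Rintegral_expR_cos_tuple R n e z phi e0.
(* Phase -pi/2 gives the sine transform, which is zero. *)
have := Z 0; have := Z (- (pi / 2)); rewrite cosN cos_pihalf cos0 mul0r mul1r => Zs Zc.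
have dd phi : dominated (fun a : n.-tuple T => damping e a * cos (phi + \sum_(i < n) z i * tnth a i)).
  apply: (@dominated_mul _ _ _ _ 1); first exact: dominated_expR.
    exact: measurable_cos_sum.
  by move=> t; exact: cos_max.
transitivity (Rintegral (leb n) setT (fun a => u b * (damping e a * cos (0 + \sum_(i < n) z i * tnth a i))
  + (- v b) * (damping e a * cos (- (pi / 2) + \sum_(i < n) z i * tnth a i)))).
  apply: eq_Rintegral => a _; rewrite phE add0r cosD cosN sinN cos_pihalf sin_pihalf; ring.
rewrite RintegralD//; last 2 first.
- have := integrableZl measurableT (u b) (dominated_integrable (dd 0)).
  by apply: eq_integrable.
- have := integrableZl measurableT (- v b) (dominated_integrable (dd (- (pi / 2)))).
  by apply: eq_integrable.
rewrite !RintegralZl//; try exact: (dominated_integrable (dd _)).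
rewrite Zs Zc mulr0 addr0; congr (_ * _); apply: eq_bigr => i _.
Qed.

(** Splits a bounded modulus of continuity into a small constant and the
    function z^2 / (1 + z^2), whose average against the Poisson kernel is of
    order [e]. *)
Lemma min1_norm_le (eta z : R) : 0 < eta <= 1 ->
  Num.min 1 `|z| <= eta + z ^+ 2 / (1 + z ^+ 2) * (2 / eta).
Proof.
move=> /andP[eta0 eta1]; have z2 := sqr_ge0 z.
have D0 : 0 < 1 + z ^+ 2 by rewrite ltr_pwDl.
have e2 : 0 < 2 / eta by rewrite divr_gt0.
have e1 : 1 <= eta^-1 by rewrite invf_ge1.
have [z1|z1] := leP 1 `|z|.
  have k : 2^-1 <= z ^+ 2 / (1 + z ^+ 2).
    by rewrite ler_pdivlMr// -(real_normK (num_real z)); nra.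
  apply: (@le_trans _ _ (0 + 2^-1 * (2 / eta))).
    by rewrite add0r mulrA mulVf// mul1r.
  by rewrite lerD ?(ltW eta0)// ler_wpM2r// ltW.
have k : z ^+ 2 / 2 <= z ^+ 2 / (1 + z ^+ 2).
  rewrite ler_wpM2l// lef_pV2 ?posrE//; have := real_normK (num_real z).
  by have := normr_ge0 z; nra.
apply: (@le_trans _ _ (eta + z ^+ 2 / 2 * (2 / eta))); last first.
  by rewrite lerD// ler_wpM2r// ltW.
have -> : eta + z ^+ 2 / 2 * (2 / eta) = (eta ^+ 2 + z ^+ 2) / eta.
  by field; rewrite gt_eqF.
rewrite ler_pdivlMr// -(real_normK (num_real z)).
by have := sqr_ge0 (eta - `|z|); have := normr_ge0 z; nra.
Qed.

Lemma poisson_kernel_ge0 (e z : R) : 0 <= e -> 0 <= poisson_kernel e z.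
Proof. by move=> e0; rewrite divr_ge0 ?mulr_ge0// addr_ge0// sqr_ge0. Qed.

(** The right-hand side is e / (2 pi) times the Cauchy density 1 / (pi (1 +
    z^2)), a probability density; integrating therefore gives at most e / (2
    pi). *)
Lemma poisson_kernel_tail (e z : R) : 0 < e ->
  z ^+ 2 / (1 + z ^+ 2) * poisson_kernel e z <= e / (2 * pi) * poisson_kernel (2 * pi) z.
Proof.
move=> e0; rewrite /poisson_kernel.
have := pi_gt0 R; generalize (pi : R) => P P0.
have z2 := sqr_ge0 z.
have D0 : 0 < 1 + z ^+ 2 by rewrite ltr_pwDl.
have e2 : 0 < e ^+ 2 by rewrite exprn_gt0.
have P2 : 0 < P ^+ 2 by rewrite exprn_gt0.
have F0 : 0 < e ^+ 2 + (2 * P * z) ^+ 2 by rewrite ltr_pwDl// sqr_ge0.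
have -> : e / (2 * P) * (2 * (2 * P) / ((2 * P) ^+ 2 + (2 * P * z) ^+ 2)) =
  2 * e / ((2 * P) ^+ 2) / (1 + z ^+ 2).
  field; rewrite !gt_eqF//.
  by rewrite ltr_pwDl ?sqr_ge0// exprn_gt0// mulr_gt0.
rewrite mulrAC ler_wpM2r ?invr_ge0 ?(ltW D0)//.
rewrite ler_pdivlMr ?exprn_gt0 ?mulr_gt0//.
have -> : z ^+ 2 * (2 * e / (e ^+ 2 + (2 * P * z) ^+ 2)) * (2 * P) ^+ 2 =
  2 * e * ((2 * P * z) ^+ 2 / (e ^+ 2 + (2 * P * z) ^+ 2)) by field; rewrite gt_eqF.
rewrite ler_piMr ?mulr_ge0 ?(ltW e0)// ler_pdivrMr// mul1r lerDr (ltW e2)//.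
Qed.

(** Averages against Poisson kernels are an approximate identity. With e =
    eta^2 each coordinate contributes eta from the constant part of
    [min1_norm_le] and (e / 2 pi) (2 / eta) = eta / pi from the tail. *)
Lemma poisson_average_cvg u x (eta : R) (M : R) : 0 < eta <= 1 -> dominated u -> 0 <= M ->
  (forall y, `|u x - u y| <= M * \sum_(i < n) Num.min 1 `|tnth x i - tnth y i|) ->
  `|u x - Rintegral (leb n) setT (fun y => u y *
     \prod_(i < n) poisson_kernel (eta ^+ 2) (tnth x i - tnth y i))| <= M * (n%:R * (2 * eta)).
Proof.
move=> eta01 du M0 uM; have /andP[eta0 eta1] := eta01.
set e := eta ^+ 2; have e0 : 0 < e by rewrite exprn_gt0.
have pi20 : 0 < 2 * pi :> R by rewrite mulr_gt0// pi_gt0.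
have mP (r : R) i : 0 < r -> measurable_fun setT (fun s : R => poisson_kernel r (tnth x i - s)).
  by move=> r0; have [/measurable_int/measurable_EFinP] := Rintegral_poisson (tnth x i) r0.
pose P y := \prod_(i < n) poisson_kernel e (tnth x i - tnth y i).
(* [Q i] arises when the tail estimate is used in coordinate [i]; like [P] it
   has total mass 1. *)
pose Q i y := \prod_(j < n) poisson_kernel (if j == i then 2 * pi else e) (tnth x j - tnth y j).
have PP (r : 'I_n -> R) : (forall i, 0 < r i) ->
    (leb n).-integrable setT (fun y => (\prod_(i < n) poisson_kernel (r i) (tnth x i - tnth y i))%:E) /\
    Rintegral (leb n) setT (fun y => \prod_(i < n) poisson_kernel (r i) (tnth x i - tnth y i)) = 1.
  move=> r0.
  have [|i s|i|i1 i2] := @integrable_prod_tnth R n (fun i s => poisson_kernel (r i) (tnth x i - s)).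
  - by move=> i; exact: mP.
  - by apply: poisson_kernel_ge0; exact: ltW.
  - by have [] := Rintegral_poisson (tnth x i) (r0 i).
  split=> //; rewrite i2 big1// => i _.
  by have [] := Rintegral_poisson (tnth x i) (r0 i).
have [iP P1] := PP (fun=> e) (fun=> e0).
have Qe (i j : 'I_n) : 0 < if j == i then 2 * pi else e by case: ifP.
have iQ i : (leb n).-integrable setT (EFin \o Q i) by have [] := PP _ (Qe i).
have Q1 i : Rintegral (leb n) setT (Q i) = 1 by have [] := PP _ (Qe i).
have P0 y : 0 <= P y by apply: prodr_ge0 => i _; apply: poisson_kernel_ge0; exact: ltW.
have [C C0 uC] := dominated_bounded du.
have iuP : (leb n).-integrable setT (EFin \o (fun y => u y * P y)).
  have := integrableZl measurableT C iP; apply: le_integrable => //.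
    apply/measurable_EFinP/measurable_funM; first exact: du.1.
    by have /measurable_int/measurable_EFinP := iP.
  move=> y _ /=; rewrite lee_fin normrM (ger0_norm (P0 y)) normrM.
  by rewrite (ger0_norm C0) (ger0_norm (P0 y)) ler_wpM2r ?P0 ?uC.
have icP : (leb n).-integrable setT (EFin \o (fun y => u x * P y)).
  by have := integrableZl measurableT (u x) iP; apply: eq_integrable.
have {}P1 : Rintegral (leb n) setT P = 1 := P1.
have {}iP : (leb n).-integrable setT (EFin \o P) := iP.
have -> : u x - Rintegral (leb n) setT (fun y => u y * P y) =
    Rintegral (leb n) setT (fun y => u x * P y - u y * P y).
  by rewrite RintegralB// RintegralZl// P1 mulr1.
have i1 := integrableB measurableT icP iuP.
rewrite (le_trans (le_normr_Rintegral _ _))//.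
pose B y := M * \sum_(i < n) (eta * P y + e / (2 * pi) * (2 / eta) * Q i y).
have iB1 i : (leb n).-integrable setT (EFin \o (fun y => eta * P y + e / (2 * pi) * (2 / eta) * Q i y)).
  have := integrableD measurableT (integrableZl measurableT eta iP)
    (integrableZl measurableT (e / (2 * pi) * (2 / eta)) (iQ i)).
  by apply: eq_integrable.
have iB2 : (leb n).-integrable setT (EFin \o (fun y => \sum_(i < n) (eta * P y + e / (2 * pi) * (2 / eta) * Q i y))).
  have := @integrable_sum _ _ _ (leb n) setT measurableT _ (index_enum 'I_n) predT (fun i y => (eta * P y + e / (2 * pi) * (2 / eta) * Q i y)%:E) (fun i _ => iB1 i).
  by apply: eq_integrable => // y _ /=; rewrite sumEFin.
have iB : (leb n).-integrable setT (EFin \o B).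
  by have := integrableZl measurableT M iB2; apply: eq_integrable.
apply: (@le_trans _ _ (Rintegral (leb n) setT B)).
  apply: le_Rintegral => //; first by have := integrable_norm i1; apply: eq_integrable.
  move=> y _; rewrite -mulrBl normrM (ger0_norm (P0 y)).
  apply: (le_trans (ler_wpM2r (P0 y) (uM y))).
  rewrite -[leLHS]mulrA; apply: ler_wpM2l => //; rewrite mulr_suml.
  apply: ler_sum => i _.
  apply: (le_trans (ler_wpM2r (P0 y) (min1_norm_le _ eta01))).
  rewrite mulrDl lerD2l mulrAC [leRHS]mulrAC ler_wpM2r ?divr_ge0 ?(ltW eta0)//.
  rewrite /P /Q (bigD1 i)//= [in leRHS](bigD1 i)//= eqxx [leLHS]mulrA [leRHS]mulrA.
  have -> : \prod_(j < n | j != i) poisson_kernel (if j == i then 2 * pi else e) (tnth x j - tnth y j) =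
     \prod_(j < n | j != i) poisson_kernel e (tnth x j - tnth y j).
    by apply: eq_bigr => j /negbTE ->.
  rewrite ler_wpM2r//; last exact: poisson_kernel_tail.
  by apply: prodr_ge0 => j _; apply: poisson_kernel_ge0; exact: ltW.
rewrite /B RintegralZl// ler_wpM2l//.
have -> : Rintegral (leb n) setT (fun y => \sum_(i < n) (eta * P y + e / (2 * pi) * (2 / eta) * Q i y)) =
  \sum_(i < n) Rintegral (leb n) setT (fun y => eta * P y + e / (2 * pi) * (2 / eta) * Q i y).
  rewrite /Rintegral; under eq_integral do rewrite -sumEFin.
  rewrite integral_sum// -sum_fine// => i _; exact: integrable_fin_num (iB1 i).
have bnd (i : 'I_n) : Rintegral (leb n) setT (fun y => eta * P y + e / (2 * pi) * (2 / eta) * Q i y) <= 2 * eta.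
  rewrite RintegralD//; last 2 first.
  - by have := integrableZl measurableT eta iP; apply: eq_integrable.
  - by have := integrableZl measurableT (e / (2 * pi) * (2 / eta)) (iQ i); apply: eq_integrable.
  rewrite !RintegralZl// Q1 P1 !mulr1 [leRHS](_ : _ = eta + eta) ?lerD2l; last by ring.
  rewrite /e; have := pi_ge2 R; have := pi_gt0 R; generalize (pi : R) => p p0 p2.
  have -> : eta ^+ 2 / (2 * p) * (2 / eta) = eta / p by field; rewrite !gt_eqF.
  by rewrite ler_pdivrMr// ler_peMr ?(ltW eta0)//; lra.
apply: (le_trans (ler_sum _ (fun i _ => bnd i))).
by rewrite sumr_const card_ord [leRHS]mulr_natl.
Qed.

(** As eta -> 0 the damped double integral tends to the undamped one by
    domination, and to [u x] because it is a Poisson average of [u]. The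
    hypothesis on [M] is what a bounded Lipschitz function satisfies. *)
Theorem trig_inversion u v x (M : R) : dominated u -> dominated v ->
  dominated (trig u v) -> dominated (trig v (fun t => - u t)) -> 0 <= M ->
  (forall y, `|u x - u y| <= M * \sum_(i < n) Num.min 1 `|tnth x i - tnth y i|) ->
  u x = trig (trig u v) (fun t => - trig v (fun t => - u t) t) x.
Proof.
move=> du dv dU dV M0 uM.
pose eta k : R := k.+1%:R^-1.
have eta01 k : 0 < eta k <= 1 by rewrite /eta invr_gt0 ltr0n/= invf_le1 ?ltr0n// ler1n.
have e0 k : 0 < eta k ^+ 2 by have /andP[? _] := eta01 k; rewrite exprn_gt0.
have eta_cvg0 : eta k @[k --> \oo] --> 0 := @cvg_harmonic R.
set g := fun t => trig u v t * cos (phase x t) + (- trig v (fun t => - u t) t) * sin (phase x t).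
have dg : dominated g by apply: dominated_trig_integrand => //; exact: dominatedN.
have c1 : Rintegral (leb n) setT (fun t => damping (eta k ^+ 2) t * g t) @[k --> \oo]
    --> Rintegral (leb n) setT g.
  apply: (@Rintegral_dominated_cvg _ _ _ _ _ (fun t => `|g t|)).
  - by move=> k; apply: measurable_funM; [have [] := @dominated_expR R n _ (e0 k)|exact: dg.1].
  - exact: dg.1.
  - move=> t; rewrite -[X in _ --> X]mul1r; apply: cvgM; last exact: cvg_cst.
    set S := \sum_(i < n) `|tnth t i|.
    have -> : (fun k => damping (eta k ^+ 2) t) = (fun k => expR (- (eta k * eta k * S))).
      by apply/funext => k; rewrite /damping mulr_sumr -sumrN expR_sum expr2.
    have cS : - (eta k * eta k * S) @[k --> \oo] --> - (0 * 0 * S).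
      by apply: cvgN; apply: cvgM; [exact: cvgM|exact: cvg_cst].
    rewrite [X in _ --> X](_ : 1 = expR (- (0 * 0 * S))); last by rewrite !mul0r oppr0 expR0.
    by apply: continuous_cvg => //; exact: continuous_expR.
  - exact/dominated_integrable/dominated_norm.
  - move=> k t; rewrite normrM ler_piMl// ger0_norm; last by apply: prodr_ge0 => i _; exact: expR_ge0.
    apply: prodr_ile1 => i; rewrite expR_ge0 -[leRHS]expR0 ler_expR oppr_le0.
    by rewrite mulr_ge0// ltW.
have c2 : Rintegral (leb n) setT (fun t => damping (eta k ^+ 2) t * g t) @[k --> \oo] --> u x.
  under eq_cvg do rewrite (trig_trig_damping x (e0 _) du dv).
  apply/cvgrPdist_le => /= r r0; near=> k.
  apply: le_trans (poisson_average_cvg (eta01 k) du M0 uM) _.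
  apply: le_trans (ler_norm _) _; near: k; apply: cvgr0_norm_le => //.
  rewrite -[X in _ --> X](mulr0 M) -[X in M * X](mulr0 n%:R) -[X in n%:R * X](mulr0 2).
  by do 3 (apply: cvgM; first exact: cvg_cst).
by rewrite /trig; exact: (cvg_unique _ c2 c1).
Unshelve. all: by end_near.
Qed.
End Inversion.

(** * Schwartz functions and their transforms *)

Section TrigPartial.
Variable R : realType.
Local Notation T := (measurableTypeR R).
Local Notation leb := (lebesgue_tuple R).
Variable n : nat.
Implicit Types (u v : n.-tuple T -> R) (x y t : n.-tuple T).

Lemma phase_tset x t i (s : R) :
  phase x (tset t i s) = phase x (tset t i 0) + (2 * pi * tnth x i) * s.
Proof.
rewrite /phase (bigD1 i)//= [in RHS](bigD1 i)//= !tnth_mktuple eqxx mulr0 add0r.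
rewrite (eq_bigr (fun j => tnth x j * tnth (tset t i 0) j)); first by ring.
by move=> j ji; rewrite !tnth_mktuple (negbTE ji).
Qed.

Lemma dominatedZ u (c : R) : dominated u -> dominated (fun t => c * u t).
Proof.
move=> [mu1 [C uC]]; split; first exact: measurable_funM.
by exists (`|c| * C) => t; rewrite normrM -mulrA ler_wpM2l.
Qed.

(** Integration by parts: the partial derivative of u cos + v sin along
    coordinate [i] has integral 0. *)
Lemma trig_partial i u v u' v' x :
  dominated u -> dominated v -> dominated u' -> dominated v' ->
  (forall t (s : R), is_derive s 1 (fun s => u (tset t i s)) (u' (tset t i s))) ->
  (forall t (s : R), is_derive s 1 (fun s => v (tset t i s)) (v' (tset t i s))) ->
  (forall t, continuous (fun s : R => u' (tset t i s))) ->
  (forall t, continuous (fun s : R => v' (tset t i s))) ->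
  trig u' v' x = - (2 * pi * tnth x i) * trig v (fun t => - u t) x.
Proof.
move=> du dv du' dv' uu' vv' cu' cv'.
set c := 2 * pi * tnth x i.
pose h t := u' t * cos (phase x t) + v' t * sin (phase x t).
pose k t := v t * cos (phase x t) + - u t * sin (phase x t).
have dh : dominated h by exact: dominated_trig_integrand.
have dk : dominated k by apply: dominated_trig_integrand => //; exact: dominatedN.
suff : Rintegral (leb n) setT (fun t => h t + c * k t) = 0.
  rewrite RintegralD//; last 2 first.
  - exact: dominated_integrable.
  - exact/dominated_integrable/dominatedZ.
  rewrite RintegralZl//; last exact: dominated_integrable.
  by move=> /eqP; rewrite addr_eq0 -mulNr => /eqP.
apply: (@Rintegral_partial R n i (fun t => u t * cos (phase x t) + v t * sin (phase x t))).
- exact: dominated_trig_integrand.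
- by apply: dominatedD => //; exact: dominatedZ.
- move=> t s; rewrite /h /k.
  have := uu' t s; have := vv' t s.
  rewrite (_ : (fun s => u (tset t i s) * cos (phase x (tset t i s)) + v (tset t i s) * sin (phase x (tset t i s))) =
    (fun s => u (tset t i s) * cos (phase x (tset t i 0) + c * s) + v (tset t i s) * sin (phase x (tset t i 0) + c * s))); last first.
    by apply/funext => r; rewrite (phase_tset x t i r).
  rewrite (phase_tset x t i s) -/c; move: (phase x (tset t i 0)) => a.
  move=> dvs dus; apply: is_derive_eq.
  by rewrite /GRing.scale/= mulr1; ring.
- move=> t.
  have cc (r : R) : continuous (fun s : R => r + c * s).
    by move=> s; apply: cvgD; [exact: cvg_cst|apply: cvgM; [exact: cvg_cst|exact: cvg_id]].
  have Eph : (fun s => phase x (tset t i s)) = (fun s => phase x (tset t i 0) + c * s).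
    by apply/funext => s; exact: phase_tset.
  have ccos : continuous (fun s => cos (phase x (tset t i s))).
    rewrite [X in continuous X](_ : _ = @cos R \o (fun s => phase x (tset t i s))) // Eph.
    by move=> s; apply: continuous_comp; [exact: cc|exact: continuous_cos].
  have csin : continuous (fun s => sin (phase x (tset t i s))).
    rewrite [X in continuous X](_ : _ = @sin R \o (fun s => phase x (tset t i s))) // Eph.
    by move=> s; apply: continuous_comp; [exact: cc|exact: continuous_sin].
  have cu : continuous (fun s : R => u (tset t i s)).
    by move=> s; apply: differentiable_continuous; apply/derivable1_diffP; have [] := uu' t s.
  have cv : continuous (fun s : R => v (tset t i s)).
    by move=> s; apply: differentiable_continuous; apply/derivable1_diffP; have [] := vv' t s.
  move=> s; rewrite /h /k; apply: cvgD.
    by apply: cvgD; apply: cvgM; [exact: cu'|exact: ccos|exact: cv'|exact: csin].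
  apply: cvgM; first exact: cvg_cst.
  by apply: cvgD; apply: cvgM; [exact: cv|exact: ccos|apply: cvgN; exact: cu|exact: csin].
Qed.
End TrigPartial.

Section Rows.
Variables (R : realType) (d : nat).
Local Notation T := (measurableTypeR R).
Local Notation V := 'rV[R]_d.
Local Notation leb := (lebesgue_tuple R).
Local Notation row := (@row_of_tuple R d).
Implicit Types (x y xi : V) (t : d.-tuple T).

Definition tuple_of_row x : d.-tuple T := [tuple x ord0 i | i < d].

Lemma tuple_of_rowK x : row (tuple_of_row x) = x.
Proof. by apply/rowP => i; rewrite mxE tnth_mktuple. Qed.

Lemma row_of_tupleK t : tuple_of_row (row t) = t.
Proof. by apply: eq_from_tnth => i; rewrite tnth_mktuple mxE. Qed.

(** The sigma-algebra on tuples is generated by the coordinates, so open sets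
    have to be exhibited as countable unions of sets defined by coordinates:
    the l^1 balls with rational centres and radii 1/(k+1) that are contained
    in them. *)
Lemma measurable_comp_row (g : V -> R) : continuous g ->
  measurable_fun setT (fun t => g (row t)).
Proof.
move=> /continuousP cg; apply: (measurability _ (RGenOpens.measurableE R)).
move=> _ [_ [a [b ->] <-]]; rewrite setTI.
pose O := g @^-1` `]a, b[%classic; have oO : open O by apply: cg; exact: interval_open.
pose S (q : 'rV[rat]_d) t : R := \sum_i `|ratr (q ord0 i) - tnth t i|.
have mS q : measurable_fun setT (S q).
  apply: measurable_sum => i; apply: measurableT_comp => //.
  by apply: measurable_funB => //; exact: measurable_tnth.
pose F (qk : 'rV[rat]_d * nat) := [set t | S qk.1 t < qk.2.+1%:R^-1 /\
  (forall s, S qk.1 s < qk.2.+1%:R^-1 -> O (row s))].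
have -> : (fun t => g (row t)) @^-1` (`]a, b[%classic) = \bigcup_qk F qk.
  apply/seteqP; split=> [t Ot|t [[q k] _ []]]; last by move=> St; apply.
  have /nbhs_ballP[e /= e0 Oe] : nbhs (row t) O by apply: open_nbhs_nbhs.
  pose k := Num.truncn (2 / e).
  have ke : 2 / k.+1%:R < e.
    by rewrite ltr_pdivrMr ?ltr0n// mulrC -ltr_pdivrMr//; exact: truncnS_gt.
  have k0 : 0 < k.+1%:R^-1 / d.+1%:R :> R by rewrite divr_gt0 ?invr_gt0.
  have qP i : exists r : rat, `|ratr r - tnth t i| < k.+1%:R^-1 / d.+1%:R.
    have : tnth t i - k.+1%:R^-1 / d.+1%:R < tnth t i + k.+1%:R^-1 / d.+1%:R.
      by rewrite ltrD2l gtrN.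
    move=> /rat_in_itvoo[r]; rewrite in_itv/= => rt.
    by exists r; rewrite ltr_distl.
  pose q : 'rV[rat]_d := \row_i projT1 (cid (qP i)).
  have St : S q t < k.+1%:R^-1.
    have St' : S q t <= d%:R * (k.+1%:R^-1 / d.+1%:R).
      rewrite -[d in d%:R]card_ord mulr_natl -sumr_const; apply: ler_sum => i _.
      by rewrite mxE; apply: ltW; exact: projT2 (cid (qP i)).
    apply: le_lt_trans St' _; rewrite mulrCA gtr_pMr ?invr_gt0//.
    by rewrite ltr_pdivrMr// mul1r ltr_nat.
  exists (q, k) => //; split=> // s Ss; apply: Oe; split=> // i j.
  rewrite (ord1 i) /ball/= !mxE.
  have le_S r : `|ratr (q ord0 j) - tnth r j| <= S q r.
    by rewrite /S (bigD1 j)//= lerDl; apply: sumr_ge0.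
  apply: (le_lt_trans (ler_distD (ratr (q ord0 j)) _ _)).
  apply: lt_trans ke; rewrite mulrDl mul1r; apply: ltrD.
    by rewrite distrC (le_lt_trans (le_S t)).
  by rewrite (le_lt_trans (le_S s)).
apply: countable_bigcupT_measurable; first exact: countableP.
move=> [q k]; rewrite /F/=.
have [H|H] := pselect (forall s, S q s < k.+1%:R^-1 -> O (row s)).
  rewrite (_ : [set t | _] = setT `&` S q @^-1` `]-oo, k.+1%:R^-1[%classic).
    by apply: mS => //; exact: measurable_itv.
  by rewrite setTI; apply/seteqP; split=> t /=; rewrite in_itv/=; [case|].
rewrite (_ : [set t | _] = set0) //.
by apply/seteqP; split=> t //= [].
Qed.

Lemma is_derive_line (g : V -> R) x v (s a : R) :
  is_derive (x + s *: v) v g a -> is_derive s 1 (fun r => g (x + r *: v)) a.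
Proof.
move=> [dg ga].
have E : (fun h : R => h^-1 *: (g (x + (h *: 1 + s) *: v) - g (x + s *: v))) =
         (fun h : R => h^-1 *: (g (h *: v + (x + s *: v)) - g (x + s *: v))).
  apply/funext => h; congr (_ *: (g _ - _)).
  by rewrite scalerDl addrCA /GRing.scale/= mulr1.
by split; [rewrite /derivable E|rewrite -ga /derive E].
Qed.

(** The mean value theorem on the segment from [x] to [y]. *)
Lemma lipschitz_of_partials (g : V -> R) (L : R) :
  (forall x, differentiable g x) ->
  (forall x i, `|'D_(delta_mx ord0 i) g x| <= L) ->
  forall x y, `|g y - g x| <= L * \sum_i `|y ord0 i - x ord0 i|.
Proof.
move=> dg gL x y; set v := y - x.
have dphi (s : R) : is_derive s 1 (fun r => g (x + r *: v)) ('d g (x + s *: v) v).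
  apply: is_derive_line; split; last by rewrite deriveE.
  exact: diff_derivable.
have cphi : continuous (fun r : R => g (x + r *: v)).
  by move=> s; apply: differentiable_continuous; apply/derivable1_diffP; have [] := dphi s.
have [|c _] := @MVT_segment R (fun r => g (x + r *: v)) (fun s => 'd g (x + s *: v) v) 0 1 ler01 (fun s _ => dphi s).
  exact: continuous_subspaceT.
rewrite scale1r scale0r addr0 subr0 mulr1 [x + v]addrC subrK => ->.
rewrite [v in X in `|X|]row_sum_delta linear_sum/=.
rewrite (le_trans (ler_norm_sum _ _ _))// mulr_sumr ler_sum// => i _.
rewrite linearZ/= normrM mulrC -deriveE// -[v ord0 i]/(_) !mxE ler_wpM2r//.
Qed.

Lemma jbracket_sqr x : jbracket x ^+ 2 = 1 + \sum_i x ord0 i ^+ 2.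
Proof.
have d0 : 0 <= dotp x x by apply: sumr_ge0 => i _; rewrite -expr2 sqr_ge0.
rewrite /jbracket sqr_sqrtr ?addr_ge0 ?sqr_ge0// /enorm sqr_sqrtr//.
Qed.

Lemma jbracket_ge1 x : 1 <= jbracket x.
Proof. by rewrite /jbracket -[leLHS]sqrtr1 ler_wsqrtr// lerDl sqr_ge0. Qed.

(** Each factor 1 + x_i^2 is at most <x>^2, so <x>^(2 d) dominates their
    product. *)
Lemma weight_jbracket x : 1 <= jbracket x ^+ (2 * d) * weight (tuple_of_row x).
Proof.
rewrite exprM jbracket_sqr /weight -[X in _ ^+ X]card_ord -prodr_const -big_split/=.
rewrite -[leLHS](@big1_eq _ 1 *%R _ (index_enum 'I_d) predT).
apply: ler_prod => i _; rewrite ler01/= tnth_mktuple ler_pdivlMr ?mul1r; last first.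
  by rewrite ltr_pwDl// sqr_ge0.
rewrite lerD2l (bigD1 i)//= lerDl; apply: sumr_ge0 => j _; exact: sqr_ge0.
Qed.

Lemma normc_ge_Re (z : R[i]) : `|complex.Re z| <= Normc.normc z.
Proof.
case: z => a b /=; rewrite -sqrtr_sqr ler_wsqrtr// lerDl sqr_ge0 //.
Qed.

Lemma normc_ge_Im (z : R[i]) : `|complex.Im z| <= Normc.normc z.
Proof.
case: z => a b /=; rewrite -sqrtr_sqr ler_wsqrtr// lerDr sqr_ge0 //.
Qed.

End Rows.

Lemma trigN (R : realType) n (u v : n.-tuple (measurableTypeR R) -> R) x : dominated u -> dominated v ->
  trig (fun t => - u t) (fun t => - v t) x = - trig u v x.
Proof.
move=> du dv; rewrite /trig -mulN1r -RintegralZl//; last first.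
  exact/dominated_integrable/dominated_trig_integrand.
by apply: eq_Rintegral => t _; rewrite mulrDr !mulNr !mul1r.
Qed.

Section SchwartzFourier.
Variables (R : realType) (d : nat).
Local Notation T := (measurableTypeR R).
Local Notation V := 'rV[R]_d.
Local Notation leb := (lebesgue_tuple R).
Local Notation row := (@row_of_tuple R d).
Local Notation tor := (@tuple_of_row R d).
Implicit Types (x y xi : V) (t : d.-tuple T) (f : V -> R[i]).

Definition re_tuple f t : R := complex.Re (f (row t)).
Definition im_tuple f t : R := complex.Im (f (row t)).

Lemma schwartz_cpartial i f : schwartz f -> schwartz (cpartial i f).
Proof.
by move=> sf s; have := sf (rcons s i); rewrite /cpartials -cats1 foldr_cat.
Qed.

Lemma schwartz_differentiable f : schwartz f -> cdifferentiable f.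
Proof. by move=> /(_ [::])[]. Qed.

Lemma schwartz_bound f k : schwartz f ->
  exists2 M, 0 <= M & forall x, jbracket x ^+ k * Normc.normc (f x) <= M.
Proof.
move=> /(_ [::])[_ /(_ k)[M fM]]; exists M => //.
apply: le_trans (fM 0); rewrite mulr_ge0 ?exprn_ge0 ?(le_trans ler01 (jbracket_ge1 _))//.
by apply: le_trans (normc_ge_Re _).
Qed.

Lemma continuous_Re f : schwartz f -> continuous (fun x => complex.Re (f x)).
Proof. by move=> sf x; apply: differentiable_continuous; have [] := schwartz_differentiable sf x. Qed.

Lemma continuous_Im f : schwartz f -> continuous (fun x => complex.Im (f x)).
Proof. by move=> sf x; apply: differentiable_continuous; have [] := schwartz_differentiable sf x. Qed.

Lemma dominated_of_jbracket (g : V -> R) M : measurable_fun setT (fun t => g (row t)) ->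
  (forall x, jbracket x ^+ (2 * d) * `|g x| <= M) -> dominated (fun t => g (row t)).
Proof.
move=> mg gM; split=> //; exists M => t; set x := row t.
have w0 := @weight_gt0 R d t.
have j1 : 1 <= jbracket x ^+ (2 * d) * weight t.
  by have := weight_jbracket x; rewrite row_of_tupleK.
apply: (@le_trans _ _ (jbracket x ^+ (2 * d) * `|g x| * weight t)).
  by rewrite mulrAC ler_peMl.
by rewrite ler_wpM2r// ltW.
Qed.

Lemma schwartz_dominated_re f : schwartz f -> dominated (re_tuple f).
Proof.
move=> sf; have [M M0 fM] := schwartz_bound (2 * d) sf.
apply: (@dominated_of_jbracket (fun x => complex.Re (f x)) M).
  by apply: (@measurable_comp_row R d (fun x => complex.Re (f x))); exact: continuous_Re.
move=> x; apply: le_trans (fM x); rewrite ler_wpM2l ?normc_ge_Re//.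
by rewrite exprn_ge0// (le_trans ler01 (jbracket_ge1 _)).
Qed.

Lemma schwartz_dominated_im f : schwartz f -> dominated (im_tuple f).
Proof.
move=> sf; have [M M0 fM] := schwartz_bound (2 * d) sf.
apply: (@dominated_of_jbracket (fun x => complex.Im (f x)) M).
  by apply: (@measurable_comp_row R d (fun x => complex.Im (f x))); exact: continuous_Im.
move=> x; apply: le_trans (fM x); rewrite ler_wpM2l ?normc_ge_Im//.
by rewrite exprn_ge0// (le_trans ler01 (jbracket_ge1 _)).
Qed.

Lemma row_tset t i (s : R) :
  row (tset t i s) = row (tset t i 0) + s *: delta_mx ord0 i.
Proof.
apply/rowP => j; rewrite !mxE !tnth_mktuple eqxx/= eq_sym.
by case: eqP => _; rewrite ?mulr1 ?mulr0 ?add0r ?addr0.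
Qed.

Lemma is_derive_re_tuple i f t (s : R) : schwartz f ->
  is_derive s 1 (fun s => re_tuple f (tset t i s)) (re_tuple (cpartial i f) (tset t i s)).
Proof.
move=> sf; rewrite /re_tuple.
rewrite (_ : (fun _ => _) = (fun s => complex.Re (f (row (tset t i 0) + s *: delta_mx ord0 i)))).
  rewrite (row_tset t i s); apply: (@is_derive_line R d (fun x => complex.Re (f x))); split=> //.
  by apply: diff_derivable; have [] := schwartz_differentiable sf (row (tset t i 0) + s *: delta_mx ord0 i).
by apply/funext => r; rewrite (row_tset t i r).
Qed.

Lemma is_derive_im_tuple i f t (s : R) : schwartz f ->
  is_derive s 1 (fun s => im_tuple f (tset t i s)) (im_tuple (cpartial i f) (tset t i s)).
Proof.
move=> sf; rewrite /im_tuple.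
rewrite (_ : (fun _ => _) = (fun s => complex.Im (f (row (tset t i 0) + s *: delta_mx ord0 i)))).
  rewrite (row_tset t i s); apply: (@is_derive_line R d (fun x => complex.Im (f x))); split=> //.
  by apply: diff_derivable; have [] := schwartz_differentiable sf (row (tset t i 0) + s *: delta_mx ord0 i).
by apply/funext => r; rewrite (row_tset t i r).
Qed.

Lemma fourierE f xi : fourier f xi =
  Complex (trig (re_tuple f) (im_tuple f) (tor xi))
          (trig (im_tuple f) (fun t => - re_tuple f t) (tor xi)).
Proof.
rewrite /fourier /cintegral.
have ph t : 2 * pi * dotp (row t) xi = phase (tor xi) t.
  rewrite /phase /dotp; congr (_ * _); apply: eq_bigr => i _.
  by rewrite mxE tnth_mktuple mulrC.
congr Complex; apply: eq_Rintegral => t _; rewrite ph /re_tuple /im_tuple /cis cosN sinN.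
  by case: (f (row t)) => a b /=; rewrite mulrN opprK.
by case: (f (row t)) => a b /=; rewrite mulrN mulNr addrC.
Qed.

(* Keeps conversion from unfolding the integral. *)
Local Opaque fourier.

Lemma fourier_cpartial i f xi : schwartz f ->
  fourier (cpartial i f) xi =
  Complex (- (2 * pi * xi ord0 i) * complex.Im (fourier f xi))
          (2 * pi * xi ord0 i * complex.Re (fourier f xi)).
Proof.
move=> sf; have sif := schwartz_cpartial i sf.
have du := schwartz_dominated_re sf; have dv := schwartz_dominated_im sf.
have du' := schwartz_dominated_re sif; have dv' := schwartz_dominated_im sif.
have cu' t : continuous (fun s : R => re_tuple (cpartial i f) (tset t i s)).
  move=> s; apply: differentiable_continuous; apply/derivable1_diffP.
  by have [] := is_derive_re_tuple i t s sif.
have cv' t : continuous (fun s : R => im_tuple (cpartial i f) (tset t i s)).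
  move=> s; apply: differentiable_continuous; apply/derivable1_diffP.
  by have [] := is_derive_im_tuple i t s sif.
have uu' t s := is_derive_re_tuple i t s sf.
have vv' t s := is_derive_im_tuple i t s sf.
rewrite !fourierE /=; congr Complex.
  by rewrite (trig_partial _ du dv du' dv')// tnth_mktuple.
rewrite (@trig_partial R d i _ _ _ _ _ dv (dominatedN du) dv' (dominatedN du'))//.
- by rewrite tnth_mktuple trigN// mulrNN.
- by move=> t s; apply: cvgN; exact: cu'.
Qed.

Lemma fourier_cpartial_re i f xi : schwartz f ->
  complex.Re (fourier (cpartial i f) xi) = - (2 * pi * xi ord0 i) * complex.Im (fourier f xi).
Proof. by move=> sf; rewrite fourier_cpartial. Qed.

Lemma fourier_cpartial_im i f xi : schwartz f ->
  complex.Im (fourier (cpartial i f) xi) = 2 * pi * xi ord0 i * complex.Re (fourier f xi).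
Proof. by move=> sf; rewrite fourier_cpartial. Qed.

Lemma fourier_bounded f : schwartz f -> exists C, forall xi,
  `|complex.Re (fourier f xi)| + `|complex.Im (fourier f xi)| <= C.
Proof.
move=> sf; have du := schwartz_dominated_re sf; have dv := schwartz_dominated_im sf.
have [C C0 hC] := trig_bounded du dv; have [D D0 hD] := trig_bounded dv (dominatedN du).
by exists (C + D) => xi; rewrite fourierE; apply: lerD; [exact: hC|exact: hD].
Qed.

(** Induction on [k]: <xi>^2 = 1 + sum_i xi_i^2, and xi_i^2 times the
    transform of [f] is, up to sign and the factor (2 pi)^2 >= 1, the
    transform of a second partial derivative of [f]. *)
Lemma fourier_decay f k : schwartz f -> exists C, forall xi,
  jbracket xi ^+ (2 * k) * (`|complex.Re (fourier f xi)| + `|complex.Im (fourier f xi)|) <= C.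
Proof.
elim: k f => [|k IH] f sf.
  by have [C hC] := fourier_bounded sf; exists C => xi; rewrite expr0 mul1r.
have [C hC] := IH f sf.
have sii i : schwartz (cpartial i (cpartial i f)) by do 2 apply: schwartz_cpartial.
pose D i := projT1 (cid (IH _ (sii i))).
have hD i xi : jbracket xi ^+ (2 * k) * (`|complex.Re (fourier (cpartial i (cpartial i f)) xi)| +
    `|complex.Im (fourier (cpartial i (cpartial i f)) xi)|) <= D i := projT2 (cid (IH _ (sii i))) xi.
exists (C + \sum_i D i) => xi.
have p1 : 1 <= (2 * pi) ^+ 2 :> R by rewrite exprn_ege1//; have := pi_ge2 R; lra.
have E i : `|complex.Re (fourier (cpartial i (cpartial i f)) xi)| +
    `|complex.Im (fourier (cpartial i (cpartial i f)) xi)| =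
  (2 * pi) ^+ 2 * xi ord0 i ^+ 2 * (`|complex.Re (fourier f xi)| + `|complex.Im (fourier f xi)|).
  move: (fourier_cpartial_re i xi sf) (fourier_cpartial_im i xi sf) (schwartz_cpartial i sf).
  move: (cpartial i f) => g e1 e2 sg.
  rewrite (fourier_cpartial_re i xi sg) (fourier_cpartial_im i xi sg) e1 e2.
  move: (complex.Re (fourier f xi)) (complex.Im (fourier f xi)) => a b.
  rewrite -exprMn; move: (2 * pi * xi ord0 i) => c; rewrite mulrDr.
  by rewrite !normrM !normrN !mulrA -expr2 real_normK ?num_real.
set S := `|_| + _ in E hC *; set J := jbracket xi ^+ (2 * k) in hC *.
have S0 : 0 <= S by rewrite addr_ge0.
have J0 : 0 <= J by rewrite exprn_ge0// (le_trans ler01 (jbracket_ge1 _)).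
have -> : jbracket xi ^+ (2 * k.+1) * S = J * S + \sum_i xi ord0 i ^+ 2 * (J * S).
  by rewrite mulnS exprD jbracket_sqr -mulr_suml /J; ring.
rewrite lerD ?hC// ler_sum// => i _.
apply: le_trans (hD i xi); rewrite E mulrCA ler_wpM2l// ler_wpM2r//.
by rewrite ler_peMl// sqr_ge0.
Qed.

Lemma measurable_fourier_re f : schwartz f ->
  measurable_fun setT (fun t => complex.Re (fourier f (row t))).
Proof.
move=> sf; under eq_fun do rewrite fourierE row_of_tupleK /=.
exact: measurable_trig (schwartz_dominated_re sf) (schwartz_dominated_im sf).
Qed.

Lemma measurable_fourier_im f : schwartz f ->
  measurable_fun setT (fun t => complex.Im (fourier f (row t))).
Proof.
move=> sf; under eq_fun do rewrite fourierE row_of_tupleK /=.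
exact: measurable_trig (schwartz_dominated_im sf) (dominatedN (schwartz_dominated_re sf)).
Qed.

Lemma dominated_fourier f : schwartz f ->
  dominated (re_tuple (fourier f)) /\ dominated (im_tuple (fourier f)).
Proof.
move=> sf; have [C hC] := fourier_decay d sf.
have j0 xi : 0 <= jbracket xi ^+ (2 * d) by rewrite exprn_ge0// (le_trans ler01 (jbracket_ge1 _)).
split.
  apply: (@dominated_of_jbracket (fun x => complex.Re (fourier f x)) C).
    exact: measurable_fourier_re.
  by move=> x; apply: le_trans (hC x); rewrite ler_wpM2l// lerDl.
apply: (@dominated_of_jbracket (fun x => complex.Im (fourier f x)) C).
  exact: measurable_fourier_im.
by move=> x; apply: le_trans (hC x); rewrite ler_wpM2l// lerDr.
Qed.

(** When some coordinate moves by at least 1, boundedness suffices; otherwise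
    the minima are the coordinate differences. *)
Lemma min_lipschitz (g : V -> R) (C L : R) : 0 <= L ->
  (forall x, `|g x| <= C) -> (forall x y, `|g y - g x| <= L * \sum_i `|y ord0 i - x ord0 i|) ->
  exists2 M, 0 <= M & forall x y, `|g x - g y| <= M * \sum_i Num.min 1 `|x ord0 i - y ord0 i|.
Proof.
move=> L0 gC gL; have C0 : 0 <= C := le_trans (normr_ge0 _) (gC 0).
exists (L + 2 * C); first by rewrite addr_ge0// mulr_ge0.
move=> x y.
have m0 (z : R) : 0 <= Num.min 1 `|z| by rewrite le_min ler01 normr_ge0.
have [/existsP[i i1]|/existsPn H] := boolP [exists i, 1 <= `|x ord0 i - y ord0 i|].
  apply: (@le_trans _ _ ((L + 2 * C) * 1)).
    rewrite mulr1 (le_trans (ler_normB _ _))//.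
    by have := gC x; have := gC y; lra.
  rewrite ler_wpM2l ?addr_ge0 ?mulr_ge0//.
  rewrite (bigD1 i)//= (min_idPl i1) lerDl; exact: sumr_ge0.
rewrite (le_trans (gL y x))// ler_pM ?sumr_ge0// ?lerDl ?mulr_ge0//.
by apply: ler_sum => i _; rewrite le_min lexx andbT ltW// ltNge H.
Qed.

Lemma schwartz_lipschitz_re f : schwartz f -> exists2 M, 0 <= M & forall x y,
  `|complex.Re (f x) - complex.Re (f y)| <= M * \sum_i Num.min 1 `|x ord0 i - y ord0 i|.
Proof.
move=> sf; have [C C0 hC] := schwartz_bound 0 sf.
have hM i := schwartz_bound 0 (schwartz_cpartial i sf).
pose L i := projT1 (cid2 (hM i)).
have L0 i : 0 <= L i by rewrite /L; case: cid2.
have hL i x : `|'D_(delta_mx ord0 i) (fun y => complex.Re (f y)) x| <= L i.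
  rewrite /L; case: cid2 => M _ /(_ x) /=; rewrite expr0 mul1r; apply: le_trans.
  exact: (normc_ge_Re (cpartial i f x)).
apply: (@min_lipschitz (fun x => complex.Re (f x)) C (\sum_i L i)).
- exact: sumr_ge0.
- by move=> x; have := hC x; rewrite expr0 mul1r; apply: le_trans; exact: normc_ge_Re.
- apply: lipschitz_of_partials.
    by move=> x; have [] := schwartz_differentiable sf x.
  move=> x i; rewrite (le_trans (hL i x))// (bigD1 i)//= lerDl; exact: sumr_ge0.
Qed.

Lemma schwartz_lipschitz_im f : schwartz f -> exists2 M, 0 <= M & forall x y,
  `|complex.Im (f x) - complex.Im (f y)| <= M * \sum_i Num.min 1 `|x ord0 i - y ord0 i|.
Proof.
move=> sf; have [C C0 hC] := schwartz_bound 0 sf.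
have hM i := schwartz_bound 0 (schwartz_cpartial i sf).
pose L i := projT1 (cid2 (hM i)).
have L0 i : 0 <= L i by rewrite /L; case: cid2.
have hL i x : `|'D_(delta_mx ord0 i) (fun y => complex.Im (f y)) x| <= L i.
  rewrite /L; case: cid2 => M _ /(_ x) /=; rewrite expr0 mul1r; apply: le_trans.
  exact: (normc_ge_Im (cpartial i f x)).
apply: (@min_lipschitz (fun x => complex.Im (f x)) C (\sum_i L i)).
- exact: sumr_ge0.
- by move=> x; have := hC x; rewrite expr0 mul1r; apply: le_trans; exact: normc_ge_Im.
- apply: lipschitz_of_partials.
    by move=> x; have [] := schwartz_differentiable sf x.
  move=> x i; rewrite (le_trans (hL i x))// (bigD1 i)//= lerDl; exact: sumr_ge0.
Qed.

(** The imaginary part is the real part for the function - i f, whose parts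
    are [im_tuple f] and [- re_tuple f]. *)
Theorem fourier_inversion f x : schwartz f ->
  complex.Re (f x) =
    trig (re_tuple (fourier f)) (fun t => - im_tuple (fourier f) t) (tor x) /\
  complex.Im (f x) =
    trig (im_tuple (fourier f)) (re_tuple (fourier f)) (tor x).
Proof.
move=> sf; have du := schwartz_dominated_re sf; have dv := schwartz_dominated_im sf.
have [dU dV] := dominated_fourier sf.
have EU : trig (re_tuple f) (im_tuple f) = re_tuple (fourier f).
  by apply/funext => t; rewrite /re_tuple fourierE row_of_tupleK.
have EV : trig (im_tuple f) (fun t => - re_tuple f t) = im_tuple (fourier f).
  by apply/funext => t; rewrite /im_tuple fourierE row_of_tupleK.
split.
  have [M M0 hM] := schwartz_lipschitz_re sf.
  transitivity (re_tuple f (tor x)); first by rewrite /re_tuple tuple_of_rowK.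
  rewrite (@trig_inversion R d (re_tuple f) (im_tuple f) (tor x) M) ?EU ?EV//.
  move=> y; rewrite /re_tuple tuple_of_rowK; apply: le_trans (hM _ _) _.
  by rewrite ler_wpM2l// ler_sum// => i _; rewrite tnth_mktuple mxE.
have [M M0 hM] := schwartz_lipschitz_im sf.
transitivity (im_tuple f (tor x)); first by rewrite /im_tuple tuple_of_rowK.
have EN : trig (fun t => - re_tuple f t) (fun t => - im_tuple f t) = fun t => - re_tuple (fourier f) t.
  by apply/funext => t; rewrite trigN// EU.
rewrite (@trig_inversion R d (im_tuple f) (fun t => - re_tuple f t) (tor x) M) ?EV ?EN//.
- by congr trig; apply/funext => t; rewrite opprK.
- exact: dominatedN.
- exact: dominatedN.
- move=> y; rewrite /im_tuple tuple_of_rowK; apply: le_trans (hM _ _) _.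
  by rewrite ler_wpM2l// ler_sum// => i _; rewrite tnth_mktuple mxE.
Qed.
End SchwartzFourier.

(** * Interpolation along a segment *)

Section Interpolation.
Variable R : realType.

Lemma poly_primitive (Q : {poly R}) (c : R) k : (size Q <= k)%N ->
  exists P : {poly R}, [/\ (size P <= k.+1)%N, P.[0] = c & P^`()%R = Q].
Proof.
move=> sQ; exists (\poly_(i < k.+1) (if i == 0 then c else Q`_i.-1 / i%:R)); split.
- exact: size_poly.
- by rewrite horner_coef0 coef_poly.
- apply/polyP => i; rewrite coef_deriv coef_poly ltnS /=.
  case: leqP => [ki|ik]; first by rewrite mul0rn nth_default// (leq_trans sQ).
  by rewrite -[LHS]mulr_natr divfK// pnatr_eq0.
Qed.

(** Induction: the derivative b cos - a sin is of the same form with the same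
    amplitude, and the mean value theorem integrates the estimate. *)
Lemma taylor_cos_sin k (a b : R) : exists P : {poly R}, (size P <= k)%N /\
  forall t, `|a * cos t + b * sin t - P.[t]| <= (`|a| + `|b|) * `|t| ^+ k.
Proof.
elim: k a b => [|k IH] a b.
  exists 0; rewrite size_poly0; split=> // t.
  by rewrite horner0 subr0 mulr1 norm_cos_sin_le.
have [Q [sQ hQ]] := IH b (- a).
have [P [sP P0 dP]] := poly_primitive a sQ.
exists P; split=> //.
pose h t := a * cos t + b * sin t - P.[t].
pose h' t := b * cos t + - a * sin t - Q.[t].
have dh (t : R) : is_derive t 1 h (h' t).
  have dPt : is_derive t 1 (horner P) Q.[t].
    by split; [exact: derivable_horner|rewrite -derive1E -derivE dP].
  rewrite /h /h'; apply: is_derive_eq.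
  by rewrite /GRing.scale/=; ring.
have h0 : h 0 = 0 by rewrite /h cos0 sin0 mulr0 addr0 mulr1 P0 subrr.
have ch : continuous h.
  by move=> s; apply: differentiable_continuous; apply/derivable1_diffP; have [] := dh s.
have M0 : 0 <= `|a| + `|b| by rewrite addr_ge0.
have bound (t c : R) : `|c| <= `|t| -> h t = h' c * t -> `|h t| <= (`|a| + `|b|) * `|t| ^+ k.+1.
  move=> ct ->; rewrite normrM exprSr mulrA ler_wpM2r//.
  rewrite (le_trans (hQ c))// normrN [`|b| + _]addrC ler_wpM2l//.
  by rewrite lerXn2r// nnegrE.
move=> t; rewrite -/(h t); have [t0|t0] := leP 0 t.
  have [|c] := @MVT_segment R h h' 0 t t0 (fun s _ => dh s).
    exact: continuous_subspaceT.
  rewrite in_itv/= h0 !subr0 => /andP[c0 ct] E; apply: bound E.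
  by rewrite !ger0_norm.
have [|c] := @MVT_segment R h h' t 0 (ltW t0) (fun s _ => dh s).
  exact: continuous_subspaceT.
rewrite in_itv/= h0 !sub0r mulrN => /andP[c0 ct] /oppr_inj E; apply: bound E.
by rewrite !ler0_norm ?lerN2// ltW.
Qed.

Lemma horner_bounded01 (P : {poly R}) : exists2 C, 0 <= C &
  forall s, 0 <= s <= 1 -> `|P.[s]| <= C.
Proof.
elim/poly_ind: P => [|P c [C C0 hC]]; first by exists 0 => // s _; rewrite horner0 normr0.
exists (C + `|c|); first by rewrite addr_ge0.
move=> s s01; have /andP[s0 s1] := s01.
rewrite hornerD hornerMX hornerC (le_trans (ler_normD _ _))// lerD2r normrM (ger0_norm s0).
by rewrite (le_trans _ (hC s s01))// ler_piMr.
Qed.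

Lemma horner_sub0_le (P : {poly R}) : exists2 C, 0 <= C &
  forall s, 0 <= s <= 1 -> `|P.[s] - P.[0]| <= C * s.
Proof.
elim/poly_ind: P => [|P c _]; first by exists 0 => // s _; rewrite !horner0 subr0 normr0 mul0r.
have [C C0 hC] := horner_bounded01 P; exists C => // s s01; have /andP[s0 s1] := s01.
rewrite !hornerD !hornerMX !hornerC mulr0 add0r addrK normrM (ger0_norm s0).
by rewrite ler_wpM2r// hC.
Qed.

(** The weights are the differences L_j(s) - L_j(0) of the Lagrange basis
    polynomials for the nodes 0, ..., k-1; they are O(s) because they vanish
    at s = 0. *)
Lemma interpolation_weights k : (0 < k)%N -> exists2 C : R, 0 <= C &
  forall s, 0 <= s <= 1 -> exists c : 'I_k -> R, (forall j, `|c j| <= C * s) /\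
  forall P : {poly R}, (size P <= k)%N ->
    P.[s] - P.[0] = \sum_(j < k) c j * P.[j%:R].
Proof.
move=> k0.
have ninj : injective (fun j : nat => j%:R : R) by move=> i j /eqP; rewrite eqr_nat => /eqP.
pose L (j : 'I_k) : {poly R} := tnth (lagrange k (fun j : nat => j%:R : R)) j.
have LP (P : {poly R}) : (size P <= k)%N -> P = \sum_(j < k) P.[j%:R]%:P * L j.
  by move=> sP; rewrite [LHS](@lagrange_gen _ k _ k0 ninj).
pose C j := projT1 (cid2 (horner_sub0_le (L j))).
have C0 j : 0 <= C j by rewrite /C; case: cid2.
have hC j s : 0 <= s <= 1 -> `|(L j).[s] - (L j).[0]| <= C j * s.
  by rewrite /C; case: cid2 => D _ /=; apply.
exists (\sum_j C j); first exact: sumr_ge0.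
move=> s s01; exists (fun j => (L j).[s] - (L j).[0]); split=> [j|P sP].
  have /andP[s0 _] := s01.
  by rewrite (le_trans (hC j s s01))// ler_wpM2r// (bigD1 j)//= lerDl sumr_ge0.
rewrite [in LHS](LP P sP) !horner_sum -sumrB; apply: eq_bigr => j _.
by rewrite !hornerM !hornerC -mulrBr mulrC.
Qed.

(** The identity of [interpolation_weights] is exact on the Taylor
    polynomial, so only the Taylor errors at s, at 0 and at the nodes remain.
    The weights do not depend on the wave: this is what permits integration
    over all frequencies. *)
Lemma interpolation_cos_sin k : (0 < k)%N -> exists2 C : R, 0 <= C &
  forall s, 0 <= s <= 1 -> exists c : 'I_k -> R, (forall j, `|c j| <= C * s) /\
  forall (a b eta : R) (g : R -> R),
    (forall t, g t = a * cos (t * eta) + b * sin (t * eta)) ->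
    `|g s - g 0 - \sum_(j < k) c j * g j%:R| <= C * (`|a| + `|b|) * `|eta| ^+ k.
Proof.
move=> k0; have [C C0 hC] := interpolation_weights k0.
pose D := C + 2 + k%:R * (C * k%:R ^+ k).
have E0 : 0 <= k%:R * (C * k%:R ^+ k) by rewrite mulr_ge0// mulr_ge0// exprn_ge0.
have D0 : 0 <= D by rewrite addr_ge0// addr_ge0.
have CD : C <= D by rewrite /D -addrA lerDl addr_ge0.
exists D => // s s01; have /andP[s0 s1] := s01.
have [c [cC cP]] := hC s s01; exists c; split.
  by move=> j; rewrite (le_trans (cC j))// ler_wpM2r.
move=> a b eta g gE.
have [P [sP hP]] := taylor_cos_sin k a b.
set M := `|a| + `|b| in hP *; have M0 : 0 <= M by rewrite addr_ge0.
pose Q := P \Po (eta *: 'X).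
have sQ : (size Q <= k)%N.
  rewrite /Q; have [->|e0] := eqVneq eta 0; first by rewrite scale0r comp_poly0r (leq_trans (size_polyC_leq1 _)).
  by rewrite size_comp_poly2// size_scale// size_polyX.
have Qt t : Q.[t] = P.[t * eta] by rewrite horner_comp hornerZ hornerX mulrC.
have err t : `|g t - Q.[t]| <= M * (`|t| ^+ k * `|eta| ^+ k).
  by rewrite Qt gE (le_trans (hP _))// normrM exprMn.
have -> : g s - g 0 - \sum_(j < k) c j * g j%:R =
  (g s - Q.[s]) - (g 0 - Q.[0]) - \sum_(j < k) c j * (g j%:R - Q.[j%:R]).
  have -> : \sum_(j < k) c j * (g j%:R - Q.[j%:R]) =
      \sum_(j < k) c j * g j%:R - \sum_(j < k) c j * Q.[j%:R].
    by rewrite -sumrB; apply: eq_bigr => j _; rewrite mulrBr.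
  by rewrite -(cP Q sQ); ring.
rewrite (le_trans (ler_normB _ _))//.
rewrite -mulrA; set E := M * `|eta| ^+ k; have ME0 : 0 <= E by rewrite mulr_ge0// exprn_ge0.
have err' t r : `|t| ^+ k <= r -> `|g t - Q.[t]| <= r * E.
  by move=> tr; rewrite (le_trans (err t))// mulrCA ler_wpM2r.
have e1 : `|g s - Q.[s]| <= 1 * E by apply: err'; rewrite ger0_norm// exprn_ile1.
have e2 : `|g 0 - Q.[0]| <= 1 * E by apply: err'; rewrite normr0 expr0n; case: (k).
have e3 : `|\sum_(j < k) c j * (g j%:R - Q.[j%:R])| <= k%:R * (C * k%:R ^+ k) * E.
  rewrite (le_trans (ler_norm_sum _ _ _))//.
  rewrite -[k in k%:R * _]card_ord -mulrA mulr_natl -sumr_const ler_sum// => j _.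
  rewrite normrM -mulrA ler_pM//.
    by rewrite (le_trans (cC j))// ler_piMr.
  apply: err'; rewrite ger0_norm// lerXn2r ?nnegrE// ler_nat ltnW//.
rewrite (le_trans (lerD (ler_normB _ _) (lexx _)))//.
rewrite (le_trans (lerD (lerD e1 e2) e3))// -!mulrDl ler_wpM2r// /D; lra.
Qed.

Variable d : nat.
Local Notation T := (measurableTypeR R).
Local Notation V := 'rV[R]_d.
Local Notation leb := (lebesgue_tuple R).
Local Notation row := (@row_of_tuple R d).
Local Notation tor := (@tuple_of_row R d).

Lemma dotpC (x y : V) : dotp x y = dotp y x.
Proof. by apply: eq_bigr => i _; rewrite mulrC. Qed.

Lemma dotpDl (x y z : V) : dotp (x + y) z = dotp x z + dotp y z.
Proof. by rewrite /dotp -big_split/=; apply: eq_bigr => i _; rewrite mxE mulrDl. Qed.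

Lemma dotpZl (a : R) (x z : V) : dotp (a *: x) z = a * dotp x z.
Proof. by rewrite /dotp mulr_sumr; apply: eq_bigr => i _; rewrite mxE mulrA. Qed.

Lemma dotp_ge0 (x : V) : 0 <= dotp x x.
Proof. by apply: sumr_ge0 => i _; rewrite -expr2 sqr_ge0. Qed.

Lemma enorm_ge0 (x : V) : 0 <= enorm x. Proof. exact: sqrtr_ge0. Qed.

Lemma enorm_sqr (x : V) : enorm x ^+ 2 = dotp x x.
Proof. by rewrite sqr_sqrtr// dotp_ge0. Qed.

Lemma dotp_eq0 (x : V) : dotp x x = 0 -> x = 0.
Proof.
move=> /eqP; rewrite psumr_eq0; last by move=> i _; rewrite -expr2 sqr_ge0.
move=> /allP x0; apply/rowP => i; rewrite mxE.
by have /(_ i) := x0; rewrite mem_index_enum => /(_ isT)/= /eqP/eqP; rewrite mulf_eq0 orbb => /eqP.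
Qed.

Lemma cauchy_schwarz (x y : V) : `|dotp x y| <= enorm x * enorm y.
Proof.
rewrite -(@ler_pXn2r _ 2)// ?nnegrE ?mulr_ge0 ?enorm_ge0//.
rewrite real_normK ?num_real// exprMn !enorm_sqr.
have [y0|yn0] := eqVneq (dotp y y) 0.
  have x0 : dotp x 0 = 0 by rewrite dotpC -(scale0r (0 : V)) dotpZl mul0r.
  by rewrite (dotp_eq0 y0) x0 expr0n mulr_ge0// dotp_ge0.
have y0 : 0 < dotp y y by rewrite lt_neqAle eq_sym yn0 dotp_ge0.
have := dotp_ge0 (dotp y y *: x + - dotp x y *: y).
rewrite dotpDl !dotpZl dotpC dotpDl !dotpZl [dotp y (_ + _)]dotpC dotpDl !dotpZl (dotpC y x).
move: (dotp x x) (dotp x y) (dotp y y) y0 => A D B B0 h.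
have : 0 <= B * (A * B - D ^+ 2).
  by rewrite (le_trans h)// le_eqVlt; apply/orP; left; apply/eqP; ring.
by rewrite pmulr_rge0// subr_ge0.
Qed.

Lemma enormD (x y : V) : enorm (x + y) <= enorm x + enorm y.
Proof.
rewrite -(@ler_pXn2r _ 2)// ?nnegrE ?addr_ge0 ?enorm_ge0//.
rewrite sqrrD !enorm_sqr dotpDl dotpC dotpDl [dotp y (_ + _)]dotpC dotpDl (dotpC y x).
have := cauchy_schwarz x y; have := ler_norm (dotp x y); lra.
Qed.

Lemma enormZ (a : R) (x : V) : enorm (a *: x) = `|a| * enorm x.
Proof.
rewrite /enorm dotpZl dotpC dotpZl mulrA -expr2 sqrtrM ?sqr_ge0// sqrtr_sqr//.
Qed.

Lemma enormN (x : V) : enorm (- x) = enorm x.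
Proof. by rewrite -scaleN1r enormZ normrN1 mul1r. Qed.

Lemma enorm_distC (x y : V) : enorm (x - y) = enorm (y - x).
Proof. by rewrite -enormN opprB. Qed.

Lemma enorm_le_jbracket (x : V) : enorm x <= jbracket x.
Proof.
rewrite -(@ler_pXn2r _ 2)// ?nnegrE ?enorm_ge0// ?(le_trans ler01 (jbracket_ge1 _))//.
by rewrite enorm_sqr jbracket_sqr /dotp; under eq_bigr do rewrite -expr2; rewrite lerDr.
Qed.

Lemma jbracket_le2 (x y : V) : enorm (x - y) <= 1 -> jbracket x <= 2 * jbracket y.
Proof.
move=> xy; have j0 z : 0 <= jbracket z := le_trans ler01 (@jbracket_ge1 R d z).
have jE z : jbracket z ^+ 2 = 1 + enorm z ^+ 2 by rewrite /jbracket sqr_sqrtr// addr_ge0// sqr_ge0.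
rewrite -(@ler_pXn2r _ 2)// ?nnegrE ?mulr_ge0// exprMn !jE.
have := enormD (x - y) y; rewrite subrK => h.
have h1 : enorm x <= 1 + enorm y by lra.
have h2 : enorm x ^+ 2 <= (1 + enorm y) ^+ 2 by rewrite ler_pXn2r ?nnegrE ?addr_ge0 ?enorm_ge0.
have := sqr_ge0 (1 - enorm y); nra.
Qed.

Lemma phase_line (x v : V) (s : R) (t : d.-tuple T) :
  phase (tor (x + s *: v)) t = phase (tor x) t + s * phase (tor v) t.
Proof.
rewrite /phase mulrCA -mulrDr; congr (_ * _); rewrite mulr_sumr -big_split/=.
by apply: eq_bigr => i _; rewrite !tnth_mktuple !mxE mulrDl mulrA.
Qed.

Lemma phase_le (v : V) (t : d.-tuple T) :
  `|phase (tor v) t| <= 2 * pi * enorm v * jbracket (row t).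
Proof.
have -> : phase (tor v) t = 2 * pi * dotp v (row t).
  by rewrite /phase; congr (_ * _); apply: eq_bigr => i _; rewrite tnth_mktuple mxE.
have pi20 : 0 <= 2 * pi :> R by rewrite mulr_ge0// pi_ge0.
rewrite normrM (ger0_norm pi20) -[leRHS]mulrA ler_wpM2l//.
by rewrite (le_trans (cauchy_schwarz _ _))// ler_wpM2l ?enorm_ge0 ?enorm_le_jbracket.
Qed.

(** Integrating [interpolation_cos_sin] over the frequencies. Along the line
    x + s v the wave of frequency [t] is a cosine in [s] of frequency at most
    2 pi |v| <t>, whence the k-th powers in the hypothesis on [N]. *)
Lemma trig_interpolation k : (0 < k)%N -> exists2 C : R, 0 <= C &
  forall s, 0 <= s <= 1 -> exists c : 'I_k -> R, (forall j, `|c j| <= C * s) /\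
  forall (a b : d.-tuple T -> R) (N : R), dominated a -> dominated b ->
    (forall t, jbracket (row t) ^+ k * (`|a t| + `|b t|) <= N * weight t) ->
    forall x v : V,
    `|trig a b (tor (x + s *: v)) - trig a b (tor x)
      - \sum_(j < k) c j * trig a b (tor (x + j%:R *: v))| <= C * N * enorm v ^+ k.
Proof.
move=> k0; have [C C0 hC] := interpolation_cos_sin k0.
pose W := Rintegral (leb d) setT (@weight R d).
have W0 : 0 <= W by apply: Rintegral_ge0 => t _; exact: ltW (weight_gt0 _).
have pi20 : 0 <= 2 * pi :> R by rewrite mulr_ge0// pi_ge0.
pose D := C * (2 * (2 * pi) ^+ k) * W.
have D0 : 0 <= D by rewrite !mulr_ge0// exprn_ge0.
exists (C + D); first by rewrite addr_ge0.
move=> s s01; have /andP[s0 s1] := s01; have [c [cC hc]] := hC s s01.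
exists c; split=> [j|a b N da db abN x v].
  by rewrite (le_trans (cC j))// ler_wpM2r// lerDl.
pose I (r : R) t := a t * cos (phase (tor (x + r *: v)) t) + b t * sin (phase (tor (x + r *: v)) t).
have dI r : dominated (I r) by exact: dominated_trig_integrand.
pose S t := \sum_(j < k) c j * I j%:R t.
have iS (X : seq 'I_k) : dominated (fun t => \sum_(j <- X) c j * I j%:R t) /\
    Rintegral (leb d) setT (fun t => \sum_(j <- X) c j * I j%:R t) =
    \sum_(j <- X) c j * trig a b (tor (x + j%:R *: v)).
  elim: X => [|j X [IH1 IH2]].
    have -> : (fun t => \sum_(j <- [::]) c j * I j%:R t) = cst 0.
      by apply/funext => t; rewrite big_nil.
    rewrite big_nil Rintegral_cst// mul0r; split=> //; split=> //.
    by exists 0 => t; rewrite normr0 mul0r.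
  have -> : (fun t => \sum_(i <- j :: X) c i * I i%:R t) = (fun t => c j * I j%:R t + \sum_(i <- X) c i * I i%:R t).
    by apply/funext => t; rewrite big_cons.
  split; first by apply: dominatedD => //; exact: dominatedZ.
  rewrite big_cons RintegralD//; last 2 first.
  - exact/dominated_integrable/dominatedZ.
  - exact: dominated_integrable.
  by rewrite RintegralZl// ?IH2//; exact: dominated_integrable.
have [dS ES] := iS (index_enum 'I_k).
have E0 : trig a b (tor x) = Rintegral (leb d) setT (I 0).
  by rewrite /I scale0r addr0.
have dsub : dominated (fun t => I s t - I 0 t) by apply: dominatedD => //; exact: dominatedN.
have dsub2 : dominated (fun t => I s t - I 0 t - S t) by apply: dominatedD => //; exact: dominatedN.
have -> : trig a b (tor (x + s *: v)) - trig a b (tor x)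
      - \sum_(j < k) c j * trig a b (tor (x + j%:R *: v)) =
    Rintegral (leb d) setT (fun t => I s t - I 0 t - S t).
  rewrite RintegralB//; last 2 first.
  - exact: dominated_integrable.
  - exact: dominated_integrable.
  by rewrite RintegralB ?ES ?E0//; exact: dominated_integrable.
rewrite (le_trans (le_normr_Rintegral _ (dominated_integrable dsub2)))//.
apply: (@le_trans _ _ (Rintegral (leb d) setT (fun t => C * (2 * (2 * pi) ^+ k) * N * enorm v ^+ k * weight t))).
  apply: le_Rintegral => //.
  - exact/dominated_integrable/dominated_norm.
  - by have := integrableZl measurableT (C * (2 * (2 * pi) ^+ k) * N * enorm v ^+ k) (integrable_weight R d); apply: eq_integrable.
  - move=> t _; set th := phase (tor x) t; set eta := phase (tor v) t.
    pose a' := a t * cos th + b t * sin th; pose b' := b t * cos th + - a t * sin th.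
    have IE r : I r t = a' * cos (r * eta) + b' * sin (r * eta).
      by rewrite /I phase_line -/th -/eta cosD sinD /a' /b'; ring.
    apply: (le_trans (hc a' b' eta (I ^~ t) IE)).
    have ab' : `|a'| + `|b'| <= 2 * (`|a t| + `|b t|).
      have := norm_cos_sin_le (a t) (b t) th; have := norm_cos_sin_le (b t) (- a t) th.
      by rewrite normrN -/a' -/b'; lra.
    have h2 : `|eta| ^+ k <= (2 * pi * enorm v * jbracket (row t)) ^+ k.
      by rewrite lerXn2r ?nnegrE ?phase_le// (le_trans _ (phase_le v t)).
    apply: (@le_trans _ _ (C * (2 * (`|a t| + `|b t|)) * (2 * pi * enorm v * jbracket (row t)) ^+ k)).
      by rewrite ler_pM ?mulr_ge0 ?addr_ge0 ?exprn_ge0// ler_wpM2l.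
    have -> : C * (2 * (`|a t| + `|b t|)) * (2 * pi * enorm v * jbracket (row t)) ^+ k =
      C * (2 * (2 * pi) ^+ k) * enorm v ^+ k * (jbracket (row t) ^+ k * (`|a t| + `|b t|)).
      by rewrite !exprMn; ring.
    have -> : C * (2 * (2 * pi) ^+ k) * N * enorm v ^+ k * weight t =
      C * (2 * (2 * pi) ^+ k) * enorm v ^+ k * (N * weight t) by ring.
    by rewrite ler_wpM2l// !mulr_ge0// exprn_ge0// enorm_ge0.
rewrite RintegralZl//; last exact: integrable_weight.
have N0 : 0 <= N.
  rewrite -(pmulr_lge0 _ (weight_gt0 (tor 0))) (le_trans _ (abN (tor 0)))//.
  by rewrite mulr_ge0 ?addr_ge0// exprn_ge0// (le_trans ler01 (jbracket_ge1 _)).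
have -> : C * (2 * (2 * pi) ^+ k) * N * enorm v ^+ k * Rintegral (leb d) setT (@weight R d) = D * N * enorm v ^+ k.
  by rewrite /D /W; ring.
by rewrite ler_wpM2r ?exprn_ge0 ?enorm_ge0// ler_wpM2r// lerDr.
Qed.
End Interpolation.

(** * Uniqueness on dense sets *)

Section Uniqueness.
Variables (R : realType) (d : nat).
Local Notation T := (measurableTypeR R).
Local Notation V := 'rV[R]_d.
Local Notation row := (@row_of_tuple R d).
Local Notation tor := (@tuple_of_row R d).
Implicit Types (x y xi : V) (A B : set V) (p q delta : R) (f : V -> R[i]).

(** If every bound [F] improves to F/2 + c, the supremum is at most 2 c; the
    first hypothesis makes it finite. *)
Lemma le_of_absorbed (X : Type) (S : X -> R) (c : R) :
  (exists F, forall z : X, S z <= F) ->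
  (forall F, (forall z : X, S z <= F) -> forall z : X, S z <= F / 2 + c) ->
  forall z : X, S z <= 2 * c.
Proof.
move=> [F hF] H x0; pose E := range S.
have ubE : has_ubound E by exists F => _ [z _ <-].
have Ss z : S z <= sup E by apply: ub_le_sup => //; exists z.
have : sup E <= sup E / 2 + c.
  by apply: ge_sup; [exists (S x0); exists x0|move=> _ [z _ <-]; exact: H].
by move=> h; rewrite (le_trans (Ss x0))//; lra.
Qed.

Lemma jbracket_gt0 x : 0 < jbracket x.
Proof. exact: lt_le_trans ltr01 (jbracket_ge1 _). Qed.

Lemma jbracket_powR_ge1 x p : 0 <= p -> 1 <= jbracket x `^ p.
Proof. by move=> p0; rewrite -[leLHS](powRr0 (jbracket x)) ler_powR ?jbracket_ge1. Qed.

Lemma jbracket_powR_le2 x y p : 0 <= p -> enorm (x - y) <= 1 ->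
  jbracket x `^ p <= 2 `^ p * jbracket y `^ p.
Proof.
move=> p0 xy; rewrite -powRM ?(ltW (jbracket_gt0 _))//.
by rewrite ge0_ler_powR// ?nnegrE ?mulr_ge0 ?(ltW (jbracket_gt0 _))// jbracket_le2.
Qed.

Lemma jbracket_powR_exprn x p (n k : nat) : n%:R <= p * k%:R ->
  jbracket x ^+ n <= (jbracket x `^ p) ^+ k.
Proof.
move=> npk; rewrite -powR_mulrn ?(ltW (jbracket_gt0 _))//.
by rewrite -powR_mulrn ?powR_ge0// -powRrM ler_powR ?jbracket_ge1.
Qed.

(** The estimate on which uniqueness rests. At [x], interpolate between [x]
    and a zero [y] of the function, with nodes [x + j v], [v = K (y - x)],
    parameter 1/K. Near [x] the weight <x>^(p k) varies by a bounded factor,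
    so the nodes contribute at most (k C 2^(p k) / K) F when [F] bounds the
    weighted function; K makes this factor at most 1/2. *)
Lemma vanish_decay p k : 0 <= p -> (0 < k)%N -> exists C1 delta1 : R,
  [/\ 0 <= C1, 0 < delta1 & delta1 <= 1] /\
  forall delta A, 0 < delta -> delta <= delta1 -> pdense p delta A ->
  forall (a b : d.-tuple T -> R) (N : R), dominated a -> dominated b ->
  (forall t, jbracket (row t) ^+ k * (`|a t| + `|b t|) <= N * weight t) ->
  (forall x, A x -> trig a b (tor x) = 0) ->
  (exists F, forall x, (jbracket x `^ p) ^+ k * `|trig a b (tor x)| <= F) ->
  forall x, (jbracket x `^ p) ^+ k * `|trig a b (tor x)| <= C1 * delta ^+ k * N.
Proof.
move=> p0 k0; have [C C0 hC] := @trig_interpolation R d k k0.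
pose c2 : R := 2 `^ p; have c20 : 0 < c2 by rewrite powR_gt0.
pose K : R := 2 * (k%:R * C * c2 ^+ k) + 1.
have c2k0 : 0 <= c2 ^+ k by rewrite exprn_ge0// ltW.
have K1 : 1 <= K by rewrite /K lerDr !mulr_ge0.
have K0 : 0 < K := lt_le_trans ltr01 K1.
have s01 : 0 <= K^-1 <= 1 by rewrite invr_ge0 (ltW K0)/= invf_le1.
have [c [cC hc]] := hC _ s01.
(* delta <= 1/D keeps all nodes within distance 1 of [x], where the weights
   are comparable. *)
pose D : R := k%:R * K * c2 + 1.
have D1 : 1 <= D by rewrite /D lerDr !mulr_ge0 ?(ltW K0) ?(ltW c20).
have D0 : 0 < D := lt_le_trans ltr01 D1.
exists (2 * (C * (K * c2) ^+ k)), D^-1; split.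
  split; first by rewrite !mulr_ge0// exprn_ge0// mulr_ge0// ltW.
    by rewrite invr_gt0.
  by rewrite invf_le1.
move=> delta A del0 delD pA a b N da db abN g0 bF.
pose g x := trig a b (tor x); pose w x := jbracket x `^ p.
have w1 x : 1 <= w x by exact: jbracket_powR_ge1.
have w0 x : 0 < w x := lt_le_trans ltr01 (w1 x).
have wE x : jbracket x `^ p = w x by [].
have w_le2 x y : enorm (x - y) <= 1 -> w x <= c2 * w y by exact: jbracket_powR_le2.
clearbody w.
have N0 : 0 <= N.
  rewrite -(pmulr_lge0 _ (weight_gt0 (tor 0))) (le_trans _ (abN (tor 0)))//.
  by rewrite mulr_ge0 ?addr_ge0// exprn_ge0// ltW// jbracket_gt0.
have -> : 2 * (C * (K * c2) ^+ k) * delta ^+ k * N = 2 * (C * (K * c2) ^+ k * delta ^+ k * N) by ring.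
apply: (@le_of_absorbed V (fun x => (jbracket x `^ p) ^+ k * `|g x|)) => // F hF x.
have {}hF z : w z ^+ k * `|g z| <= F by rewrite -wE.
rewrite wE; have F0 : 0 <= F by rewrite (le_trans _ (hF x))// mulr_ge0// exprn_ge0// ltW// w0.
have [y Ay] : (\bigcup_(x in A) eball x (delta * jbracket x `^ (- p))) x by rewrite pA.
rewrite /eball /= powRN wE => xy.
have del1 : delta <= 1 by rewrite (le_trans delD)// invf_le1.
have xy1 : enorm (x - y) <= 1.
  rewrite (le_trans (ltW xy))// -[leRHS]mulr1 ler_pM// ?invr_ge0 ?(ltW del0) ?(ltW (w0 _))//.
  by rewrite invf_le1.
have wxy : w x <= c2 * w y by exact: w_le2.
have r_le : enorm (y - x) <= c2 * delta / w x.
  rewrite enorm_distC (le_trans (ltW xy))// ler_pdivlMr// mulrAC ler_pdivrMr//.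
  by rewrite [c2 * delta]mulrC -mulrA ler_wpM2l ?(ltW del0).
set v := K *: (y - x).
have v_le : enorm v <= K * c2 * delta / w x.
  by rewrite enormZ (gtr0_norm K0) -!mulrA ler_wpM2l ?(ltW K0)// mulrA.
have node (j : 'I_k) : (w x) ^+ k * `|g (x + j%:R *: v)| <= c2 ^+ k * F.
  have xj : enorm (x - (x + j%:R *: v)) <= 1.
    rewrite opprD addrA subrr sub0r enormN enormZ normr_nat.
    have jk : (j%:R : R) <= k%:R by rewrite ler_nat ltnW.
    have v1 : enorm v <= K * c2 * delta.
      rewrite (le_trans v_le)// ler_pdivrMr// ler_peMr// !mulr_ge0// ltW//.
    rewrite (le_trans (ler_pM _ (enorm_ge0 _) jk v1))//.
    rewrite !mulrA (le_trans (_ : _ <= D * delta))// ?ler_wpM2r ?(ltW del0) ?lerDl//.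
    by rewrite mulrC -ler_pdivlMr// mul1r.
  have wj : w x <= c2 * w (x + j%:R *: v) by exact: w_le2.
  apply: (@le_trans _ _ ((c2 * w (x + j%:R *: v)) ^+ k * `|g (x + j%:R *: v)|)).
    by rewrite ler_wpM2r// lerXn2r// nnegrE ?mulr_ge0// ltW.
  by rewrite exprMn -mulrA ler_wpM2l// hF.
have := hc a b N da db abN x v.
have -> : x + K^-1 *: v = y by rewrite /v scalerA mulVf ?gt_eqF// scale1r addrC subrK.
rewrite (g0 _ Ay) sub0r -opprD normrN => h.
have h1 : `|g x| <= \sum_(j < k) `|c j| * `|g (x + j%:R *: v)| + C * N * enorm v ^+ k.
  have -> : g x = (g x + \sum_(j < k) c j * g (x + j%:R *: v)) - \sum_(j < k) c j * g (x + j%:R *: v).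
    by rewrite addrK.
  rewrite (le_trans (ler_normB _ _))// addrC lerD//.
  rewrite (le_trans (ler_norm_sum _ _ _))// ler_sum// => j _.
  by rewrite normrM.
have wk0 : 0 <= w x ^+ k by rewrite exprn_ge0// ltW.
apply: (le_trans (ler_wpM2l wk0 h1)); rewrite mulrDr; apply: lerD.
  apply: (@le_trans _ _ (\sum_(j < k) C * K^-1 * (c2 ^+ k * F))).
    rewrite mulr_sumr ler_sum// => j _; rewrite mulrCA ler_pM//.
    by rewrite mulr_ge0.
  rewrite sumr_const card_ord -[leLHS]mulr_natl.
  have -> : k%:R * (C * K^-1 * (c2 ^+ k * F)) = (k%:R * C * c2 ^+ k / K) * F by ring.
  rewrite [F / 2]mulrC ler_wpM2r// ler_pdivrMr// /K; lra.
have vk : enorm v ^+ k <= (K * c2 * delta / w x) ^+ k.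
  by rewrite lerXn2r// nnegrE ?enorm_ge0// (le_trans (enorm_ge0 _) v_le).
have CN0 : 0 <= C * N by rewrite mulr_ge0.
apply: (le_trans (ler_wpM2l wk0 (ler_wpM2l CN0 vk))).
rewrite le_eqVlt; apply/orP; left; apply/eqP.
rewrite exprMn exprVn exprMn; have : w x ^+ k != 0 by rewrite expf_neq0// gt_eqF.
by move: (w x ^+ k) ((K * c2) ^+ k) => W Z W0; field.
Qed.

(** p > 1/q, so the two lines q m = k + 2 d and p k = m + 2 d bound an
    infinite wedge. *)
Lemma exponents_exist p q : 0 < p -> 0 < q -> 1 < p * q -> exists k m : nat,
  [/\ (0 < k)%N, (0 < m)%N, (k + 2 * d)%:R <= q * m%:R & (m + 2 * d)%:R <= p * k%:R].
Proof.
move=> p0 q0 pq1.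
pose e : R := (2 * d)%:R.
have pq0 : 0 < p - q^-1 by rewrite subr_gt0 -[_^-1]mul1r ltr_pdivrMr.
have e0 : 0 <= e by rewrite /e.
(* With [m] the rounding up of (k + e) / q, the inequality m + e <= p k
   follows from k (p - 1/q) >= e/q + 1 + e. *)
pose k := (Num.truncn ((e / q + 2 + e) / (p - q^-1))).+1.
have hk : (e / q + 2 + e) / (p - q^-1) < k%:R by exact: truncnS_gt.
pose m := (Num.truncn ((k%:R + e) / q)).+1.
have hm : (k%:R + e) / q < m%:R by exact: truncnS_gt.
have ke0 : 0 <= (k%:R + e) / q by rewrite divr_ge0 ?addr_ge0// ltW.
have hm2 : m%:R <= (k%:R + e) / q + 1.
  by rewrite -natr1 lerD2r; have /andP[] := truncn_itv ke0.
exists k, m; split=> //.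
  by rewrite natrD -/e mulrC -ler_pdivrMr// ltW.
rewrite natrD -/e (le_trans (lerD hm2 (lexx e)))//.
move: hk; rewrite ltr_pdivrMr// mulrBr mulrDl => hk; lra.
Qed.

(** The 2 d spare powers of the bracket are converted into the integrable
    weight that [vanish_decay] requires. *)
Lemma bracket_weight_le x p (k m : nat) (a b F : R) : (m + 2 * d)%:R <= p * k%:R ->
  (jbracket x `^ p) ^+ k * (`|a| + `|b|) <= F ->
  jbracket x ^+ m * (`|a| + `|b|) <= F * weight (tor x).
Proof.
move=> mpk hF; have j0 := ltW (jbracket_gt0 x).
have s0 : 0 <= `|a| + `|b| by rewrite addr_ge0.
have w0 := ltW (weight_gt0 (tor x)).
apply: (@le_trans _ _ (jbracket x ^+ m * (`|a| + `|b|) * (jbracket x ^+ (2 * d) * weight (tor x)))).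
  by rewrite ler_peMr ?weight_jbracket// mulr_ge0// exprn_ge0.
have -> : jbracket x ^+ m * (`|a| + `|b|) * (jbracket x ^+ (2 * d) * weight (tor x)) =
  jbracket x ^+ (m + 2 * d) * (`|a| + `|b|) * weight (tor x) by rewrite exprD; ring.
by rewrite ler_wpM2r// (le_trans _ hF)// ler_wpM2r// jbracket_powR_exprn.
Qed.

Lemma powR_jbracket_le_nat p (k : nat) : exists n : nat,
  forall x, (jbracket x `^ p) ^+ k <= jbracket x ^+ (2 * n).
Proof.
pose n := (Num.truncn (p * k%:R)).+1; exists n => x.
rewrite -powR_mulrn ?powR_ge0// -powRrM -powR_mulrn ?(ltW (jbracket_gt0 _))//.
rewrite ler_powR ?jbracket_ge1// (@le_trans _ _ n%:R)//.
  exact/ltW/truncnS_gt.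
by rewrite ler_nat leq_pmull.
Qed.

(** [vanish_decay] is used for [f] on [A] and for its transform on [B], each
    time for the real and the imaginary part. The composition improves a
    bound [F] of [S] to 4 C1 C2 delta^(k+m) F, which is at most F / 2 for
    small [delta]. *)
Theorem schwartz_uniqueness p q : 0 < p -> 0 < q -> 1 < p * q ->
  exists2 delta0 : R, 0 < delta0 & forall delta A B, 0 < delta -> delta <= delta0 ->
  pdense p delta A -> pdense q delta B ->
  forall f, schwartz f -> (forall x, A x -> f x = 0) -> (forall xi, B xi -> fourier f xi = 0) ->
  forall x, f x = 0.
Proof.
move=> p0 q0 pq1; have [k [m [k0 m0 kqm mpk]]] := exponents_exist p0 q0 pq1.
have [C1 [d1 [[C10 d10 d11] h1]]] := vanish_decay (ltW p0) k0.
have [C2 [d2 [[C20 d20 d21] h2]]] := vanish_decay (ltW q0) m0.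
have CC0 : 0 <= C1 * C2 by rewrite mulr_ge0.
pose d0 := Num.min (Num.min d1 d2) (8 * (C1 * C2) + 1)^-1.
have Cp : 0 < 8 * (C1 * C2) + 1 by rewrite ltr_wpDl// mulr_ge0.
exists d0; first by rewrite !lt_min d10 d20 invr_gt0.
move=> delta A B del0; rewrite !le_min => /andP[/andP[del1 del2] del3] pA pB f sf fA fB.
have du := schwartz_dominated_re sf; have dv := schwartz_dominated_im sf.
have [dU dV] := dominated_fourier sf.
pose S x := (jbracket x `^ p) ^+ k * (`|complex.Re (f x)| + `|complex.Im (f x)|).
pose G xi := (jbracket xi `^ q) ^+ m * (`|complex.Re (fourier f xi)| + `|complex.Im (fourier f xi)|).
have [n1 hn1] := powR_jbracket_le_nat p k.
have [n2 hn2] := powR_jbracket_le_nat q m.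
have [M1 M10 hM1] := schwartz_bound (2 * n1) sf.
have [M2 hM2] := fourier_decay n2 sf.
have jp0 y (r : R) (n : nat) : 0 <= (jbracket y `^ r) ^+ n by rewrite exprn_ge0// powR_ge0.
have bRe x : (jbracket x `^ p) ^+ k * `|complex.Re (f x)| <= M1.
  by rewrite (le_trans _ (hM1 x))// ler_pM// normc_ge_Re.
have bIm x : (jbracket x `^ p) ^+ k * `|complex.Im (f x)| <= M1.
  by rewrite (le_trans _ (hM1 x))// ler_pM// normc_ge_Im.
have bFRe x : (jbracket x `^ q) ^+ m * `|complex.Re (fourier f x)| <= M2.
  by rewrite (le_trans _ (hM2 x))// ler_pM// lerDl.
have bFIm x : (jbracket x `^ q) ^+ m * `|complex.Im (fourier f x)| <= M2.
  by rewrite (le_trans _ (hM2 x))// ler_pM// lerDr.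
have EU xi : trig (re_tuple f) (im_tuple f) (tor xi) = complex.Re (fourier f xi) by rewrite fourierE.
have EV xi : trig (im_tuple f) (fun t => - re_tuple f t) (tor xi) = complex.Im (fourier f xi).
  by rewrite fourierE.
have Eu x := (fourier_inversion x sf).1; have Ev x := (fourier_inversion x sf).2.
have SG F : (forall x, S x <= F) -> forall xi, G xi <= 2 * (C2 * delta ^+ m * F).
  move=> hF xi.
  have wF t : jbracket (row t) ^+ m * (`|re_tuple f t| + `|im_tuple f t|) <= F * weight t.
    by rewrite -[in weight t](row_of_tupleK t); exact: bracket_weight_le mpk (hF _).
  rewrite /G mulrDr mulr2n mulrDl mul1r lerD//.
    rewrite -EU; apply: (h2 delta B) => //.
      by move=> y By; rewrite EU fB.
    by exists M2 => y; rewrite EU.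
  rewrite -EV; apply: (h2 delta B) => //.
  - exact: dominatedN.
  - by move=> t; rewrite normrN addrC.
  - by move=> y By; rewrite EV fB.
  - by exists M2 => y; rewrite EV.
have GS F : (forall xi, G xi <= F) -> forall x, S x <= 2 * (C1 * delta ^+ k * F).
  move=> hF x.
  have wF t : jbracket (row t) ^+ k * (`|re_tuple (fourier f) t| + `|im_tuple (fourier f) t|) <= F * weight t.
    by rewrite -[in weight t](row_of_tupleK t); exact: bracket_weight_le kqm (hF _).
  rewrite /S mulrDr mulr2n mulrDl mul1r lerD//.
    rewrite Eu; apply: (h1 delta A) => //.
    - exact: dominatedN.
    - by move=> t; rewrite normrN.
    - by move=> y Ay; rewrite -Eu fA.
    - by exists M1 => y; rewrite -Eu.
  rewrite Ev; apply: (h1 delta A) => //.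
  - by move=> t; rewrite addrC.
  - by move=> y Ay; rewrite -Ev fA.
  - by exists M1 => y; rewrite -Ev.
have S0 x : S x <= 2 * 0.
  apply: le_of_absorbed => [|F hF y].
    by exists (M1 + M1) => y; rewrite /S mulrDr lerD.
  have F0 : 0 <= F by rewrite (le_trans _ (hF 0))// mulr_ge0// addr_ge0.
  apply: (le_trans (GS _ (SG F hF) y)); rewrite addr0.
  have -> : 2 * (C1 * delta ^+ k * (2 * (C2 * delta ^+ m * F))) =
    (4 * (C1 * C2) * (delta ^+ k * delta ^+ m)) * F by ring.
  rewrite [F / 2]mulrC ler_wpM2r//.
  have dkm : delta ^+ k * delta ^+ m <= delta.
    have de1 : delta <= 1 := le_trans del1 d11.
    rewrite -exprD; case: (k) k0 => // k' _; rewrite addSn exprS ler_piMr ?(ltW del0)//.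
    by rewrite exprn_ile1// ltW.
  apply: (@le_trans _ _ (4 * (C1 * C2) * delta)); first by rewrite ler_wpM2l// mulr_ge0.
  apply: (@le_trans _ _ (4 * (C1 * C2) * (8 * (C1 * C2) + 1)^-1)).
    by rewrite ler_wpM2l// mulr_ge0.
  rewrite ler_pdivrMr//; lra.
move=> x; have := S0 x; rewrite mulr0 /S pmulr_rle0; last by rewrite exprn_gt0// powR_gt0// jbracket_gt0.
case: (f x) => a b /= ab.
have a0 : `|a| <= 0 by have := normr_ge0 a; have := normr_ge0 b; lra.
have b0 : `|b| <= 0 by have := normr_ge0 a; have := normr_ge0 b; lra.
by move: a0 b0; rewrite !normr_le0 => /eqP -> /eqP ->.
Qed.
End Uniqueness.

(** * Dimension bounds and linearity of the transform *)

Section LinearAlgebra.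
Variables (K : fieldType) (V : lmodType K).
Implicit Types (W : set V).

(** More rows than columns: the left kernel is nonzero. *)
Lemma dependent_rows n m (M : 'M[K]_(n, m)) : (m < n)%N ->
  exists2 c : 'I_n -> K, (exists i, c i != 0) & forall j, \sum_i c i * M i j = 0.
Proof.
move=> mn; have : kermx M != 0.
  by rewrite -mxrank_eq0 mxrank_ker subn_eq0 -ltnNge (leq_ltn_trans (rank_leq_col _)).
move=> /rowV0Pn[u uM u0]; exists (fun i => u ord0 i).
  have [i ui] : exists i, u ord0 i != 0.
    by apply/existsP; apply: contraNT u0 => /existsPn h; apply/eqP/rowP => i; rewrite mxE; apply/eqP; have := h i; rewrite negbK.
  by exists i.
move=> j; have /sub_kermxP/matrixP/(_ ord0 j) := uM.
by rewrite !mxE.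
Qed.

(** A free family in [W] has at most [N] members, since the matrix of the
    values of the functionals has independent rows. A free family of maximal
    length then spans. *)
Lemma dim_le_of_functionals W N (L : 'I_N -> V -> K) :
  W 0 -> (forall (c : K) u v, W u -> W v -> W (c *: u + v)) ->
  (forall j (c : K) u v, W u -> W v -> L j (c *: u + v) = c * L j u + L j v) ->
  (forall v, W v -> (forall j, L j v = 0) -> v = 0) ->
  dim_le W N.
Proof.
move=> W0 WL LL Linj.
have Wsum n (b : 'I_n -> V) (c : 'I_n -> K) : (forall i, W (b i)) ->
    W (\sum_i c i *: b i) /\ forall j, L j (\sum_i c i *: b i) = \sum_i c i * L j (b i).
  move=> Wb; elim: (index_enum _) => [|i s [IH1 IH2]].
    split=> [|j]; first by rewrite big_nil.
    by rewrite !big_nil; have := LL j (-1) 0 0 W0 W0; rewrite scaler0 addr0 mulN1r addNr.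
  split=> [|j]; first by rewrite big_cons; exact: WL.
  by rewrite !big_cons LL// IH2.
pose P n := exists b : 'I_n -> V, (forall i, W (b i)) /\
  forall c : 'I_n -> K, \sum_i c i *: b i = 0 -> forall i, c i = 0.
have PN n : P n -> (n <= N)%N.
  move=> [b [Wb fb]]; rewrite leqNgt; apply/negP => Nn.
  have [c [i ci] hc] := dependent_rows (\matrix_(i, j) L j (b i)) Nn.
  suff : \sum_i c i *: b i = 0 by move=> /fb/(_ i)/eqP; rewrite (negbTE ci).
  apply: Linj; first by have [] := Wsum _ b c Wb.
  move=> j; have [_ ->] := Wsum _ b c Wb; rewrite -[RHS](hc j).
  by apply: eq_bigr => k _; rewrite mxE.
have P0 : exists n, `[< P n >].
  exists 0%N; apply/asboolP; exists (fun i : 'I_0 => 0); split=> [[]//|c _ []//].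
have PN' n : `[< P n >] -> (n <= N)%N by move=> /asboolP; exact: PN.
case: (ex_maxnP P0 PN') => n /asboolP[b [Wb fb]] nmax.
exists n, b; split=> //; first by apply: PN; exists b.
move=> v Wv.
pose b' (i : 'I_n.+1) := if unlift ord0 i is Some j then b j else v.
have b'0 : b' ord0 = v by rewrite /b' unlift_none.
have b'S j : b' (lift ord0 j) = b j by rewrite /b' liftK.
have Wb' i : W (b' i) by rewrite /b'; case: unlift.
have nP : ~ P n.+1 by move=> /asboolP/nmax; rewrite ltnn.
have [c [hc [i ci]]] : exists c : 'I_n.+1 -> K, \sum_i c i *: b' i = 0 /\ exists i, c i != 0.
  apply: contrapT => H; apply: nP; exists b'; split=> // c hc i; apply/eqP.
  by apply: contrapT => /negP ci; apply: H; exists c; split=> //; exists i.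
move: hc; rewrite big_ord_recl b'0; under eq_bigr do rewrite b'S.
move=> hc; have c0 : c ord0 != 0.
  apply: contraNneq ci => c0; move: hc; rewrite c0 scale0r add0r => /fb h.
  by case: (unliftP ord0 i) => [j|] ->; rewrite ?c0 ?h.
exists (fun j => - (c ord0)^-1 * c (lift ord0 j)).
rewrite -[LHS](scalerK c0); move/eqP: hc; rewrite addr_eq0 => /eqP ->.
by rewrite scalerN -scaleNr scaler_sumr; apply: eq_bigr => j _; rewrite scalerA.
Qed.
End LinearAlgebra.

Section SchwartzLinear.
Variables (R : realType) (d : nat).
Local Notation V := 'rV[R]_d.
Local Notation row := (@row_of_tuple R d).
Local Notation tor := (@tuple_of_row R d).
Implicit Types (x y xi : V) (f g : V -> R[i]) (c : R[i]).

Lemma Re_lin c (z w : R[i]) :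
  complex.Re (c * z + w) = complex.Re c * complex.Re z - complex.Im c * complex.Im z + complex.Re w.
Proof. by case: c z w => [? ?] [? ?] [? ?]. Qed.

Lemma Im_lin c (z w : R[i]) :
  complex.Im (c * z + w) = complex.Re c * complex.Im z + complex.Im c * complex.Re z + complex.Im w.
Proof. by case: c z w => [? ?] [? ?] [? ?] /=; ring. Qed.

Lemma Re_linE c f g : (fun y => complex.Re ((c *: f + g) y)) =
  (complex.Re c *: (fun y => complex.Re (f y)) - complex.Im c *: (fun y => complex.Im (f y))) +
  (fun y => complex.Re (g y)).
Proof. by apply/funext => y; rewrite -[RHS]/(_ - _ + _) -Re_lin. Qed.

Lemma Im_linE c f g : (fun y => complex.Im ((c *: f + g) y)) =
  (complex.Re c *: (fun y => complex.Im (f y)) + complex.Im c *: (fun y => complex.Re (f y))) +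
  (fun y => complex.Im (g y)).
Proof. by apply/funext => y; rewrite -[RHS]/(_ + _ + _) -Im_lin. Qed.

Lemma cdifferentiable_lin c f g : cdifferentiable f -> cdifferentiable g ->
  cdifferentiable (c *: f + g).
Proof.
move=> df dg x; have [df1 df2] := df x; have [dg1 dg2] := dg x.
rewrite Re_linE Im_linE; split.
  exact: (differentiableD (differentiableB (differentiableZ _ df1) (differentiableZ _ df2)) dg1).
exact: (differentiableD (differentiableD (differentiableZ _ df2) (differentiableZ _ df1)) dg2).
Qed.

Lemma cpartial_lin i c f g : cdifferentiable f -> cdifferentiable g ->
  cpartial i (c *: f + g) = c *: cpartial i f + cpartial i g.
Proof.
move=> df dg; apply/funext => x; have [df1 df2] := df x; have [dg1 dg2] := dg x.
have D (h : V -> R) : differentiable h x -> derivable h x (delta_mx ord0 i).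
  by move=> dh; exact: diff_derivable.
have D1 := D _ df1; have D2 := D _ df2; have D3 := D _ dg1; have D4 := D _ dg2.
rewrite /cpartial Re_linE Im_linE.
have a1 := @derivableZ _ _ _ _ (complex.Re c) _ _ D1; have a2 := @derivableZ _ _ _ _ (complex.Im c) _ _ D2.
have a3 := @derivableZ _ _ _ _ (complex.Re c) _ _ D2; have a4 := @derivableZ _ _ _ _ (complex.Im c) _ _ D1.
rewrite (deriveD (derivableB a1 a2) D3) (deriveD (derivableD a3 a4) D4).
rewrite (deriveB a1 a2) (deriveD a3 a4) !deriveZ//.
apply/eqP; rewrite eq_complex; apply/andP; split; apply/eqP.
  by rewrite [RHS]Re_lin.
by rewrite [RHS]Im_lin.
Qed.

Lemma cpartials_lin s c f g : schwartz f -> schwartz g ->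
  cpartials s (c *: f + g) = c *: cpartials s f + cpartials s g.
Proof.
move=> sf sg; elim: s => [//|i s IH] /=; rewrite IH cpartial_lin//.
  by have [] := sf s.
by have [] := sg s.
Qed.

Lemma normcM_le c (z w : R[i]) : Normc.normc (c * z + w) <= Normc.normc c * Normc.normc z + Normc.normc w.
Proof. by rewrite (le_trans (le_normcD _ _))// Normc.normcM. Qed.

Lemma schwartz_lin c f g : schwartz f -> schwartz g -> schwartz (c *: f + g).
Proof.
move=> sf sg s; have [df bf] := sf s; have [dg bg] := sg s.
rewrite cpartials_lin//; split; first exact: cdifferentiable_lin.
move=> k; have [M hM] := bf k; have [M' hM'] := bg k.
have c0 : 0 <= Normc.normc c := le_trans (normr_ge0 _) (normc_ge_Re c).
exists (Normc.normc c * M + M') => x.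
apply: (@le_trans _ _ (jbracket x ^+ k * (Normc.normc c * Normc.normc (cpartials s f x) + Normc.normc (cpartials s g x)))).
  by rewrite ler_wpM2l ?exprn_ge0 ?(ltW (jbracket_gt0 _))//; exact: normcM_le.
by rewrite mulrDr mulrCA lerD// ler_wpM2l.
Qed.

Lemma schwartz0 : schwartz (0 : V -> R[i]).
Proof.
have E (s : seq 'I_d) : cpartials s (0 : V -> R[i]) = 0.
  elim: s => [//|i s IH] /=; rewrite IH; apply/funext => x; rewrite /cpartial.
  by rewrite !derive_cst.
move=> s; rewrite E; split; first by move=> x; split; exact: differentiable_cst.
by move=> k; exists 0 => x; rewrite /= expr0n/= addr0 sqrtr0 mulr0.
Qed.

Lemma trig_lin n (u v u' v' : n.-tuple (measurableTypeR R) -> R) (a b : R) (x : n.-tuple (measurableTypeR R)) :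
  dominated u -> dominated v -> dominated u' -> dominated v' ->
  trig (fun t => a * u t - b * v t + u' t) (fun t => a * v t + b * u t + v' t) x =
  a * trig u v x - b * trig v (fun t => - u t) x + trig u' v' x.
Proof.
move=> du dv du' dv'; rewrite /trig.
have d1 := dominated_trig_integrand x du dv.
have d2 := dominated_trig_integrand x dv (dominatedN du).
have d3 := dominated_trig_integrand x du' dv'.
rewrite -!RintegralZl//; try exact: dominated_integrable.
have i1 := dominated_integrable (dominatedZ a d1).
have i2 := dominated_integrable (dominatedZ b d2).
rewrite -RintegralB// -RintegralD//; last 2 first.
- exact: (dominated_integrable (dominatedD (dominatedZ a d1) (dominatedN (dominatedZ b d2)))).
- exact: dominated_integrable.
by apply: eq_Rintegral => t _; ring.
Qed.

Lemma fourier_lin c f g xi : schwartz f -> schwartz g ->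
  fourier (c *: f + g) xi = c * fourier f xi + fourier g xi.
Proof.
move=> sf sg; have du := schwartz_dominated_re sf; have dv := schwartz_dominated_im sf.
have du' := schwartz_dominated_re sg; have dv' := schwartz_dominated_im sg.
rewrite !fourierE.
have -> : re_tuple (c *: f + g) = fun t => complex.Re c * re_tuple f t - complex.Im c * im_tuple f t + re_tuple g t.
  by apply/funext => t; exact: Re_lin.
have -> : im_tuple (c *: f + g) = fun t => complex.Re c * im_tuple f t + complex.Im c * re_tuple f t + im_tuple g t.
  by apply/funext => t; exact: Im_lin.
rewrite trig_lin//.
have -> : trig (fun t => complex.Re c * im_tuple f t + complex.Im c * re_tuple f t + im_tuple g t)
    (fun t => - (complex.Re c * re_tuple f t - complex.Im c * im_tuple f t + re_tuple g t)) (tor xi) =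
  complex.Re c * trig (im_tuple f) (fun t => - re_tuple f t) (tor xi) + complex.Im c * trig (re_tuple f) (im_tuple f) (tor xi)
   + trig (im_tuple g) (fun t => - re_tuple g t) (tor xi).
  transitivity (trig (fun t => complex.Re c * im_tuple f t - complex.Im c * (- re_tuple f t) + im_tuple g t)
    (fun t => complex.Re c * (- re_tuple f t) + complex.Im c * im_tuple f t + - re_tuple g t) (tor xi)).
    by congr trig; apply/funext => t; ring.
  rewrite trig_lin//; try exact: dominatedN.
  by rewrite trigN//; ring.
by case: c => a b.
Qed.

Lemma schwartz_sum_lin n (c : 'I_n -> R[i]) (f : 'I_n -> V -> R[i]) : (forall i, schwartz (f i)) ->
  schwartz (\sum_i c i *: f i) /\
  forall xi, fourier (\sum_i c i *: f i) xi = \sum_i c i * fourier (f i) xi.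
Proof.
move=> sf; elim: (index_enum _) => [|i s [IH1 IH2]].
  split=> [|xi]; rewrite !big_nil; first exact: schwartz0.
  have := fourier_lin (-1) xi schwartz0 schwartz0.
  by rewrite scaler0 addr0 mulN1r addNr.
split=> [|xi]; rewrite !big_cons; first exact: schwartz_lin.
by rewrite fourier_lin// IH2.
Qed.
End SchwartzLinear.

(** * Finite nets and removal of points *)

Section Nets.
Variables (R : realType) (d : nat).
Local Notation V := 'rV[R]_d.
Implicit Types (x y z xi : V) (A B : set V) (p q delta : R) (f : V -> R[i]).

Lemma norm_le_enorm x : `|x| <= enorm x.
Proof.
rewrite /Num.norm/= mx_normrE; apply: bigmax_le; first exact: enorm_ge0.
move=> [i j] _ /=; rewrite (ord1 i) -sqrtr_sqr /enorm ler_wsqrtr// /dotp (bigD1 j)//= -expr2.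
by rewrite lerDl; apply: sumr_ge0 => k _; rewrite -expr2 sqr_ge0.
Qed.

Lemma continuous_enorm_sub z : continuous (fun y => enorm (y - z)).
Proof.
move=> y; rewrite /enorm; apply: (@continuous_comp _ _ _ (fun y => dotp (y - z) (y - z)) (@Num.sqrt R)).
  have c i : continuous (fun y : V => (y - z) ord0 i).
    rewrite (_ : (fun y : V => _) = (fun y : V => y ord0 i - z ord0 i)); last first.
      by apply/funext => x; rewrite !mxE.
    move=> x; have h := @coord_continuous R 1 d ord0 i x.
    exact: (cvgB h (cvg_cst _)).
  have cs (s : seq 'I_d) : continuous (fun y : V => \sum_(i <- s) (y - z) ord0 i * (y - z) ord0 i).
    elim: s => [|i s IH]; first by under eq_fun do rewrite big_nil; exact: cst_continuous.
    under eq_fun do rewrite big_cons.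
    by move=> x; exact: (cvgD (cvgM (c i x) (c i x)) (IH x)).
  exact: cs.
exact: sqrt_continuous.
Qed.

Lemma open_eball z (r : R) : open (eball z r).
Proof.
have /continuousP/(_ _ (@open_lt _ r)) := @continuous_enorm_sub z.
by [].
Qed.

Lemma eball_finite_cover (R1 : R) (r : V -> R) : (forall z, 0 < r z) ->
  exists s : seq V, forall y, enorm y <= R1 -> exists2 z, z \in s & eball z (r z) y.
Proof.
move=> r0; pose K := [set y : V | `|y| <= R1].
have cK : compact K.
  apply: bounded_closed_compact.
    by exists R1; split; [exact: num_real|move=> M RM y /= yK; rewrite (le_trans yK)// ltW].
  rewrite /K; apply: (@closed_comp _ _ (fun y : V => `|y|) [set r : R | r <= R1]).
    by move=> y _; exact: norm_continuous.
  exact: closed_le.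
move: cK; rewrite compact_cover => /(_ V setT (fun z => eball z (r z))).
case=> [z _|y _|D _ KD].
- exact: open_eball.
- by exists y => //; rewrite /eball/= subrr -(scale0r (0 : V)) enormZ normr0 mul0r.
exists (finmap.enum_fset D) => y yR.
by have [|z zD zy] := KD y; [exact: le_trans (norm_le_enorm y) yR|exists z].
Qed.

Lemma jbracket_le_enorm x y (r : R) : enorm (x - y) <= r -> enorm x <= jbracket y + r.
Proof.
move=> xy; have := enormD (x - y) y; rewrite subrK => /le_trans; apply.
by rewrite addrC lerD// enorm_le_jbracket.
Qed.

(** Where <a> >= rho = (delta / delta')^(1/(p - p')) the ball of radius delta
    <a>^-p lies in the one of radius delta' <a>^-p'. Points covered from the
    remaining [a] lie in the ball of radius rho + delta, which by compactness
    has a finite cover that does not depend on [A]. *)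
Lemma finite_net p p' delta delta' : 0 <= p -> p' < p -> 0 < delta -> 0 < delta' ->
  exists s : seq V, forall A, pdense p delta A -> pdense p' delta' (A `|` [set` s]).
Proof.
move=> p0 pp del0 del0'.
pose rho := (delta / delta') `^ (p - p')^-1.
have rho0 : 0 <= rho by exact: powR_ge0.
have jN0 y (r : R) : 0 < jbracket y `^ r by rewrite powR_gt0// jbracket_gt0.
have [s hs] := @eball_finite_cover (rho + delta) (fun z => delta' * jbracket z `^ (- p'))
  (fun z => mulr_gt0 del0' (jN0 z _)).
exists s => A pA; apply/seteqP; split=> // y _.
have [a Aa ya] : (\bigcup_(x in A) eball x (delta * jbracket x `^ (- p))) y by rewrite pA.
have [ra|ra] := leP rho (jbracket a).
  exists a; first by left.
  rewrite /eball/= in ya *; apply: (lt_le_trans ya).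
  have h : delta / delta' <= jbracket a `^ (p - p').
    have -> : delta / delta' = rho `^ (p - p').
      by rewrite /rho -powRrM mulVf ?subr_eq0 ?gt_eqF// powRr1// divr_ge0 ?ltW.
    by rewrite ge0_ler_powR// ?nnegrE ?subr_ge0 ?(ltW pp)// ltW// jbracket_gt0.
  rewrite powRN ler_pdivrMr//.
  move: h; rewrite ler_pdivrMr// mulrC => /le_trans; apply.
  rewrite -mulrA ler_wpM2l ?(ltW del0')//.
  have E : jbracket a `^ (- p' + p) = jbracket a `^ (- p') * jbracket a `^ p.
    by rewrite powRD// (gt_eqF (jbracket_gt0 _)) implybT.
  by rewrite -E addrC.
have [|z zs zy] := hs y.
  rewrite (le_trans (@jbracket_le_enorm y a delta _))//; last by rewrite lerD2r ltW.
  rewrite (le_trans (ltW ya))// powRN ler_pdivrMr// ler_peMr ?(ltW del0)//.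
  exact: jbracket_powR_ge1.
by exists z => //; right.
Qed.

Lemma pdenseS p delta delta' A : delta <= delta' -> pdense p delta A -> pdense p delta' A.
Proof.
move=> dd pA; apply/seteqP; split=> // y _.
have [a Aa ya] : (\bigcup_(x in A) eball x (delta * jbracket x `^ (- p))) y by rewrite pA.
by exists a => //; rewrite /eball/= in ya *; rewrite (lt_le_trans ya)// ler_wpM2r ?powR_ge0.
Qed.

Lemma enorm_delta (i : 'I_d) : enorm (delta_mx ord0 i : V) = 1.
Proof.
rewrite /enorm /dotp (bigD1 i)//= big1 => [|j ji]; rewrite mxE eqxx/=.
  by rewrite eqxx mulr1 addr0 sqrtr1.
by rewrite (negbTE ji) mul0r.
Qed.

Lemma enormBA x y z : enorm (x - z) <= enorm (x - y) + enorm (y - z).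
Proof. by have := enormD (x - y) (y - z); rewrite addrA subrK. Qed.

Lemma pdense_cover p delta A y : pdense p delta A ->
  exists2 a, A a & enorm (y - a) < delta * jbracket a `^ (- p).
Proof.
move=> pA; have [a Aa ya] : (\bigcup_(x in A) eball x (delta * jbracket x `^ (- p))) y by rewrite pA.
by exists a.
Qed.

Lemma radius_le p delta x : 0 <= p -> 0 < delta -> delta * jbracket x `^ (- p) <= delta.
Proof.
move=> p0 del0; rewrite powRN ler_pdivrMr ?powR_gt0 ?jbracket_gt0//.
by rewrite ler_peMr ?(ltW del0)// jbracket_powR_ge1.
Qed.

(** Points of [A] next to the multiples L, 2 L, 3 L, ... of a unit vector,
    with L >= 5 delta. *)
Lemma separated_points p delta A : (0 < d)%N -> 0 <= p -> 0 < delta -> pdense p delta A ->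
  exists a : nat -> V, [/\ forall i, A (a i), forall i, 2 * delta <= enorm (a i) &
    forall i j, i != j -> 2 * delta < enorm (a i - a j)].
Proof.
move=> dpos p0 del0 pA.
have [e e1] : exists e : V, enorm e = 1 by exists (delta_mx ord0 (Ordinal dpos)); exact: enorm_delta.
have [L hL] : exists L : R, 5 * delta <= L by exists (5 * delta).
have L0 : 0 < L by apply: lt_le_trans hL; rewrite mulr_gt0.
have [X XL XX] : exists2 X : nat -> V, forall i, L <= enorm (X i) &
    forall i j, i != j -> L <= enorm (X i - X j).
  exists (fun i => (L * i.+1%:R) *: e) => [i|i j ij].
    by rewrite enormZ e1 mulr1 gtr0_norm ?mulr_gt0//; apply: ler_peMr; rewrite ?ler1n// ltW.
  rewrite -scalerBl enormZ e1 mulr1 -mulrBr normrM (gtr0_norm L0).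
  apply: ler_peMr; first exact: ltW.
  wlog: i j ij / (i < j)%N => [H|lij].
    by move: ij; rewrite neq_ltn => /orP[] h; [|rewrite distrC]; apply: H; rewrite ?neq_ltn ?h ?orbT.
  rewrite distrC ger0_norm ?subr_ge0 ?ler_nat 1?ltnW//.
  by rewrite lerBrDr addrC natr1 ler_nat ltnS.
have [a aP] : exists a : nat -> V, forall i, A (a i) /\ enorm (X i - a i) < delta.
  have near_X i : exists b, A b /\ enorm (X i - b) < delta.
    have [b Ab hb] := pdense_cover (X i) pA.
    by exists b; split=> //; exact: lt_le_trans hb (radius_le b p0 del0).
  by exists (fun i => projT1 (cid (near_X i))) => i; exact: projT2 (cid (near_X i)).
exists a; split=> [i|i|i j ij]; first by have [] := aP i.
  have := enormD (X i - a i) (a i); rewrite subrK; have := XL i; have [_] := aP i.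
  move: (enorm _) (enorm _) (enorm _) => u v w; clear -hL del0; lra.
have := enormBA (X i) (a i) (X j); have := enormBA (a i) (a j) (X j).
have [_] := aP i; have [_] := aP j; have := XX i j ij.
rewrite [enorm (a j - X j)]enorm_distC.
move: (enorm _) (enorm _) (enorm _) (enorm _) (enorm _) => u v w r s.
clear -hL del0; lra.
Qed.

(** Let [y] be covered by a removed point [b], and let [z] be at distance
    exactly the radius [r] of [b] from [b]. The ball of [b] is open, so [z]
    is covered by another point [b'] of [A]. It is within 2 delta of [b], so
    it is not removed, and |b'| <= 2 |b|, so its radius is at least r / 2^p.
    Passing through [b] and [z], the distance from [y] to [b'] is less than 2
    r plus the radius of [b']. *)
Lemma sparse_removal p delta A : (0 < d)%N -> 0 <= p -> 0 < delta -> pdense p delta A ->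
  exists a : nat -> V, [/\ injective a, forall i, A (a i) &
    pdense p ((2 * 2 `^ p + 1) * delta) (A `\` range a)].
Proof.
move=> dpos p0 del0 pA; have [a [Aa far aa]] := separated_points dpos p0 del0 pA.
have [e e1] : exists e : V, enorm e = 1 by exists (delta_mx ord0 (Ordinal dpos)); exact: enorm_delta.
have a_inj : injective a.
  move=> i j ij; apply/eqP; apply: contraT => /aa; rewrite ij subrr.
  by rewrite -(scale0r (0 : V)) enormZ normr0 mul0r ltNge mulr_ge0 ?ltW.
exists a; split=> //; apply/seteqP; split=> // y _.
have [b Ab yb] := pdense_cover y pA.
have c0 : 0 < 2 `^ p :> R by rewrite powR_gt0.
have [[i _ ib]|nb] := pselect (range a b); last first.
  exists b => //; rewrite /eball/= (lt_le_trans yb)// ler_wpM2r ?powR_ge0//.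
  by rewrite ler_peMl ?(ltW del0)// lerDr mulr_ge0// ltW.
have [r rE] : exists r, r = delta * jbracket b `^ (- p) by exists (delta * jbracket b `^ (- p)).
have r0 : 0 < r by rewrite rE mulr_gt0// powR_gt0// jbracket_gt0.
have [z zb] : exists z, enorm (z - b) = r.
  by exists (b + r *: e); rewrite addrC addKr enormZ e1 mulr1 gtr0_norm.
have [b' Ab' zb'] := pdense_cover z pA.
have bb' : enorm (b' - b) <= 2 * delta.
  apply: (le_trans (enormBA b' z b)); rewrite zb (enorm_distC b' z) mulr2n mulrDl mul1r.
  apply: lerD; first exact: ltW (lt_le_trans zb' (radius_le b' p0 del0)).
  by rewrite rE radius_le.
have nb' : ~ range a b'.
  move=> [j _ jb']; have [ij|/aa] := eqVneq j i.
    by move: zb'; rewrite -jb' ij ib zb rE ltxx.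
  by rewrite ib jb' ltNge bb'.
have h : enorm b' <= 2 * enorm b.
  have := enormD (b' - b) b; rewrite subrK => /le_trans; apply.
  rewrite [leRHS](_ : _ = enorm b + enorm b); last by ring.
  rewrite lerD2r (le_trans bb')//.
  by rewrite -ib.
have jb' : jbracket b' <= 2 * jbracket b.
  have jE w : jbracket w ^+ 2 = 1 + enorm w ^+ 2 by rewrite /jbracket sqr_sqrtr// addr_ge0// sqr_ge0.
  rewrite -(@ler_pXn2r _ 2)// ?nnegrE ?mulr_ge0// ?(ltW (jbracket_gt0 _))// exprMn !jE.
  have : enorm b' ^+ 2 <= (2 * enorm b) ^+ 2 by rewrite ler_pXn2r ?nnegrE ?mulr_ge0 ?enorm_ge0.
  by rewrite exprMn mulrDr => h2; rewrite lerD// mulr1 -natrX ler1n.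
have rr : r <= 2 `^ p * (delta * jbracket b' `^ (- p)).
  have hp : jbracket b' `^ p <= 2 `^ p * jbracket b `^ p.
    rewrite -powRM ?(ltW (jbracket_gt0 _))//.
    by rewrite ge0_ler_powR// ?nnegrE ?mulr_ge0// ?(ltW (jbracket_gt0 _)).
  rewrite rE !powRN; move: hp.
  have := powR_gt0 p (jbracket_gt0 b); have := powR_gt0 p (jbracket_gt0 b').
  move: (jbracket b' `^ p) (jbracket b `^ p) (2 `^ p) => u w c u0 w0 uw.
  rewrite mulrA ler_pdivrMr// mulrAC ler_pdivlMr//.
  by rewrite [c * delta]mulrC -mulrA ler_wpM2l ?(ltW del0).
exists b'; first by split.
rewrite /eball /=.
apply: (le_lt_trans (enormBA y b b')).
apply: (le_lt_trans (lerD (lexx _) (enormBA b z b'))).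
rewrite (enorm_distC b z) zb -[X in _ < X]mulrA; move: yb; rewrite -rE => yb; move: yb zb' rr.
move: (enorm _) (enorm _) (delta * _) (2 `^ p) => u v w c; clear; nra.
Qed.
End Nets.

(** * Kernel and cokernel *)

Section Main.
Variables (R : realType) (d : nat).
Local Notation V := 'rV[R]_d.
Implicit Types (x y z xi : V) (A B : set V) (p q delta : R) (f g : V -> R[i]).

Lemma FAB_eq0 A B f : FAB A B f = 0 <->
  (forall x, A x -> f x = 0) /\ (forall xi, B xi -> fourier f xi = 0).
Proof.
split=> [h|[fA fB]].
  split=> [x Ax|x Bx].
    by have /(congr1 (fun k => k.1 (SigSub (mem_set Ax)))) := h.
  by have /(congr1 (fun k => k.2 (SigSub (mem_set Bx)))) := h.
congr pair; apply/funext => a.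
  by apply: fA; exact: set_valP.
by apply: fB; exact: set_valP.
Qed.

(** The functionals are the evaluations at one finite net and those of the
    transform at another: they make the uniqueness theorem applicable for
    exponents t p and t q with t < 1. *)
Lemma dense_functionals p q delta : 0 < p -> 0 < q -> 1 < p * q -> 0 < delta ->
  exists N (L : 'I_N -> (V -> R[i]) -> R[i]),
  (forall j (c : R[i]) f g, schwartz f -> schwartz g -> L j (c *: f + g) = c * L j f + L j g) /\
  forall A B, pdense p delta A -> pdense q delta B -> forall f, schwartz f ->
    (forall x, A x -> f x = 0) -> (forall xi, B xi -> fourier f xi = 0) ->
    (forall j, L j f = 0) -> f = 0.
Proof.
move=> p0 q0 pq1 del0; pose r := (p * q)^-1; pose t := (1 + r) / 2.
have pq0 : 0 < p * q := lt_trans ltr01 pq1.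
have r1 : r < 1 by rewrite invf_lt1.
have r0 : 0 < r by rewrite invr_gt0.
have t0 : 0 < t by rewrite /t; lra.
have t1 : t < 1 by rewrite /t; lra.
(* t is the mean of 1 and r = 1/(p q), and the arithmetic mean exceeds the
   geometric mean: t^2 > r. *)
have tpq : 1 < (t * p) * (t * q).
  have -> : (t * p) * (t * q) = t ^+ 2 * (p * q) by ring.
  rewrite -ltr_pdivrMr// div1r -/r /t; move: r r1 {r0 t0 t1} @t => s s1 _.
  rewrite -subr_gt0 (_ : _ - s = (1 - s) ^+ 2 / 4); last by field.
  by rewrite divr_gt0// exprn_gt0// subr_gt0.
have [delta0 del00 uniq] := @schwartz_uniqueness R d _ _ (mulr_gt0 t0 p0) (mulr_gt0 t0 q0) tpq.
have lt_t (s : R) : 0 < s -> t * s < s by move=> s0; rewrite gtr_pMl.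
have [sA hA] := @finite_net R d p (t * p) delta delta0 (ltW p0) (lt_t p p0) del0 del00.
have [sB hB] := @finite_net R d q (t * q) delta delta0 (ltW q0) (lt_t q q0) del0 del00.
exists (size sA + size sB)%N, (fun j f => if (j < size sA)%N then f (nth 0 sA j)
  else fourier f (nth 0 sB (j - size sA))); split.
  by move=> j c f g sf sg; case: ifP => _; [|exact: fourier_lin].
move=> A B pA pB f sf fA fB fL; apply/funext => x.
apply: (uniq delta0 _ _ del00 (lexx _) (hA A pA) (hB B pB) f sf) => [y [/fA//|ys]|y [/fB//|ys]].
  have ji : (index y sA < size sA + size sB)%N by rewrite ltn_addr// index_mem.
  have := fL (Ordinal ji); rewrite /= index_mem ifT ?nth_index//.
have ji : (size sA + index y sB < size sA + size sB)%N by rewrite ltn_add2l index_mem.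
have := fL (Ordinal ji); rewrite /= ltnNge leq_addr/= addnC addnK nth_index//.
Qed.

Lemma pair_sum_fst (A B : set V) n (c : 'I_n -> R[i]) (u : 'I_n -> (A -> R[i]) * (B -> R[i])) (x : A) :
  (\sum_i c i *: u i).1 x = \sum_i c i * (u i).1 x.
Proof.
elim: (index_enum _) => [|i s IH]; first by rewrite !big_nil.
by rewrite !big_cons -IH.
Qed.

Lemma pair_sum_snd (A B : set V) n (c : 'I_n -> R[i]) (u : 'I_n -> (A -> R[i]) * (B -> R[i])) (x : B) :
  (\sum_i c i *: u i).2 x = \sum_i c i * (u i).2 x.
Proof.
elim: (index_enum _) => [|i s IH]; first by rewrite !big_nil.
by rewrite !big_cons -IH.
Qed.

Lemma fct_sum n (c : 'I_n -> R[i]) (f : 'I_n -> V -> R[i]) x :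
  (\sum_i c i *: f i) x = \sum_i c i * f i x.
Proof.
elim: (index_enum _) => [|i s IH]; first by rewrite !big_nil.
by rewrite !big_cons -IH.
Qed.

Lemma sum_lin (L : (V -> R[i]) -> R[i]) :
  (forall (c : R[i]) f g, schwartz f -> schwartz g -> L (c *: f + g) = c * L f + L g) ->
  forall n (c : 'I_n -> R[i]) (f : 'I_n -> V -> R[i]), (forall i, schwartz (f i)) ->
  L (\sum_i c i *: f i) = \sum_i c i * L (f i).
Proof.
move=> LL n c f sf.
suff : schwartz (\sum_i c i *: f i) /\ L (\sum_i c i *: f i) = \sum_i c i * L (f i) by case.
elim: (index_enum _) => [|i s [IH1 IH2]]; rewrite !(big_nil, big_cons).
  split; first exact: schwartz0.
  have := LL (-1) _ _ (@schwartz0 R d) (@schwartz0 R d).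
  by rewrite scaler0 addr0 mulN1r addNr.
by split; [exact: schwartz_lin|rewrite LL// IH2].
Qed.

(** Given representatives [u j] that span the cokernel, every indicator [e i]
    of a removed point is the image of some [f i] plus sum_j c_ij u_j. There
    are more indices [i] than equations in [hl], so some nonzero [l] cancels
    the [u j] and all functionals; F = sum_i l_i f_i then vanishes on the
    thinned set and is 0, while F(a_i) = l_i. *)
Lemma coker_infinite p q delta A B : (0 < d)%N -> 0 < p -> 0 < q -> 1 < p * q -> 0 < delta ->
  pdense p delta A -> pdense q delta B ->
  ~ quotient_finite_dim (FAB_target A B) (FAB_image A B).
Proof.
move=> dpos p0 q0 pq1 del0 pA pB [n [u [Uu span]]].
pose delta' := (2 * 2 `^ p + 1) * delta.
(* One set of functionals is needed for both density constants, so [B] is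
   regarded as (q, delta')-dense too. *)
have c1 : 1 <= 2 * 2 `^ p + 1 :> R by rewrite lerDr mulr_ge0// powR_ge0.
have dd : delta <= delta' by rewrite /delta' ler_peMl// ltW.
have [N [L [LL hL]]] := dense_functionals p0 q0 pq1 (lt_le_trans del0 dd).
have [a [a_inj Aa pA']] := sparse_removal dpos (ltW p0) del0 pA.
pose e (i : 'I_(n + N).+1) : (A -> R[i]) * (B -> R[i]) :=
  (fun x : A => ((set_val x : V) == a i)%:R : R[i], fun=> 0).
have normc0 : Normc.normc (0 : R[i]) = 0 := @Normc.normc0 R.
have normc1 : Normc.normc (1 : R[i]) = 1 := @Normc.normc1 R.
have eU i : FAB_target A B (e i).
  split=> j; last by exists 0 => b; rewrite -[(e i).2 b]/(0 : R[i]) normc0 mul0r.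
  exists (jbracket (a i) ^+ j) => x.
  rewrite -[(e i).1 x]/(((set_val x : V) == a i)%:R : R[i]); have [->|_] := eqVneq (set_val x) (a i).
    by rewrite normc1 mul1r.
  by rewrite normc0 mul0r exprn_ge0// ltW// jbracket_gt0.
pose c i := projT1 (cid (span _ (eU i))).
have cW i : FAB_image A B (e i - \sum_j c i j *: u j) := projT2 (cid (span _ (eU i))).
pose f i := projT1 (cid2 (cW i)).
have sf i : schwartz (f i) by rewrite /f; case: cid2.
have fE i : FAB A B (f i) = e i - \sum_j c i j *: u j by rewrite /f; case: cid2.
have fA i (x : A) : f i (set_val x) = (set_val x == a i)%:R - \sum_j c i j * (u j).1 x.
  by rewrite -pair_sum_fst; have /(congr1 (fun k => k.1 x)) := fE i.
have fB i (x : B) : fourier (f i) (set_val x) = - \sum_j c i j * (u j).2 x.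
  rewrite -pair_sum_snd; have /(congr1 (fun k => k.2 x)) := fE i.
  by rewrite /= => ->; rewrite -[LHS]/(0 - _) sub0r.
have [l [i0 li0] hl] := dependent_rows
  (row_mx (\matrix_(i, j) c i j) (\matrix_(i, j) L j (f i))) (leqnn (n + N).+1).
have lc j : \sum_i l i * c i j = 0.
  by rewrite -[RHS](hl (lshift N j)); apply: eq_bigr => i _; rewrite row_mxEl mxE.
have lL j : \sum_i l i * L j (f i) = 0.
  by rewrite -[RHS](hl (rshift n j)); apply: eq_bigr => i _; rewrite row_mxEr mxE.
have swap (w : 'I_n -> R[i]) : \sum_i l i * (\sum_j c i j * w j) = 0.
  under eq_bigr do rewrite mulr_sumr.
  rewrite exchange_big/= big1// => j _.
  by under eq_bigr do rewrite mulrA; rewrite -mulr_suml lc mul0r.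
pose F := \sum_i l i *: f i.
have [sF FF] := schwartz_sum_lin l sf.
have FA (x : A) : F (set_val x) = \sum_i l i * (set_val x == a i)%:R.
  rewrite /F fct_sum; under eq_bigr do rewrite fA mulrBr.
  by rewrite sumrB swap subr0.
have F0 : F = 0.
  apply: (hL _ _ pA' (pdenseS dd pB) F sF).
  - move=> x [Ax nx]; have := FA (SigSub (mem_set Ax)).
    rewrite -[set_val _]/x => ->; rewrite big1// => i _.
    by case: eqP => [xa|_]; rewrite ?mulr0//; case: nx; exists i.
  - move=> xi Bx; rewrite FF.
    transitivity (\sum_i l i * - \sum_j c i j * (u j).2 (SigSub (mem_set Bx))).
      by apply: eq_bigr => i _; rewrite -fB.
    by under eq_bigr do rewrite mulrN; rewrite sumrN swap oppr0.
  - by move=> j; rewrite /F (sum_lin (LL j))// lL.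
have := FA (SigSub (mem_set (Aa i0))); rewrite F0 -[set_val _]/(a i0).
rewrite (bigD1 i0)//= eqxx mulr1 big1 ?addr0; last first.
  by move=> i ii0; rewrite (inj_eq a_inj) eq_sym (inj_eq val_inj) (negbTE ii0) mulr0.
by move=> /esym/eqP; rewrite (negbTE li0).
Qed.
End Main.

Theorem theorem1p4 (R : realType) (d : nat) (p q : R) :
  (1 <= d)%N -> 0 < p -> 0 < q -> 1 < p * q ->
  (forall delta : R, 0 < delta ->
     exists C : nat, forall A B : set 'rV[R]_d,
       closed_discrete A -> closed_discrete B ->
       pdense p delta A -> pdense q delta B ->
       dim_le (FAB_ker A B) C /\
       ~ quotient_finite_dim (FAB_target A B) (FAB_image A B)) /\
  (exists delta0 : R, 0 < delta0 /\
     forall delta : R, 0 < delta -> delta <= delta0 ->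
       forall A B : set 'rV[R]_d,
         closed_discrete A -> closed_discrete B ->
         pdense p delta A -> pdense q delta B ->
         set_inj schwartz (FAB A B)).
Proof.
move=> dpos p0 q0 pq1; split.
  move=> delta del0; have [N [L [LL hL]]] := @dense_functionals R d p q delta p0 q0 pq1 del0.
  exists N => A B _ _ pA pB; split; last exact: coker_infinite pA pB.
  apply: (@dim_le_of_functionals _ _ _ _ L).
  - split; first exact: schwartz0.
    apply/FAB_eq0; split=> // xi _; have := fourier_lin (-1) xi (@schwartz0 R d) (@schwartz0 R d).
    by rewrite scaler0 addr0 mulN1r addNr.
  - move=> c f g [sf /FAB_eq0[fA fB]] [sg /FAB_eq0[gA gB]]; split; first exact: schwartz_lin.
    apply/FAB_eq0; split=> x hx.
      by rewrite -[LHS]/(c * f x + g x) fA// gA// mulr0 addr0.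
    by rewrite fourier_lin// fB// gB// mulr0 addr0.
  - by move=> j c f g [sf _] [sg _]; exact: LL.
  - by move=> f [sf /FAB_eq0[fA fB]]; exact: hL pA pB f sf fA fB.
have [delta0 del00 uniq] := @schwartz_uniqueness R d p q p0 q0 pq1.
exists delta0; split=> // delta del0 dd A B _ _ pA pB f g /set_mem sf /set_mem sg fg.
have sh := schwartz_lin (-1) sg sf.
suff h0 x : (-1 *: g + f) x = 0.
  apply/funext => x; have := h0 x; rewrite -[LHS]/(-1 * g x + f x) mulN1r addrC => /eqP.
  by rewrite subr_eq0 => /eqP.
apply: (uniq _ _ _ del0 dd pA pB _ sh) => y hy.
  have E : f y = g y := congr1 (fun k => k.1 (SigSub (mem_set hy))) fg.
  by rewrite -[LHS]/(-1 * g y + f y) E mulN1r addNr.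
have E : fourier f y = fourier g y := congr1 (fun k => k.2 (SigSub (mem_set hy))) fg.
by rewrite fourier_lin// E mulN1r addNr.
Qed.
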